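(* Let $p\in\{1,2\}$, let $f(x)=\mathbb{E}_\xi[F(x,\xi)]$ satisfy the assumptions listed in the context and in addition be $\mu_p$-strongly convex w.r.t. $\|\cdot\|_p$, and let the RDDsc method (described in the context) be applied to the problem $\min_{x\in\mathbb{R}^n}f(x)$ with $K\ge1$ outer iterations. Then its output $u_K$ satisfies $$\mathbb{E}f(u_K)-f^*\le\frac{\mu_pR_p^2}{2}\cdot2^{-K}+2\Delta,$$ where $$\Delta=\frac{n}{12L_2}\Delta_\zeta+\frac{4n}{3L_2}\Delta_\eta^2+\frac{8\sqrt{2nR_p^2\Omega_p}}{N_0}\left(\frac{\sqrt{\Delta_\zeta}}{2}+2\Delta_\eta\right)+\frac{N_0}{3L_2\rho_n}\left(\frac{\sqrt{\Delta_\zeta}}{2}+2\Delta_\eta\right)^2 .$$ Moreover, for a target accuracy $\varepsilon>0$, under an appropriate choice of $\Delta_\zeta$ and $\Delta_\eta$ such that $2\Delta\le\varepsilon/2$, the oracle complexity (total number of evaluations of the noisy directional derivative $\tilde f'$) to achieve $\varepsilon$-accuracy of the solution, $\mathbb{E}f(u_K)-f^*\le\varepsilon$, is $$\widetilde O\left(\max\left\{\frac{n^{\frac2q}L_2\Omega_p}{\mu_p}\log_2\frac{\mu_pR_p^2}{\varepsilon},\ \frac{n^{\frac2q}\sigma^2\Omega_p}{\mu_p\varepsilon}\right\}\right).$$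
   Context: Problem. $n\ge 8$; $\xi$ is a random vector with distribution $P$ on $\mathcal{X}$; for $P$-almost every $\xi$ the function $F(\cdot,\xi):\mathbb{R}^n\to\mathbb{R}$ is closed and convex and has gradient $g(x,\xi)$ that is $L(\xi)$-Lipschitz in the Euclidean norm, with $\sqrt{\mathbb{E}_\xi L(\xi)^2}\le L_2<+\infty$, $L_2>0$. Then $\mathbb{E}_\xi g(x,\xi)=\nabla f(x)$ and $\nabla f$ is $L_2$-Lipschitz in the Euclidean norm. Also $\mathbb{E}_\xi\|g(x,\xi)-\nabla f(x)\|_2^2\le\sigma^2$ for all $x$. $x_*$ denotes the minimizer of $f$ and $f^*=f(x_* )$. $\mu_p$-strong convexity ($\mu_p>0$): $f(y)\ge f(x)+\langle\nabla f(x),y-x\rangle+\frac{\mu_p}2\|y-x\|_p^2$. Oracle. Let $S_2(1)$ be the unit Euclidean sphere centered at $0$ in $\mathbb{R}^n$, and write $e\in RS_2(1)$ for $e$ uniformly distributed on $S_2(1)$. For $x\in\mathbb{R}^n$, $e\in S_2(1)$ and $\xi$ drawn independently from $P$, the oracle returns $\tilde f'(x,\xi,e)=\langle g(x,\xi),e\rangle+\zeta(x,\xi,e)+\eta(x,\xi,e)$, where $\mathbb{E}_\xi(\zeta(x,\xi,e))^2\le\Delta_\zeta$ for all $x,e$, and $|\eta(x,\xi,e)|\le\Delta_\eta$ for all $x,e$ and almost surely in $\xi$; $\Delta_\zeta,\Delta_\eta$ are controlled and can be made as small as desired. Proximal setup. $\frac1p+\frac1q=1$ (so $q=\infty$ for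 $p=1$, $q=2$ for $p=2$). For $p=1$: $d(x)=\frac{\Omega_1}{2}\|x\|_\kappa^2$ with $\kappa=1+\frac1{\ln n}$, $\Omega_1=\mathrm{e}\,n^{(\kappa-1)(2-\kappa)/\kappa}\ln n$. For $p=2$: $d(x)=\frac12\|x\|_2^2$, $\Omega_2=1$. In both cases $d$ is 1-strongly convex w.r.t. $\|\cdot\|_p$. For a prox-function $d$, the Bregman divergence is $V[z](x)=d(x)-d(z)-\langle\nabla d(z),x-z\rangle$. Put $\rho_n=\min\{q-1,\,16\ln n-8\}\,n^{\frac2q-1}$ (for $q=\infty$: $q-1=\infty$, $2/q=0$). RDD method (input: starting point $x_0$, prox-function, number of iterations $N$, batch size $m$). Put $\alpha=\frac1{48n\rho_nL_2}$. For $k=0,\dots,N-1$: draw $e_{k+1}\in RS_2(1)$ and independent realizations $\xi_1,\dots,\xi_m$ of $\xi$, independently of everything drawn before; compute $\widetilde\nabla^mf(x_k)=\frac1m\sum_{i=1}^m\tilde f'(x_k,\xi_i,e_{k+1})\,e_{k+1}$; set $x_{k+1}=\arg\min_{x\in\mathbb{R}^n}\{\alpha n\langle\widetilde\nabla^mf(x_k),x-x_k\rangle+V[x_k](x)\}$. Output $\bar x_N=\frac1N\sum_{k=0}^{N-1}x_k$. RDDsc method (input: $x_0$ with $\|x_0-x_*\|_p^2\le R_p^2$, $K\ge1$, $\mu_p$). Put $a=384n\rho_n$, $b=2$, $N_0=\left\lceil\frac{8aL_2\Omega_p}{\mu_p}\right\rceil$, $u_0=x_0$. For $k=0,\dots,K-1$: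 put $m_k=\max\left\{1,\left\lceil\frac{8b\sigma^22^k}{L_2\mu_pR_p^2}\right\rceil\right\}$, $R_k^2=R_p^22^{-k}+\frac{4\Delta}{\mu_p}(1-2^{-k})$ ($\Delta$ as in the claim), $d_k(x)=R_k^2\,d\left(\frac{x-u_k}{R_k}\right)$; run RDD from starting point $u_k$ with prox-function $d_k$ (and its Bregman divergence) for $N_0$ steps with batch size $m_k$; let $u_{k+1}=\bar x_{N_0}$ be its output. Output $u_K$. $\mathbb{E}$ is the expectation over all randomness. $\widetilde O$ hides polylogarithmic factors $(\ln n)^c$, $c>0$, and absolute constants.
   Formalization: The complexity bound is stated with ε replaced by min(ε, μ_pR_p²/2): for larger ε the printed formula fails (for σ=0 and ε≥μ_pR_p² it is ≤0, while K≥1 forces at least N_0 oracle calls). *)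

(* Defs.v *)
From HB Require Import structures.
From mathcomp Require Import all_boot all_order all_algebra.
From mathcomp Require Import all_classical all_reals all_analysis.

Set Implicit Arguments.
Unset Strict Implicit.
Unset Printing Implicit Defensive.

Import Order.TTheory GRing.Theory Num.Theory.
Import numFieldNormedType.Exports.

Local Open Scope classical_set_scope.
Local Open Scope ring_scope.

(* R^n with its Borel sigma-algebra. The carrier is convertible to 'rV[R]_n. *)
Notation borelRn R n := (g_sigma_algebraType (@open 'rV[R]_n)).

Section euclidean_space.
Context {R : realType} {n : nat}.
Implicit Types (x y z u v : 'rV[R]_n) (f d h : 'rV[R]_n -> R) (p : R).

Definition dotp u v : R := \sum_(i < n) u 0 i * v 0 i.

Definition pnorm p x : R := (\sum_(i < n) `|x 0 i| `^ p) `^ p^-1.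

Definition unit_sphere : set 'rV[R]_n := [set x | pnorm 2 x = 1].

Definition grad f x : 'rV[R]_n := \row_(i < n) 'D_(delta_mx 0 i) f x.

Definition strongly_convex p (mu : R) f : Prop :=
  forall x y,
    f x + dotp (grad f x) (y - x) + mu / 2 * pnorm p (y - x) ^+ 2 <= f y.

Definition bregman d z x : R := d x - d z - dotp (grad d z) (x - z).

(* Some global minimizer of h if there is one, an arbitrary point otherwise. *)
Definition argmin h : 'rV[R]_n := get [set x | forall y, h x <= h y].

End euclidean_space.

Section proximal_setup.
Context {R : realType}.
Variables (n : nat) (p : R).

Definition conjugate_exponent : \bar R := hoelder_conjugate p%:E.

(* 2/q, which is 0 for q = +oo *)
Definition two_over_q : R := fine (2%:E / conjugate_exponent)%E.

Definition kappa : R := 1 + (ln n%:R)^-1.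

(* Only p = 1 and p = 2 are meant; the "else" branches are the case p = 2. *)
Definition Omega : R :=
  if p == 1 then
    expR 1 * n%:R `^ ((kappa - 1) * (2 - kappa) / kappa) * ln n%:R
  else 1.

Definition prox (x : 'rV[R]_n) : R :=
  if p == 1 then Omega / 2 * pnorm kappa x ^+ 2 else 2^-1 * pnorm 2 x ^+ 2.

Definition rho : R :=
  fine (Order.min (conjugate_exponent - 1) (16 * ln n%:R - 8)%:E)%E
  * n%:R `^ (two_over_q - 1).

End proximal_setup.

Section stochastic_setting.
Context {R : realType} {n : nat} {d : measure_display} {X : measurableType d}.
Variable P : probability X R.
Implicit Types (F : 'rV[R]_n -> X -> R) (g : 'rV[R]_n -> X -> 'rV[R]_n).
Implicit Types (zeta eta : 'rV[R]_n -> X -> 'rV[R]_n -> R).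

Definition objective F (x : 'rV[R]_n) : R := \int[P]_xi F x xi.

(* Measurability of g and L and integrability of the F(x, .) are implicit in
   the expectations that the setting uses. *)
Record stochastic_problem F g (L : X -> R) (L2 sigma : R) : Prop := {
  sp_integrable : forall x, P.-integrable [set: X] (EFin \o F x);
  sp_measurable_g : measurable_fun [set: borelRn R n * X]
    (fun z => g z.1 z.2 : borelRn R n);
  sp_measurable_L : measurable_fun [set: X] L;
  (* closed: the epigraph is closed *)
  sp_closed : {ae P, forall xi,
    closed [set z : 'rV[R]_n * R | F z.1 xi <= z.2]};
  sp_convex : {ae P, forall xi, convex_function [set: 'rV[R]_n] (F ^~ xi)};
  sp_gradient : {ae P, forall xi, forall x,
    differentiable (F ^~ xi) x /\ grad (F ^~ xi) x = g x xi};
  sp_lipschitz : {ae P, forall xi, forall x y,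
    pnorm 2 (g x xi - g y xi) <= L xi * pnorm 2 (x - y)};
  sp_L2 : (sqrte 'E_P[fun xi => (L xi ^+ 2)%R] <= L2%:E)%E;
  sp_variance : forall x,
    ('E_P[fun xi => (pnorm 2 (g x xi - grad (objective F) x) ^+ 2)%R]
     <= (sigma ^+ 2)%:E)%E
}.

Definition noisy_oracle g zeta eta (x : 'rV[R]_n) (xi : X) (e : 'rV[R]_n) : R :=
  dotp (g x xi) e + zeta x xi e + eta x xi e.

Record oracle_noise zeta eta (Dzeta Deta : R) : Prop := {
  on_measurable_zeta : measurable_fun [set: borelRn R n * X * borelRn R n]
    (fun z => zeta z.1.1 z.1.2 z.2);
  on_measurable_eta : measurable_fun [set: borelRn R n * X * borelRn R n]
    (fun z => eta z.1.1 z.1.2 z.2);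
  on_zeta : forall x e, unit_sphere e ->
    ('E_P[fun xi => (zeta x xi e ^+ 2)%R] <= Dzeta%:E)%E;
  on_eta : forall x e, unit_sphere e ->
    {ae P, forall xi, `|eta x xi e| <= Deta}
}.

End stochastic_setting.

(* The uniform distribution on the unit sphere is the rotation-invariant
   probability measure carried by it. *)
Definition uniform_on_sphere {R : realType} {n : nat}
    (nu : set (borelRn R n) -> \bar R) : Prop :=
  nu unit_sphere = 1%E /\
  forall (Q : 'M[R]_n) (A : set (borelRn R n)), Q *m Q^T = 1%:M ->
    measurable A -> nu ((fun x : 'rV[R]_n => x *m Q) @^-1` A) = nu A.

Definition mutually_independent {R : realType} {d' : measure_display}
    {W : measurableType d'} (Pr : probability W R) {I : eqType}
    (G : I -> set_system W) : Prop :=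
  forall (J : seq I) (A : I -> set W), uniq J ->
    (forall i, i \in J -> G i (A i)) ->
    Pr (\bigcap_(i in [set` J]) A i) = (\prod_(i <- J) Pr (A i))%E.

Section sampling.
Context {R : realType} {n : nat} {d : measure_display} {X : measurableType d}.
Context {d' : measure_display} {W : measurableType d'}.
Variables (P : probability X R) (Pr : probability W R).
(* e k j is the direction and xi k j i the i-th realization of the j-th step of
   the k-th run of RDD, all indices starting from 0. *)
Variables (e : nat -> nat -> W -> 'rV[R]_n) (xi : nat -> nat -> nat -> W -> X).

Definition draw_events (a : nat * nat + nat * nat * nat) : set_system W :=
  match a with
  | inl (k, j) =>
      preimage_set_system [set: W] (e k j : W -> borelRn R n) measurable
  | inr (k, j, i) => preimage_set_system [set: W] (xi k j i) measurable
  end.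

Record sampling : Prop := {
  sa_measurable_e : forall k j,
    measurable_fun [set: W] (e k j : W -> borelRn R n);
  sa_measurable_xi : forall k j i, measurable_fun [set: W] (xi k j i);
  sa_law_e : forall k j,
    uniform_on_sphere (pushforward Pr (e k j : W -> borelRn R n));
  sa_law_xi : forall k j i A, measurable A -> pushforward Pr (xi k j i) A = P A;
  sa_independent : mutually_independent Pr draw_events
}.

End sampling.

Section rdd_method.
Context {R : realType} {n : nat} {X : Type}.
Variables (p L2 : R) (oracle : 'rV[R]_n -> X -> 'rV[R]_n -> R).

Definition batch_gradient (m : nat) (x : 'rV[R]_n) (xis : nat -> X)
    (e : 'rV[R]_n) : 'rV[R]_n :=
  m%:R^-1 *: \sum_(i < m) oracle x (xis i) e *: e.

Definition stepsize : R := (48 * n%:R * rho n p * L2)^-1.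

Fixpoint rdd_iterate (dprox : 'rV[R]_n -> R) (m : nat) (e : nat -> 'rV[R]_n)
    (xis : nat -> nat -> X) (x0 : 'rV[R]_n) (k : nat) : 'rV[R]_n :=
  if k is k'.+1 then
    let xk := rdd_iterate dprox m e xis x0 k' in
    argmin (fun x => stepsize * n%:R *
                       dotp (batch_gradient m xk (xis k') (e k')) (x - xk)
                     + bregman dprox xk x)
  else x0.

Definition rdd (dprox : 'rV[R]_n -> R) (N m : nat) (e : nat -> 'rV[R]_n)
    (xis : nat -> nat -> X) (x0 : 'rV[R]_n) : 'rV[R]_n :=
  N%:R^-1 *: \sum_(k < N) rdd_iterate dprox m e xis x0 k.

End rdd_method.

Section rddsc_method.
Context {R : realType}.
Variables (n : nat) (p L2 sigma mu Rp Dzeta Deta : R).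

(* the ceiling as a natural number, for nonnegative arguments *)
Definition natceil (x : R) : nat := `|Num.ceil x|%N.

Definition N0 : nat :=
  natceil (8 * (384 * n%:R * rho n p) * L2 * Omega n p / mu).

Definition batch_size (k : nat) : nat :=
  maxn 1 (natceil (8 * 2 * sigma ^+ 2 * 2 ^+ k / (L2 * mu * Rp ^+ 2))).

Definition noise_floor : R :=
  n%:R / (12 * L2) * Dzeta
  + 4 * n%:R / (3 * L2) * Deta ^+ 2
  + 8 * Num.sqrt (2 * n%:R * Rp ^+ 2 * Omega n p) / N0%:R
    * (Num.sqrt Dzeta / 2 + 2 * Deta)
  + N0%:R / (3 * L2 * rho n p) * (Num.sqrt Dzeta / 2 + 2 * Deta) ^+ 2.

Definition radius (k : nat) : R :=
  Num.sqrt (Rp ^+ 2 * 2 ^- k + 4 * noise_floor / mu * (1 - 2 ^- k)).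

Definition scaled_prox (k : nat) (u x : 'rV[R]_n) : R :=
  radius k ^+ 2 * prox p ((radius k)^-1 *: (x - u)).

Fixpoint rddsc {X : Type} (oracle : 'rV[R]_n -> X -> 'rV[R]_n -> R)
    (e : nat -> nat -> 'rV[R]_n) (xis : nat -> nat -> nat -> X)
    (x0 : 'rV[R]_n) (K : nat) : 'rV[R]_n :=
  if K is k.+1 then
    let uk := rddsc oracle e xis x0 k in
    rdd p L2 oracle (scaled_prox k uk) N0 (batch_size k) (e k) (xis k) uk
  else x0.

(* Each step of the k-th run of RDD evaluates the oracle batch_size k times. *)
Definition oracle_calls (K : nat) : nat := \sum_(k < K) N0 * batch_size k.

(* The argument of the O-bound. As K >= 1 forces at least N0 * batch_size 0
   calls, which do not depend on eps, it is evaluated at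
   eps <= mu * Rp ^+ 2 / 2 only, where the binary logarithm is at least 1. *)
Definition complexity_bound (eps : R) : R :=
  Num.max
    (n%:R `^ two_over_q p * L2 * Omega n p / mu
     * (ln (mu * Rp ^+ 2 / eps) / ln 2))
    (n%:R `^ two_over_q p * sigma ^+ 2 * Omega n p / (mu * eps)).

End rddsc_method.

(* Main.v *)
(* Write M = grad d^* for the gradient of the conjugate of the prox-function. A
   run of RDD from u is x_j = u + M y_j with y_0 = 0 and y_(j+1) = y_j - alpha n
   G_j, where G_j is the gradient estimate; its potential
   V_j = d(x_* - u) + d^*(y_j) - <y_j, x_* - u> dominates |x_j - x_*|_2^2 / 2.
   Smoothness of d^* in the q-norm, dual to the strong convexity of d, gives
   V_(j+1) <= V_j - alpha n <G_j, x_j - x_*> + (alpha n)^2 |G_j|_q^2 / 2.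
   Signed permutations preserve the uniform law of e on the sphere, so
   E <a, e> <b, e> = <a, b> / n and E <a, e>^2 |e|_q^2 = |a|_2^2 / n * E |e|_q^2,
   with E |e|_q^2 <= rho_n. Together with |grad f|_2^2 <= 4 L2 (f - min f) each step
   decreases the mean potential by 5/6 alpha (E f(x_j) - min f), up to the noise,
   whose linear part is absorbed by a growth factor 1 + 1 / (2 N_0) per step.
   Summing over a run, and bounding V_0 by the distance of u to x_*, hence by
   strong convexity by the gap at u, shows that every restart halves the gap. The
   complexity is the sum of the N_0 m_k over K = O(log (mu R^2 / eps)) restarts. *)
Require Import Defs.
From HB Require Import structures.
From mathcomp Require Import all_boot all_order all_algebra.
From mathcomp Require Import all_classical all_reals all_analysis.
From mathcomp Require Import perm measurable_realfun ring lra.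

Set Implicit Arguments.
Unset Strict Implicit.
Unset Printing Implicit Defensive.

Import Order.TTheory GRing.Theory Num.Theory.
Import numFieldNormedType.Exports.

Local Open Scope classical_set_scope.
Local Open Scope ring_scope.

(** * Euclidean space *)

(** Two features of the setting shape the proof. The method is given by [argmin], an arbitrary
    choice among minimizers, so each step must be shown to have a unique minimizer; once it is the
    explicit image [M y] of a dual point, measurability of the iterates with respect to the past is
    immediate. And no moment of the iterates is assumed finite: the integrability of the potential
    is carried along with its decrease. The potential bounds the squared distance to the minimizer,
    this bounds the gap, and the gap bounds the squared gradient. The randomness of one step is
    averaged in two different orders. For the gradient part all samples are put into the past and
    the direction is averaged first, because the batch mean of [g] does not involve the direction.
    For [zeta] and [eta] the direction is put into the past first, because they may depend on it and
    their moments are bounded for each fixed direction. The noise enters linearly in the distance to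
    the minimizer; Young's inequality with weights of order 1 / (alpha N_0) turns it into a multiple
    of the potential whose growth over a whole run stays below a constant factor. *)

Section dot_product.
Context {R : realType} {n : nat}.
Implicit Types (x y z : 'rV[R]_n) (a : R).

Lemma dotpC x y : dotp x y = dotp y x.
Proof. by apply: eq_bigr => i _; rewrite mulrC. Qed.

Lemma dotpDl x y z : dotp (x + y) z = dotp x z + dotp y z.
Proof. by rewrite -big_split/=; apply: eq_bigr => i _; rewrite mxE mulrDl. Qed.

Lemma dotpDr x y z : dotp z (x + y) = dotp z x + dotp z y.
Proof. by rewrite dotpC dotpDl !(dotpC z). Qed.

Lemma dotpZl a x y : dotp (a *: x) y = a * dotp x y.
Proof. by rewrite mulr_sumr; apply: eq_bigr => i _; rewrite mxE mulrA. Qed.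

Lemma dotpZr a x y : dotp x (a *: y) = a * dotp x y.
Proof. by rewrite dotpC dotpZl dotpC. Qed.

Lemma dotpNl x y : dotp (- x) y = - dotp x y.
Proof. by rewrite -scaleN1r dotpZl mulN1r. Qed.

Lemma dotpNr x y : dotp x (- y) = - dotp x y.
Proof. by rewrite dotpC dotpNl dotpC. Qed.

Lemma dotpBl x y z : dotp (x - y) z = dotp x z - dotp y z.
Proof. by rewrite dotpDl dotpNl. Qed.

Lemma dotpBr x y z : dotp z (x - y) = dotp z x - dotp z y.
Proof. by rewrite dotpDr dotpNr. Qed.

Lemma dotp0l x : dotp 0 x = 0.
Proof. by rewrite -(scale0r 0) dotpZl mul0r. Qed.

Lemma dotp0r x : dotp x 0 = 0.
Proof. by rewrite dotpC dotp0l. Qed.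

Lemma dotp_suml (I : Type) (r : seq I) (F : I -> 'rV[R]_n) y :
  dotp (\sum_(i <- r) F i) y = \sum_(i <- r) dotp (F i) y.
Proof.
by elim/big_rec2: _ => [|i s t _ <-]; rewrite ?dotp0l// dotpDl.
Qed.

Lemma dotpp_ge0 x : 0 <= dotp x x.
Proof. by apply: sumr_ge0 => i _; rewrite -expr2 sqr_ge0. Qed.

Lemma dotpp_eq0 x : dotp x x = 0 -> x = 0.
Proof.
move=> /eqP; rewrite psumr_eq0 => [/allP x0|i _]; last first.
  by rewrite -expr2 sqr_ge0.
apply/rowP => i; rewrite mxE.
by have := x0 i (mem_index_enum _); rewrite -expr2 expf_eq0/= => /eqP.
Qed.

Lemma dotp_delta x i : dotp x (delta_mx 0 i) = x 0 i.
Proof.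
rewrite /dotp (bigD1 i)//= mxE !eqxx mulr1 big1 ?addr0// => j /negPf ji.
by rewrite mxE ji andbF mulr0.
Qed.

Lemma dotp_delta_delta i : dotp (delta_mx 0 i : 'rV[R]_n) (delta_mx 0 i) = 1.
Proof. by rewrite dotp_delta mxE !eqxx. Qed.

Lemma dotpp_add x y : dotp (x + y) (x + y) = dotp x x + 2 * dotp x y + dotp y y.
Proof. by rewrite dotpDl !dotpDr (dotpC y x); ring. Qed.

Lemma dotp_cauchy_schwarz x y : dotp x y ^+ 2 <= dotp x x * dotp y y.
Proof.
have [y0|y0] := eqVneq (dotp y y) 0.
  by rewrite (dotpp_eq0 y0) !dotp0r expr0n mulr0.
have yp : 0 < dotp y y by rewrite lt_neqAle eq_sym y0 dotpp_ge0.
have := dotpp_ge0 (dotp y y *: x - dotp x y *: y).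
rewrite dotpBl !dotpBr !dotpZl !dotpZr (dotpC y x) => h.
rewrite -subr_ge0 -(pmulr_rge0 _ yp).
by rewrite (le_trans h)// le_eqVlt; apply/orP; left; apply/eqP; ring.
Qed.

Lemma coord_sqr_le x i : x 0 i ^+ 2 <= dotp x x.
Proof.
rewrite /dotp (bigD1 i)//= -expr2 lerDl sumr_ge0// => j _.
by rewrite -expr2 sqr_ge0.
Qed.

Lemma pnorm2_sqr x : pnorm 2 x ^+ 2 = dotp x x.
Proof.
rewrite /pnorm -powR_mulrn ?powR_ge0// -powRrM mulVf// powRr1; last first.
  by apply: sumr_ge0 => i _; rewrite powR_ge0.
by apply: eq_bigr => i _; rewrite powR_mulrn// real_normK ?num_real// expr2.
Qed.

Lemma unit_sphereE x : unit_sphere x <-> dotp x x = 1.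
Proof.
rewrite -pnorm2_sqr /unit_sphere/=; split=> [->|]; first by rewrite expr1n.
by move=> /eqP; rewrite sqrp_eq1 ?powR_ge0// => /eqP.
Qed.

(** On row vectors [|x|] is the maximum norm, that is the q-norm for p = 1. *)
Lemma norm_row_coord_le x i : `|x 0 i| <= `|x|.
Proof.
rewrite [leRHS]/Num.norm/= mx_normrE; apply/bigmax_geP; right => /=; by exists (0, i).
Qed.

Lemma norm_row_sqr_le x : `|x| ^+ 2 <= dotp x x.
Proof.
have [x0|/mx_norm_neq0[[i j] /= xE]] := eqVneq (mx_norm x) 0.
  by rewrite /Num.norm/= x0 expr0n dotpp_ge0.
rewrite {1}/Num.norm/= xE ord1 real_normK ?num_real//.
exact: coord_sqr_le.
Qed.

End dot_product.

Section borel_rows.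
Context {R : realType} {n : nat}.

Lemma continuous_measurable_borelRn (f : 'rV[R]_n -> R) :
  continuous f -> measurable_fun [set: borelRn R n] (f : borelRn R n -> R).
Proof.
move=> /continuousP cf; apply: (measurability _ (RGenOpens.measurableE R)).
move=> _ [_ [a [b ->] <-]]; rewrite setTI.
by apply: sub_sigma_algebra; apply: cf; exact: interval_open.
Qed.

Lemma measurable_coord (i : 'I_n) :
  measurable_fun [set: borelRn R n] (fun x : borelRn R n => (x : 'rV[R]_n) 0 i).
Proof. by apply: continuous_measurable_borelRn; exact: coord_continuous. Qed.

(** The sigma-algebra of [borelRn] is generated by the open sets, so the coordinates enter through a
    countable base: an open set is the union of the rational open cubes it contains, and the
    preimage of a cube is a finite intersection of coordinate conditions. *)
Lemma measurable_row d (T : measurableType d) (Y : T -> 'rV[R]_n) :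
  (forall i, measurable_fun [set: T] (fun w => Y w 0 i)) ->
  measurable_fun [set: T] (Y : T -> borelRn R n).
Proof.
move=> mY; apply: (measurability _ (erefl (@measurable _ (borelRn R n)))).
move=> _ [U oU <-]; rewrite setTI.
pose B (cq : 'rV[rat]_n * rat) : set 'rV[R]_n :=
  [set y | forall i, `|y 0 i - ratr (cq.1 0 i)| < ratr cq.2].
have UE : U = \bigcup_(cq in [set cq | B cq `<=` U]) B cq.
  apply/seteqP; split=> [y Uy|y [cq/= BU /BU]//].
  have [e /= e0 yU] : nbhs_ball y U by apply/nbhs_ballP; exact: open_nbhs_nbhs.
  (* With a rational radius below [e / 2], a cube that contains [y] lies in the ball of radius [e]
     around [y]. *)
  have [q qe] : exists q : rat, ratr q \in `]0, (e / 2)[.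
    by apply: rat_in_itvoo; rewrite divr_gt0.
  move: qe; rewrite in_itv/= => /andP[q0 qe].
  have cE i : exists c : rat, `|y 0 i - ratr c| < ratr q.
    have [c] : exists c : rat, ratr c \in `](y 0 i - ratr q), (y 0 i)[.
      by apply: rat_in_itvoo; rewrite gtrBl.
    rewrite in_itv/= => /andP[c1 c2]; exists c.
    by rewrite ger0_norm ?subr_ge0 ?ltW// ltrBlDr addrC -ltrBlDr.
  have [c cP] := choice cE.
  exists (\row_i c i, q); last by move=> i /=; rewrite mxE.
  move=> z /= zB; apply: yU; split=> // j i; rewrite ord1.
  rewrite /ball/= -(subrK (ratr (c i)) (y 0 i)) -addrA.
  rewrite (le_lt_trans (ler_normD _ _))// (splitr e) ltrD//.
    exact: lt_trans (cP i) qe.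
  by rewrite distrC; have := zB i; rewrite mxE => /lt_trans; apply.
rewrite UE preimage_bigcup bigcup_mkcond.
apply: countable_bigcupT_measurable => // cq; case: ifPn => // _.
rewrite [X in measurable X](_ : _ =
   \bigcap_(i in [set: 'I_n])
     [set w | `|Y w 0 i - ratr (cq.1 0 i)| < ratr cq.2]); last first.
  by apply/seteqP; split=> [w + i _|w + i]; apply.
apply: fin_bigcap_measurable => // i _.
rewrite -[X in measurable X]setTI.
apply: (@measurable_fun_ltr _ _ _ _ (fun w => `|Y w 0 i - ratr (cq.1 0 i)|)) => //.
apply: measurableT_comp => //; exact: measurable_funB.
Qed.

Lemma measurable_rowP d (T : measurableType d) (Y : T -> 'rV[R]_n) :
  measurable_fun [set: T] (Y : T -> borelRn R n) <->
  (forall i, measurable_fun [set: T] (fun w => Y w 0 i)).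
Proof.
split=> [mY i|]; last exact: measurable_row.
by apply: (measurableT_comp (measurable_coord i)).
Qed.

Lemma measurable_dotp d (T : measurableType d) (Y Z : T -> 'rV[R]_n) :
  measurable_fun [set: T] (Y : T -> borelRn R n) ->
  measurable_fun [set: T] (Z : T -> borelRn R n) ->
  measurable_fun [set: T] (fun w => dotp (Y w) (Z w)).
Proof.
move=> /measurable_rowP mY /measurable_rowP mZ.
by apply: measurable_sum => i; exact: measurable_funM.
Qed.

Lemma measurable_rowD d (T : measurableType d) (Y Z : T -> 'rV[R]_n) :
  measurable_fun [set: T] (Y : T -> borelRn R n) ->
  measurable_fun [set: T] (Z : T -> borelRn R n) ->
  measurable_fun [set: T] (fun w => Y w + Z w : borelRn R n).
Proof.
move=> /measurable_rowP mY /measurable_rowP mZ; apply/measurable_rowP => i.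
by under eq_fun do rewrite mxE; exact: measurable_funD.
Qed.

Lemma measurable_rowZ d (T : measurableType d) (a : T -> R) (Y : T -> 'rV[R]_n) :
  measurable_fun [set: T] a ->
  measurable_fun [set: T] (Y : T -> borelRn R n) ->
  measurable_fun [set: T] (fun w => a w *: Y w : borelRn R n).
Proof.
move=> ma /measurable_rowP mY; apply/measurable_rowP => i.
by under eq_fun do rewrite mxE; exact: measurable_funM.
Qed.

Lemma measurable_rowB d (T : measurableType d) (Y Z : T -> 'rV[R]_n) :
  measurable_fun [set: T] (Y : T -> borelRn R n) ->
  measurable_fun [set: T] (Z : T -> borelRn R n) ->
  measurable_fun [set: T] (fun w => Y w - Z w : borelRn R n).
Proof.
move=> mY mZ; under eq_fun do rewrite -scaleN1r; apply: measurable_rowD => //.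
exact: measurable_rowZ.
Qed.

Lemma measurable_row_sum d (T : measurableType d) (I : Type) (s : seq I)
    (Y : I -> T -> 'rV[R]_n) :
  (forall i, measurable_fun [set: T] (Y i : T -> borelRn R n)) ->
  measurable_fun [set: T] (fun w => \sum_(i <- s) Y i w : borelRn R n).
Proof.
move=> mY; apply/measurable_rowP => j.
under eq_fun do rewrite summxE.
by apply: measurable_sum => i; exact: (proj1 (measurable_rowP _) (mY i) j).
Qed.

End borel_rows.

(** * Integration and independence *)

Section integrable_real.
Context {R : realType} {d : measure_display} {T : measurableType d}.
Variable mu : {measure set T -> \bar R}.
Implicit Types f g h : T -> R.

(** The real-valued integral is [fine] of the extended one and is reliable only for integrable
    functions, so this predicate accompanies every mean below. *)
Definition integrableR f := mu.-integrable [set: T] (EFin \o f).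

Lemma integrableR_measurable f : integrableR f -> measurable_fun [set: T] f.
Proof. by move=> /measurable_int /measurable_EFinP. Qed.

Lemma integrableR_le f g : integrableR g -> measurable_fun [set: T] f ->
  (forall x, `|f x| <= g x) -> integrableR f.
Proof.
move=> ig mf fg; apply: le_integrable ig => //; first exact/measurable_EFinP.
by move=> x _; rewrite /= lee_fin (le_trans (fg x))// ler_norm.
Qed.

Lemma integrableRD f g : integrableR f -> integrableR g ->
  integrableR (fun x => f x + g x).
Proof.
by move=> jf jg; have := integrableD measurableT jf jg.
Qed.

Lemma integrableRB f g : integrableR f -> integrableR g ->
  integrableR (fun x => f x - g x).
Proof.
by move=> jf jg; have := integrableB measurableT jf jg.
Qed.

Lemma integrableRZ k f : integrableR f -> integrableR (fun x => k * f x).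
Proof. by move=> jf; have := integrableZl measurableT k jf. Qed.

Lemma integrableR0 : integrableR (fun=> 0).
Proof. exact: integrable0. Qed.

Lemma integrableR_sum (I : Type) (s : seq I) (h : I -> T -> R) :
  (forall i, integrableR (h i)) -> integrableR (fun x => \sum_(i <- s) h i x).
Proof.
move=> ih; elim: s => [|i s IH].
  by under eq_fun do rewrite big_nil; exact: integrableR0.
by under eq_fun do rewrite big_cons; exact: integrableRD.
Qed.

Lemma Rintegral_sum (I : Type) (s : seq I) (h : I -> T -> R) :
  (forall i, integrableR (h i)) ->
  \int[mu]_x (\sum_(i <- s) h i x) = \sum_(i <- s) \int[mu]_x h i x.
Proof.
move=> ih; elim: s => [|i s IH].
  under eq_Rintegral do rewrite big_nil.
  by rewrite big_nil /Rintegral integral0.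
under eq_Rintegral do rewrite big_cons.
by rewrite big_cons RintegralD ?IH//; [exact: ih|exact: (integrableR_sum s ih)].
Qed.

Lemma RintegralE f : integrableR f ->
  (\int[mu]_x f x)%:E = (\int[mu]_x (f x)%:E)%E.
Proof. by move=> jf; rewrite /Rintegral fineK//; exact: integrable_fin_num. Qed.

Lemma integrableR_ge0 f : measurable_fun [set: T] f -> (forall x, 0 <= f x) ->
  (\int[mu]_x (f x)%:E < +oo)%E -> integrableR f.
Proof.
move=> mf f0 fy; apply/integrableP; split; first exact/measurable_EFinP.
by under eq_integral do rewrite /= ger0_norm//.
Qed.

(** The difference [g - f] equals its positive part almost everywhere, and the latter is nonnegative
    everywhere, so that [integral_ge0] applies. *)
Lemma ae_le_Rintegral f g : integrableR f -> integrableR g ->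
  {ae mu, forall x, f x <= g x} -> \int[mu]_x f x <= \int[mu]_x g x.
Proof.
move=> jf jg fg; rewrite -subr_ge0 -RintegralB//.
have jgf := integrableRB jg jf.
rewrite -lee_fin RintegralE//.
rewrite (@ae_eq_integral _ _ _ mu setT (fun x => (Num.max (g x - f x) 0)%:E)) //.
- by apply: integral_ge0 => x _; rewrite lee_fin le_max lexx orbT.
- exact: measurable_int jgf.
- apply/measurable_EFinP; apply: measurable_maxr => //.
  exact: integrableR_measurable.
- apply: filterS fg => x fgx _; congr EFin.
  by rewrite (elimT max_idPl)// subr_ge0.
Qed.

Lemma ae_eq_Rintegral f g : measurable_fun [set: T] f ->
  measurable_fun [set: T] g -> {ae mu, forall x, f x = g x} ->
  \int[mu]_x f x = \int[mu]_x g x.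
Proof.
move=> mf mg fg; congr fine; apply: ae_eq_integral => //.
- exact/measurable_EFinP.
- exact/measurable_EFinP.
- by apply: filterS fg => x -> _.
Qed.

Lemma integrableR_ae_le f g : measurable_fun [set: T] f -> integrableR g ->
  {ae mu, forall x, `|f x| <= g x} -> integrableR f.
Proof.
move=> mf jg fg; have mg := integrableR_measurable jg.
apply/integrableP; split; first exact/measurable_EFinP.
case/integrableP: (jg) => _; apply: le_lt_trans.
apply: ae_ge0_le_integral => //.
- by apply/measurableT_comp => //; exact/measurable_EFinP.
- by apply/measurableT_comp => //; exact/measurable_EFinP.
- apply: filterS fg => x fgx _ /=; rewrite lee_fin (le_trans fgx)//.
  exact: ler_norm.
Qed.

End integrable_real.

Section probability_real.
Context {R : realType} {d : measure_display} {T : measurableType d}.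
Variable P : probability T R.

Lemma integrableR_cst (k : R) : integrableR P (fun=> k).
Proof. exact: finite_measure_integrable_cst. Qed.

Lemma Rintegral_prob_cst (k : R) : \int[P]_x k = k.
Proof. by rewrite Rintegral_cst// [fine _](_ : _ = 1) ?mulr1//= probability_setT. Qed.

Lemma integrableR_ae_bounded (f : T -> R) (C : R) : measurable_fun [set: T] f ->
  {ae P, forall x, `|f x| <= C} -> integrableR P f.
Proof. by move=> mf; exact/integrableR_ae_le/integrableR_cst. Qed.

(** Since |t| <= t^2 + 1 and constants are integrable for a probability. *)
Lemma integrableR_sqr (f : T -> R) : measurable_fun [set: T] f ->
  integrableR P (fun x => f x ^+ 2) -> integrableR P f.
Proof.
move=> mf jf; have jf1 := integrableRD jf (integrableR_cst 1).
apply: (integrableR_le jf1) => //.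
move=> x; rewrite ler_norml.
have := sqr_ge0 (f x + 1); have := sqr_ge0 (f x - 1); have := sqr_ge0 (f x).
rewrite !expr2; nra.
Qed.

End probability_real.

Section independence.
Context {R : realType} {d : measure_display} {W : measurableType d}.
Variable Pr : probability W R.

(** Dynkin's pi-lambda argument: finite intersections of events taken from the [G i] with [i] in [S]
    form a pi-system that generates the sigma-algebra, and the finite measures that send [E] to Pr
    (E and B) and to Pr B times Pr E agree on it. *)
Lemma mutually_independent_sigma {I : eqType} (G : I -> set_system W)
    (S : set I) (z : I) (A B : set W) :
  mutually_independent Pr G ->
  (forall i, G i `<=` measurable) -> (forall i, setI_closed (G i)) ->
  (forall i, G i setT) ->
  ~ S z -> <<s \bigcup_(i in S) G i >> A -> G z B ->
  Pr (A `&` B) = (Pr A * Pr B)%E.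
Proof.
move=> indep Gm GI GT Sz sA GB.
have mB : measurable B by exact: Gm GB.
pose C : set_system W := [set E | exists (J : seq I) (f : I -> set W),
  [/\ uniq J, forall i, i \in J -> S i, forall i, G i (f i)
    & E = \bigcap_(i in [set` J]) f i]].
have CE J (f : I -> set W) : uniq J -> (forall i, i \in J -> S i) ->
    (forall i, G i (f i)) -> C (\bigcap_(i in [set` J]) f i).
  by move=> *; exists J, f.
have Cm : C `<=` measurable.
  move=> _ [J [f [_ _ Gf ->]]]; apply: fin_bigcap_measurable.
    exact: finite_seq.
  by move=> i _; exact: Gm (Gf i).
have CI : setI_closed C.
  move=> _ _ [J [f [_ SJ Gf ->]]] [K [g [_ SK Gg ->]]].
  (* An index of only one of the two lists gets [setT] as its other factor, so a single family over
     [J ++ K] describes both intersections. *)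
  pose h i := (if i \in J then f i else setT) `&` (if i \in K then g i else setT).
  rewrite [X in C X](_ : _ = \bigcap_(i in [set` undup (J ++ K)]) h i).
    apply: CE; first exact: undup_uniq.
      by move=> i; rewrite mem_undup mem_cat => /orP[/SJ|/SK].
    by move=> i; apply: GI; case: ifPn.
  apply/seteqP; split=> w.
    move=> [wf wg] i /=; rewrite mem_undup mem_cat /h => _.
    by split; case: ifPn => // iJ; [exact: wf|exact: wg].
  move=> wh; split=> i /= iJ; have := wh i; rewrite /= mem_undup mem_cat iJ ?orbT;
    by move=> /(_ isT); rewrite /h iJ => -[].
have CT : C setT.
  rewrite (_ : setT = \bigcap_(i in [set` ([::] : seq I)]) setT).
    exact: CE.
  by apply/seteqP; split.
have GC : \bigcup_(i in S) G i `<=` C.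
  move=> E [i Si GE]; pose f j := if j == i then E else setT.
  rewrite (_ : E = \bigcap_(j in [set` [:: i]]) f j).
    apply: CE => // j; first by rewrite inE => /eqP ->.
    by rewrite /f; case: eqP => // ->.
  apply/seteqP; split=> w.
    by move=> wE j; rewrite /= inE /f => ->.
  by move/(_ i); rewrite /= inE /f eqxx; apply.
have fB : Pr B \is a fin_num by exact: fin_num_measure.
have fB0 : 0 <= fine (Pr B) by rewrite fine_ge0.
pose m1 : {measure set W -> \bar R} := mrestr Pr mB.
pose m2 : {measure set W -> \bar R} := mscale (NngNum fB0) Pr.
have m2E E : m2 E = (Pr B * Pr E)%E by rewrite -[in RHS](fineK fB).
have : m1 A = m2 A.
  apply: (@g_sigma_algebra_measure_unique _ _ _ C Cm (fun=> setT)) => //.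
  - by rewrite bigcup_const.
  - move=> E [J [f [uJ SJ Gf ->]]]; rewrite m2E/= /mrestr.
    (* Since [z] is not in [J], the product rule over [z :: J] splits off exactly the factor of
       [B]. *)
    pose f' i := if i == z then B else f i.
    have zJ : z \notin J by apply/negP => /SJ.
    rewrite [X in Pr X](_ : _ = \bigcap_(i in [set` z :: J]) f' i).
      rewrite indep/=; [|by rewrite zJ|]; last first.
        by move=> i; rewrite inE /f'; case: eqP => [->//|/=].
      rewrite big_cons /f' eqxx; congr (_ * _)%E.
      rewrite indep// big_seq [RHS]big_seq; apply: eq_bigr => i iJ.
      by case: eqP => // iz; rewrite -iz iJ in zJ.
    apply/seteqP; split=> w.
      move=> [wf wB] i; rewrite /= inE /f'; case: eqP => //= _ iJ; exact: wf.
    move=> wf'; split.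
      move=> i /= iJ; have := wf' i; rewrite /= inE iJ orbT /f' => /(_ isT).
      by case: eqP => // iz; rewrite -iz iJ in zJ.
    by have := wf' z; rewrite /= inE eqxx /f' => /(_ isT); rewrite eqxx.
  - by move=> k; rewrite /m1/= /mrestr setTI ltey_eq fB.
  - by apply: sub_smallest2r sA.
by rewrite m2E muleC.
Qed.

End independence.

(** * Averaging over a draw that is independent of the past *)

Section freezing.
Context {R : realType} {d d2 : measure_display} {W : measurableType d}
  {T2 : measurableType d2}.
Variables (Pr : probability W R) (Q : probability T2 R) (G : set_system W).
Variable Z : W -> T2.
Hypothesis Gm : G `<=` measurable.
Hypothesis mZ : measurable_fun [set: W] Z.
Hypothesis indep : forall A B, <<s G >> A -> measurable B ->
  Pr (A `&` Z @^-1` B) = (Pr A * Q B)%E.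
(** The sample space with the coarser sigma-algebra of the past: measurability on [WG] means being
    determined by the past. *)
Notation WG := (g_sigma_algebraType G).

Lemma measurable_coarsen (A : set W) : <<s G >> A -> measurable A.
Proof.
by move: A; apply: smallest_sub => //; exact: sigma_algebra_measurable.
Qed.

Lemma measurable_fun_coarsen d3 (T3 : measurableType d3) (Y : W -> T3) :
  measurable_fun [set: WG] (Y : WG -> T3) -> measurable_fun [set: W] Y.
Proof.
move=> mY _ B mB; apply: measurable_coarsen.
by have := mY measurableT _ mB.
Qed.

Let mid : measurable_fun [set: W] (idfun : W -> WG).
Proof. by move=> _ B mB; rewrite setTI; exact: measurable_coarsen. Qed.

Let mpair : measurable_fun [set: W] (fun w => (w, Z w) : WG * T2).
Proof. exact: measurable_fun_pair. Qed.

Let idm : {mfun W >-> WG} := mfun_Sub (mem_set mid).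
Let pairm : {mfun W >-> (WG * T2)%type} := mfun_Sub (mem_set mpair).

(** The past is represented by the identity map into [WG]. By independence its pair with [Z] has the
    product law, which opens the way to Fubini and Tonelli. *)
Let joint_law X : measurable X ->
  (distribution Pr idm \x Q)%E X = distribution Pr pairm X.
Proof.
apply: product_measure_unique => A B mA mB.
by rewrite /distribution/= /pushforward/= -indep.
Qed.

Lemma measurable_freeze (h : WG * T2 -> R) : measurable_fun [set: WG * T2] h ->
  measurable_fun [set: W] (fun w => h (w, Z w)).
Proof. by move=> mh; apply: (measurableT_comp mh). Qed.

Lemma ge0_integral_freeze (h : WG * T2 -> \bar R) :
  measurable_fun [set: WG * T2] h -> (forall x, 0 <= h x)%E ->
  (\int[Pr]_w h (w, Z w) = \int[Pr]_w \int[Q]_z h (w, z))%E.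
Proof.
move=> mh h0.
transitivity (\int[distribution Pr pairm]_x h x)%E.
  by rewrite ge0_integral_distribution.
transitivity (\int[distribution Pr idm \x Q]_x h x)%E.
  by apply: eq_measure_integral => A mA _; exact/esym/joint_law.
rewrite fubini_tonelli1// ge0_integral_distribution//.
  exact: measurable_fun_fubini_tonelli_F.
by move=> w; exact: integral_ge0.
Qed.

Let integrable_joint (h : WG * T2 -> \bar R) :
  measurable_fun [set: WG * T2] h ->
  Pr.-integrable [set: W] (fun w => h (w, Z w)) ->
  (distribution Pr idm \x Q)%E.-integrable setT h.
Proof.
move=> mh ih; apply/integrableP; split => //.
rewrite (eq_measure_integral (distribution Pr pairm)); last first.
  by move=> A mA _; exact: joint_law.
rewrite ge0_integral_distribution//; last exact: measurableT_comp.
by case/integrableP: ih.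
Qed.

Let integrable_section (h : WG * T2 -> \bar R) :
  measurable_fun [set: WG * T2] h ->
  Pr.-integrable [set: W] (fun w => h (w, Z w)) ->
  Pr.-integrable [set: W] (fun w => \int[Q]_z h (w, z))%E.
Proof.
move=> mh ih; have := integrable_fubini_F (integrable_joint mh ih).
move=> /integrableP[mF F1]; apply/integrableP; split.
  exact: (measurableT_comp mF mid).
by move: F1; rewrite ge0_integral_distribution//; exact: measurableT_comp.
Qed.

Let integral_freeze (h : WG * T2 -> \bar R) :
  measurable_fun [set: WG * T2] h ->
  Pr.-integrable [set: W] (fun w => h (w, Z w)) ->
  (\int[Pr]_w h (w, Z w) = \int[Pr]_w \int[Q]_z h (w, z))%E.
Proof.
move=> mh ih; have ih2 := integrable_joint mh ih.
transitivity (\int[distribution Pr pairm]_x h x)%E.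
  by rewrite integral_distribution.
transitivity (\int[distribution Pr idm \x Q]_x h x)%E.
  by apply: eq_measure_integral => A mA _; exact/esym/joint_law.
rewrite -integral12_prod_meas1// integral_distribution//.
  exact: (measurable_fubini_F ih2).
exact: integrable_section.
Qed.

(** The conditional expectation given the past, computed by holding [w] fixed in the first argument
    and integrating out the draw. *)
Lemma Rintegral_freeze (h : W -> T2 -> R) :
  measurable_fun [set: WG * T2] (fun x => h x.1 x.2) ->
  (forall w, integrableR Q (h w)) ->
  integrableR Pr (fun w => h w (Z w)) ->
  integrableR Pr (fun w => \int[Q]_z h w z) /\
  \int[Pr]_w h w (Z w) = \int[Pr]_w \int[Q]_z h w z.
Proof.
move=> mh iQ ih; pose H (x : WG * T2) := (h x.1 x.2)%:E.
have mH : measurable_fun [set: WG * T2] H by exact/measurable_EFinP.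
have E w : (\int[Q]_z H (w, z) = (\int[Q]_z h w z)%:E)%E by rewrite RintegralE.
split.
  have := integrable_section mH ih.
  by apply: eq_integrable => // w _; exact: E.
congr fine; rewrite (integral_freeze mH ih).
by apply: eq_integral => w _; rewrite E.
Qed.

(** Tonelli yields integrability and the bound at once, so no moment has to be known beforehand. The
    bound is asked for almost surely only, because directions have unit length only almost
    surely. *)
Lemma ge0_freeze_le (h : W -> T2 -> R) (B : W -> R) :
  measurable_fun [set: WG * T2] (fun x => h x.1 x.2) ->
  (forall w z, 0 <= h w z) -> integrableR Pr B ->
  {ae Pr, forall w, (\int[Q]_z (h w z)%:E <= (B w)%:E)%E} ->
  integrableR Pr (fun w => h w (Z w)) /\
  \int[Pr]_w h w (Z w) <= \int[Pr]_w B w.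
Proof.
move=> mh h0 iB hB; pose H (x : WG * T2) := (h x.1 x.2)%:E.
have mH : measurable_fun [set: WG * T2] H by exact/measurable_EFinP.
have H0 x : (0 <= H x)%E by rewrite lee_fin.
have le1 : (\int[Pr]_w (h w (Z w))%:E <= \int[Pr]_w `|(B w)%:E|)%E.
  rewrite (ge0_integral_freeze mH H0); apply: ae_ge0_le_integral => //.
  - by move=> w _; exact: integral_ge0.
  - exact: (measurableT_comp (measurable_fun_fubini_tonelli_F H mH H0) mid).
  - by apply: measurableT_comp => //; exact: measurable_int iB.
  - apply: filterS hB => w hBw _; apply: le_trans hBw _.
    by rewrite lee_fin ler_norm.
have ih : integrableR Pr (fun w => h w (Z w)).
  apply: integrableR_ge0 => //; first exact: (measurable_freeze mh).
  by apply: le_lt_trans le1 _; case/integrableP: iB.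
split => //; rewrite -lee_fin RintegralE//; apply: le_trans le1 _.
rewrite RintegralE//; rewrite le_eqVlt; apply/orP; left; apply/eqP.
apply: ae_eq_integral => //.
- by apply: measurableT_comp => //; exact: measurable_int iB.
- exact: measurable_int iB.
- apply: filterS hB => w hBw _ /=; rewrite ger0_norm//.
  rewrite -lee_fin; apply: le_trans hBw; apply: integral_ge0 => z _.
  by rewrite lee_fin.
Qed.

End freezing.

(** * The uniform distribution on the sphere *)

(* Proved for [`|x| <= 1 / 3] and propagated by [cosh (2 x) = 2 * cosh x ^ 2 - 1]. *)
Lemma cosh_le_expR {R : realType} (x : R) :
  expR x + expR (- x) <= 2 * expR (9 / 8 * x ^+ 2).
Proof.
(* Applying e^y <= 1 / (1 - y) to y and -y gives 2 / (1 - y^2), which is at most 2 (1 + 9/8 y^2) as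
   long as y^2 <= 1/9; this is the origin of 9/8. *)
have base (y : R) : `|y| <= 3^-1 -> expR y + expR (- y) <= 2 * expR (9 / 8 * y ^+ 2).
  rewrite ler_norml => /andP[y1 y2].
  have inv_le (z : R) : z < 1 -> expR z <= (1 - z)^-1.
    move=> z1; rewrite -[expR z]invrK -expRN lef_pV2 ?posrE ?expR_gt0 ?subr_gt0//.
    exact: expR_ge1Dx.
  have h1 := inv_le y; have h2 := inv_le (- y).
  have e1 := @expR_ge1Dx R (9 / 8 * y ^+ 2).
  apply: (@le_trans _ _ (2 * (1 + 9 / 8 * y ^+ 2))); last by rewrite ler_wpM2l.
  apply: (@le_trans _ _ ((1 - y)^-1 + (1 - - y)^-1)).
    by rewrite lerD ?h1 ?h2//; lra.
  have -> : (1 - y)^-1 + (1 - - y)^-1 = 2 / (1 - y ^+ 2).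
    by field; apply/and3P; split; apply/eqP; nra.
  have u0 := sqr_ge0 y.
  have u1 : y ^+ 2 <= 9^-1 by rewrite expr2; nra.
  move: (y ^+ 2) u0 u1 => u u0 u1.
  by rewrite ler_pdivrMr; nra.
have step (y : R) : expR y + expR (- y) <= 2 * expR (9 / 8 * y ^+ 2) ->
    expR (2 * y) + expR (- (2 * y)) <= 2 * expR (9 / 8 * (2 * y) ^+ 2).
  rewrite (_ : - (2 * y) = 2 * (- y)); last by ring.
  rewrite (_ : 9 / 8 * (2 * y) ^+ 2 = 4 * (9 / 8 * y ^+ 2)); last by field.
  rewrite !expRM_natl; have := expRxMexpNx_1 y.
  move: (expR_gt0 y) (expR_gt0 (- y)) (expR_gt0 (9 / 8 * y ^+ 2)).
  move: (expR y) (expR (- y)) (expR (9 / 8 * y ^+ 2)) => a b c a0 b0 c0 ab abc.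
  have : (a + b) ^+ 2 <= (2 * c) ^+ 2 by rewrite ler_sqr ?nnegrE; nra.
  (* Here a^2 + b^2 = (a + b)^2 - 2 <= 4 c^2 - 2 <= 2 c^4. *)
  have : 0 <= (c ^+ 2 - 1) ^+ 2 by exact: sqr_ge0.
  nra.
have pow k : forall y : R, `|y| <= 3^-1 * 2 ^+ k ->
    expR y + expR (- y) <= 2 * expR (9 / 8 * y ^+ 2).
  elim: k => [|k IH] y; first by rewrite expr0 mulr1; exact: base.
  move=> yk; rewrite (_ : y = 2 * (y / 2)); last by field.
  apply: step; apply: IH; rewrite normrM (ger0_norm (_ : 0 <= 2^-1))//.
  by rewrite ler_pdivrMr// -mulrA -exprSr.
apply: (pow (Num.bound (3 * `|x|))).
rewrite -(ler_pM2l (_ : 0 < 3))// mulrA divff// mul1r.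
apply: (le_trans (ltW (archi_boundP _))); first by rewrite mulr_ge0.
by rewrite -natrX ler_nat ltnW// ltn_expl.
Qed.

(** From e^(-1/2) >= 1 - 1/2 one gets e^(3/2) <= 2^3 = 8. The bound makes the exponent 1 + ln n
    exceed 2, decides the minimum in [rho] for p = 2 and leaves room for the constants of the max
    norm estimate. *)
Lemma ln_ge_3_2 {R : realType} (n : nat) : (8 <= n)%N -> 3 / 2 <= ln (n%:R : R).
Proof.
move=> n8; have h : expR (2^-1 : R) <= 2.
  rewrite -[expR _]invrK -expRN -[leRHS]invrK lef_pV2 ?posrE ?expR_gt0//.
  by apply: le_trans (expR_ge1Dx _); lra.
have e8 : expR (3 / 2 : R) <= n%:R.
  apply: (@le_trans _ _ 8); last by rewrite ler_nat.
  rewrite expRM_natl; apply: le_trans (_ : 2 ^+ 3 <= _); last by lra.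
  by rewrite lerXn2r// nnegrE ?expR_ge0.
by rewrite -(expRK (3 / 2)) ler_ln ?posrE ?expR_gt0// ltr0n (leq_trans _ n8).
Qed.

Section sphere.
Context {R : realType} {n : nat}.
Variable nu : probability (borelRn R n) R.
Hypothesis unu : uniform_on_sphere nu.

Lemma measurable_unit_sphere : measurable (unit_sphere : set (borelRn R n)).
Proof.
rewrite (_ : unit_sphere =
    (fun x : borelRn R n => dotp (x : 'rV[R]_n) x) @^-1` [set 1]); last first.
  by apply/seteqP; split=> x /=; move/unit_sphereE.
rewrite -[X in measurable X]setTI.
by apply: measurable_dotp => //; exact: measurable_id.
Qed.

Lemma ae_unit_sphere : {ae nu, forall x : borelRn R n, dotp (x : 'rV[R]_n) x = 1}.
Proof.
exists (~` unit_sphere); split.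
- by apply: measurableC; exact: measurable_unit_sphere.
- rewrite probability_setC; last exact: measurable_unit_sphere.
  by rewrite (proj1 unu) subee.
- by move=> x /= xN xs; apply: xN; apply/unit_sphereE.
Qed.

Lemma measurable_mulmxr (Q : 'M[R]_n) : measurable_fun [set: borelRn R n]
  (fun x : borelRn R n => (x : 'rV[R]_n) *m Q : borelRn R n).
Proof.
apply: measurable_row => i; under eq_fun do rewrite mxE.
by apply: measurable_sum => j; apply: measurable_funM => //; exact: measurable_coord.
Qed.

Lemma sphere_rotation (Q : 'M[R]_n) (h : 'rV[R]_n -> R) :
  Q *m Q^T = 1%:M ->
  measurable_fun [set: borelRn R n] (h : borelRn R n -> R) ->
  integrableR nu (fun x : borelRn R n => h ((x : 'rV[R]_n) *m Q)) ->
  \int[nu]_x h x = \int[nu]_x h ((x : 'rV[R]_n) *m Q).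
Proof.
move=> QQ mh ih; congr fine.
pose rot : {mfun borelRn R n >-> borelRn R n} :=
  mfun_Sub (mem_set (measurable_mulmxr Q)).
rewrite (eq_measure_integral (distribution nu rot)).
  by rewrite integral_distribution//; exact/measurable_EFinP.
by move=> A mA _; apply/esym; apply: (proj2 unu).
Qed.

Lemma sphere_bounded_integrable (h : 'rV[R]_n -> R) (C : R) :
  measurable_fun [set: borelRn R n] (h : borelRn R n -> R) ->
  (forall x, dotp x x = 1 -> `|h x| <= C) -> integrableR nu h.
Proof.
move=> mh hC; apply: (@integrableR_ae_bounded _ _ _ nu h C) => //.
by apply: filterS ae_unit_sphere => x; exact: hC.
Qed.

Definition flip (a : 'I_n) : 'M[R]_n :=
  diag_mx (\row_j (if j == a then -1 else 1)).

Lemma flipE a (x : 'rV[R]_n) j :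
  (x *m flip a) 0 j = if j == a then - x 0 j else x 0 j.
Proof.
by rewrite mul_mx_diag !mxE; case: ifP => _; rewrite ?mulrN1 ?mulr1.
Qed.

Lemma swapE a b (x : 'rV[R]_n) j : (x *m tperm_mx a b) 0 j = x 0 (tperm a b j).
Proof. by rewrite -xcolE mxE. Qed.

Lemma flip_orthogonal a : flip a *m (flip a)^T = 1%:M.
Proof.
rewrite tr_diag_mx mulmx_diag -[1%:M]diag_const_mx; congr diag_mx.
by apply/rowP => j; rewrite !mxE; case: ifP => _; rewrite ?mulrNN mulr1.
Qed.

Lemma swap_orthogonal a b : tperm_mx a b *m (tperm_mx a b)^T = 1%:M :> 'M[R]_n.
Proof. by rewrite tr_perm_mx -perm_mxM mulgV perm_mx1. Qed.

(** The max norm is not rotation invariant, so a weight is only required to be invariant under sign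
    changes and exchanges of coordinates; these suffice to diagonalize second moments. *)
Definition signed_perm_invariant (phi : 'rV[R]_n -> R) : Prop :=
  (forall a x, phi (x *m flip a) = phi x) /\
  (forall a b x, phi (x *m tperm_mx a b) = phi x).

(** Flipping the sign of coordinate [a] negates the mean when [a] differs from [b]. Exchanging
    coordinates makes the diagonal means equal, and they add up to the mean of [phi] because |x|_2 =
    1. *)
Lemma sphere_isotropic (phi : 'rV[R]_n -> R) (C : R) (a b : 'I_n) :
  measurable_fun [set: borelRn R n] (phi : borelRn R n -> R) ->
  (forall x, dotp x x = 1 -> `|phi x| <= C) ->
  signed_perm_invariant phi ->
  \int[nu]_x ((x : 'rV[R]_n) 0 a * (x : 'rV[R]_n) 0 b * phi x) =
    (a == b)%:R / n%:R * \int[nu]_x phi x.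
Proof.
move=> mphi phiC [phif phis].
pose h (a b : 'I_n) (x : 'rV[R]_n) := x 0 a * x 0 b * phi x.
have mh c e : measurable_fun [set: borelRn R n] (h c e : borelRn R n -> R).
  by apply: measurable_funM => //; apply: measurable_funM; exact: measurable_coord.
have coord1 (x : 'rV[R]_n) c : dotp x x = 1 -> `|x 0 c| <= 1.
  move=> x1; rewrite -(@ler_pXn2r _ 2)// ?nnegrE// expr1n real_normK ?num_real//.
  by rewrite -x1 coord_sqr_le.
have hC c e (x : 'rV[R]_n) : dotp x x = 1 -> `|h c e x| <= C.
  move=> x1; rewrite /h !normrM -[C]mul1r ler_pM ?mulr_ge0//; last exact: phiC.
  by rewrite -[leRHS]mulr1 ler_pM// coord1.
have ih c e : integrableR nu (h c e).
  exact: (sphere_bounded_integrable (mh c e) (hC c e)).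
have [->|ab] := eqVneq a b; last first.
  rewrite mul0r mul0r; set I := LHS.
  suff : I = - I by lra.
  rewrite {1}/I (sphere_rotation (flip_orthogonal a) (mh a b)).
    rewrite -mulN1r -RintegralZl//; last exact: ih.
    apply: eq_Rintegral => x _.
    by rewrite /h !flipE eqxx eq_sym (negPf ab) phif; ring.
  have := integrableRZ (-1) (ih a b); apply: eq_integrable => // x _ /=.
  by congr EFin; rewrite /h !flipE eqxx eq_sym (negPf ab) phif; ring.
have hs c e (x : 'rV[R]_n) : h c c (x *m tperm_mx c e) = h e e x.
  by rewrite /h !swapE tpermL phis.
have J c : \int[nu]_x h b b x = \int[nu]_x h c c x.
  rewrite (sphere_rotation (swap_orthogonal b c) (mh b b)).
    by apply: eq_Rintegral => x _; exact: hs.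
  have := ih c c; apply: eq_integrable => // x _ /=.
  by rewrite hs.
have n0 : n%:R != 0 :> R.
  by rewrite pnatr_eq0 -lt0n (leq_ltn_trans _ (ltn_ord b)).
apply: (mulfI n0); rewrite mul1r mulrA divff// mul1r.
transitivity (\sum_(c < n) \int[nu]_x h c c x).
  rewrite (eq_bigr (fun=> \int[nu]_x h b b x)); last by move=> c _; rewrite (J c).
  by rewrite sumr_const card_ord mulr_natl.
rewrite -Rintegral_sum; last by move=> c; exact: ih.
apply: ae_eq_Rintegral => //.
  by apply: measurable_sum => c; exact: mh.
apply: filterS ae_unit_sphere => x x1.
by rewrite -mulr_suml [X in X * _](_ : _ = dotp (x : 'rV[R]_n) x) ?x1 ?mul1r.
Qed.

(* The Householder reflection that exchanges [u] and the [i]-th basis vector. *)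
Lemma orthogonal_with_column (u : 'rV[R]_n) (i : 'I_n) : dotp u u = 1 ->
  exists2 Q : 'M[R]_n, Q *m Q^T = 1%:M & forall x, (x *m Q) 0 i = dotp x u.
Proof.
move=> u1; pose v := u - delta_mx 0 i.
have [v0|v0] := eqVneq (dotp v v) 0.
  exists 1%:M; first by rewrite trmx1 mulmx1.
  move=> x; rewrite mulmx1 -dotp_delta; congr dotp.
  by apply/esym/eqP; rewrite -subr_eq0; apply/eqP/dotpp_eq0.
have vv : dotp v v = - 2 * v 0 i.
  rewrite /v dotpBl !dotpBr dotp_delta_delta u1 dotp_delta dotpC dotp_delta.
  by rewrite !mxE !eqxx /= mulr1n; ring.
have mulv (x y : 'rV[R]_n) : x *m y^T = (dotp x y)%:M.
  by apply/matrixP => j k; rewrite !ord1 !mxE eqxx; apply: eq_bigr => l _; rewrite mxE.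
pose c := 2 / dotp v v.
have QT : (1%:M - c *: (v^T *m v))^T = 1%:M - c *: (v^T *m v).
  by rewrite linearB/= trmx1 linearZ/= trmx_mul trmxK.
exists (1%:M - c *: (v^T *m v)).
  have AA : (v^T *m v) *m (v^T *m v) = dotp v v *: (v^T *m v).
    by rewrite mulmxA -(mulmxA v^T) mulv mul_mx_scalar -scalemxAl.
  rewrite QT; move: (v^T *m v) AA => A AA.
  rewrite mulmxBl mul1mx -scalemxAl mulmxBr mulmx1 -scalemxAr AA.
  rewrite scalerBr !scalerA opprB -!addrA -!(scaleNr _ A) -!(scalerDl A).
  rewrite [X in X *: A](_ : _ = 0) ?scale0r ?addr0//.
  by rewrite /c; field.
move=> x; rewrite mulmxBr mulmx1 -scalemxAr mulmxA mulv mul_scalar_mx.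
have v0i : v 0 i != 0 by apply: contraNneq v0 => vi; rewrite vv vi mulr0.
have E (w : 'rV[R]_n) k : (x - k *: w) 0 i = x 0 i - k * w 0 i by rewrite !mxE.
have dE : dotp x v = dotp x u - x 0 i by rewrite /v dotpBr dotp_delta.
by rewrite scalerA E /c vv dE; field.
Qed.

(* By rotation invariance [x_i] has the law of [<x, z> / sqrt n] for every sign
   vector [z]; the mean over all [z] is a product of hyperbolic cosines. *)
Lemma sphere_subgaussian (i : 'I_n) (l : R) :
  \int[nu]_x expR (l * (x : 'rV[R]_n) 0 i) <= expR (9 / 8 * (l ^+ 2 / n%:R)).
Proof.
have n0 : 0 < n%:R :> R by rewrite ltr0n (leq_ltn_trans _ (ltn_ord i)).
pose q := (Num.sqrt n%:R)^-1 : R.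
have qq : q ^+ 2 = n%:R^-1 by rewrite /q exprVn sqr_sqrtr// ltW.
pose u (s : {ffun 'I_n -> bool}) : 'rV[R]_n := \row_j ((-1) ^+ s j * q).
have u1 s : dotp (u s) (u s) = 1.
  rewrite /dotp (eq_bigr (fun=> n%:R^-1)); last first.
    by move=> j _; rewrite !mxE mulrACA -!expr2 qq sqrr_sign mul1r.
  by rewrite sumr_const card_ord -[LHS]mulr_natr mulVf// gt_eqF.
have mexp (v : 'rV[R]_n) : measurable_fun [set: borelRn R n]
    (fun x : borelRn R n => expR (l * dotp (x : 'rV[R]_n) v)).
  apply: measurableT_comp => //; apply: measurable_funM => //.
  by apply: measurable_dotp => //; exact: measurable_id.
have iexp v : dotp v v = 1 ->
    integrableR nu (fun x : borelRn R n => expR (l * dotp (x : 'rV[R]_n) v)).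
  move=> v1; apply: (sphere_bounded_integrable (C := expR `|l|) (mexp v)) => x x1.
  rewrite ger0_norm ?expR_ge0// ler_expR (le_trans (ler_norm _))// normrM.
  rewrite ler_piMr// -(@ler_pXn2r _ 2)// ?nnegrE// expr1n real_normK ?num_real//.
  by rewrite (le_trans (dotp_cauchy_schwarz _ _))// x1 v1 mulr1.
set M := leLHS.
have Ms s : M = \int[nu]_x expR (l * dotp (x : 'rV[R]_n) (u s)).
  have [Q QQ Qi] := orthogonal_with_column i (u1 s).
  rewrite /M (sphere_rotation (h := fun x => expR (l * x 0 i)) QQ).
  - by apply: eq_Rintegral => x _; rewrite Qi.
  - have := mexp (delta_mx 0 i).
    by under eq_fun do rewrite dotp_delta.
  - by have := iexp _ (u1 s); under [in X in X -> _]eq_fun do rewrite -Qi.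
have S2 : (2 ^ n)%:R * M =
    \int[nu]_x \sum_(s : {ffun 'I_n -> bool}) expR (l * dotp (x : 'rV[R]_n) (u s)).
  rewrite Rintegral_sum; last by move=> s; exact: iexp (u1 s).
  rewrite (eq_bigr (fun=> M)); last by move=> s _; rewrite -Ms.
  by rewrite sumr_const card_ffun card_bool card_ord mulr_natl.
rewrite -(@ler_pM2l _ (2 ^ n)%:R) ?ltr0n ?expn_gt0// S2.
rewrite -[leRHS](Rintegral_prob_cst nu).
apply: ae_le_Rintegral.
- by apply: integrableR_sum => s; exact: iexp (u1 s).
- exact: integrableR_cst.
apply: filterS ae_unit_sphere => x x1.
rewrite (eq_bigr (fun s : {ffun 'I_n -> bool} =>
    \prod_(j < n) expR (l * ((x : 'rV[R]_n) 0 j * ((-1) ^+ s j * q))))); last first.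
  move=> s _; rewrite -expR_sum mulr_sumr; congr expR.
  by apply: eq_bigr => j _; rewrite mxE.
rewrite -(bigA_distr_bigA (fun (j : 'I_n) (b : bool) =>
   expR (l * ((x : 'rV[R]_n) 0 j * ((-1) ^+ b * q))))).
apply: (@le_trans _ _ (\prod_(j < n)
    (2 * expR (9 / 8 * (l ^+ 2 / n%:R) * ((x : 'rV[R]_n) 0 j) ^+ 2)))).
  apply: ler_prod => j _; rewrite sumr_ge0/=; last first.
    by move=> b _; exact: expR_ge0.
  rewrite big_bool/= expr0 expr1 mulN1r mul1r mulrN mulrN addrC.
  apply: (le_trans (cosh_le_expR _)).
  rewrite !exprMn qq le_eqVlt; apply/orP; left; apply/eqP.
  by congr (2 * expR _); ring.
rewrite big_split/= prodr_const card_ord -natrX -expR_sum -mulr_sumr.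
have -> : \sum_(j < n) (x : 'rV[R]_n) 0 j ^+ 2 = 1.
  by rewrite -x1; apply: eq_bigr => j _; rewrite expr2.
by rewrite mulr1.
Qed.

(** With s = sqrt n |t| and tau = sqrt (8 L / 9) the claim reduces to s^2 <= 9/2 L + 9/2 exp (tau s
    - 2 L). Up to s = 9/4 tau the first term suffices, beyond it a quadratic lower bound of the
    exponential does. The multiplier [l] satisfies 9/8 l^2 / n = L, so that [sphere_subgaussian]
    gives exactly e^L = n. *)
Lemma max_sqr_le_exp (L t : R) : 1 <= L -> expR L = n%:R ->
  let l := Num.sqrt (8 / 9 * L) * Num.sqrt n%:R in
  n%:R * t ^+ 2 <=
    9 / 2 * L + 9 / 2 * n%:R ^- 2 * (expR (l * t) + expR (- l * t)).
Proof.
move=> L1 eL /=.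
have n0 : 0 < n%:R :> R by rewrite -eL expR_gt0.
have L0 : 0 <= 8 / 9 * L by lra.
pose tau := Num.sqrt (8 / 9 * L); pose s := Num.sqrt n%:R * `|t|.
have tau2 : tau ^+ 2 = 8 / 9 * L by rewrite sqr_sqrtr.
have tau0 : 0 <= tau by exact: sqrtr_ge0.
have s2 : s ^+ 2 = n%:R * t ^+ 2.
  by rewrite exprMn sqr_sqrtr ?ltW// real_normK ?num_real.
have s0 : 0 <= s by rewrite mulr_ge0 ?sqrtr_ge0.
have es : expR (tau * s) <= expR (tau * Num.sqrt n%:R * t) +
                            expR (- (tau * Num.sqrt n%:R) * t).
  have [t0|t0] := leP 0 t.
    rewrite /s ger0_norm// mulrA lerDl; exact: expR_ge0.
  by rewrite /s ltr0_norm// mulrA mulrN -mulNr lerDr expR_ge0.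
rewrite -/tau -s2; apply: (@le_trans _ _
  (9 / 2 * L + 9 / 2 * (n%:R ^- 2 * expR (tau * s)))); last first.
  by rewrite lerD2l mulrA ler_wpM2l// mulr_ge0// invr_ge0 exprn_ge0// ltW.
have -> : n%:R ^- 2 * expR (tau * s) = expR (tau * s - 2 * L).
  by rewrite expRB -eL -expRM_natl mulrC.
pose r := s - 9 / 4 * tau.
have L2 : 2 * L = 9 / 4 * tau ^+ 2 by rewrite tau2; field.
have -> : tau * s - 2 * L = tau * r by rewrite L2 /r; field.
have sE : s = 9 / 4 * tau + r by rewrite /r; ring.
have e0 := expR_ge0 (tau * r).
have [r0|r0] := leP 0 r; last first.
  apply: (@le_trans _ _ (9 / 2 * L)); last by lra.
  have : s ^+ 2 <= (9 / 4 * tau) ^+ 2 by rewrite ler_sqr ?nnegrE; lra.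
  by move/le_trans; apply; rewrite exprMn tau2; lra.
(* The exponential of v is the square of exp (v / 2) >= 1 + v / 2. *)
have e1 : 1 + tau * r + (tau * r) ^+ 2 / 4 <= expR (tau * r).
  have -> : tau * r = 2 * (tau * r / 2) by field.
  rewrite expRM_natl; have := expR_ge1Dx (tau * r / 2).
  have : 0 <= tau * r by rewrite mulr_ge0.
  move: (tau * r) => v v0 hv.
  have : (1 + v / 2) ^+ 2 <= expR (v / 2) ^+ 2 by rewrite ler_sqr ?nnegrE; lra.
  by apply: le_trans; rewrite le_eqVlt; apply/orP; left; apply/eqP; field.
have r2 : r ^+ 2 <= 9 / 8 * (tau * r) ^+ 2.
  by rewrite exprMn tau2; have := sqr_ge0 r; move: (r ^+ 2) => v v0; nra.
rewrite sE sqrrD exprMn tau2 -mulr_natr.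
have : 0 <= tau * r by rewrite mulr_ge0.
lra.
Qed.

(* The maximum of the [x_i ^ 2] is bounded by a sum of exponentials. *)
Lemma sphere_max_norm : (8 <= n)%N ->
  \int[nu]_x (`|x : 'rV[R]_n| ^+ 2) <= (16 * ln n%:R - 8) / n%:R.
Proof.
move=> n8; have L32 := @ln_ge_3_2 R n n8; set L := ln _ in L32 *.
have n0 : 0 < n%:R :> R by rewrite ltr0n (leq_trans _ n8).
have eL : expR L = n%:R by rewrite lnK.
pose l := Num.sqrt (8 / 9 * L) * Num.sqrt n%:R.
have l2 : l ^+ 2 / n%:R = 8 / 9 * L.
  by rewrite exprMn !sqr_sqrtr ?ltW// ?mulfK ?gt_eqF//; lra.
have mexp (k : R) i : measurable_fun [set: borelRn R n]
    (fun x : borelRn R n => expR (k * (x : 'rV[R]_n) 0 i)).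
  apply: measurableT_comp => //; apply: measurable_funM => //.
  exact: measurable_coord.
have iexp (k : R) i :
    integrableR nu (fun x : borelRn R n => expR (k * (x : 'rV[R]_n) 0 i)).
  apply: (sphere_bounded_integrable (C := expR `|k|) (mexp k i)) => x x1.
  rewrite ger0_norm ?expR_ge0// ler_expR (le_trans (ler_norm _))// normrM.
  rewrite ler_piMr// -(@ler_pXn2r _ 2)// ?nnegrE// expr1n real_normK ?num_real//.
  by rewrite -x1 coord_sqr_le.
have eN (k : R) i : k ^+ 2 = l ^+ 2 ->
    \int[nu]_x expR (k * (x : 'rV[R]_n) 0 i) <= n%:R.
  move=> kl; apply: le_trans (sphere_subgaussian _ _) _.
  by rewrite kl l2 -eL ler_expR; lra.
pose B (x : 'rV[R]_n) := 9 / 2 * L + 9 / 2 * n%:R ^- 2 *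
  \sum_(i < n) (expR (l * x 0 i) + expR (- l * x 0 i)).
have isum : integrableR nu (fun x : borelRn R n =>
    \sum_(i < n) (expR (l * (x : 'rV[R]_n) 0 i) + expR (- l * (x : 'rV[R]_n) 0 i))).
  by apply: integrableR_sum => i; apply: integrableRD; exact: iexp.
have iB : integrableR nu B.
  apply: integrableRD; first exact: integrableR_cst.
  exact: integrableRZ.
(* The 9 comes from 2 n exponentials of mean at most n, weighted by 9/2 n^-2. *)
have BE : \int[nu]_x B x <= 9 / 2 * L + 9.
  rewrite RintegralD//; last 2 first.
  - exact: (integrableR_cst nu (9 / 2 * L)).
  - exact: integrableRZ isum.
  rewrite Rintegral_prob_cst lerD2l RintegralZl// Rintegral_sum; last first.
    by move=> i; apply: integrableRD; exact: iexp.
  rewrite -ler_pdivlMl; last by rewrite mulr_gt0// invr_gt0 exprn_gt0.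
  apply: (@le_trans _ _ (\sum_(i < n) (2 * n%:R))).
    apply: ler_sum => i _; rewrite RintegralD//; [|exact: iexp..].
    by rewrite mulrDl mul1r lerD// eN// sqrrN.
  rewrite sumr_const card_ord -mulr_natr.
  by rewrite le_eqVlt; apply/orP; left; apply/eqP; field; rewrite gt_eqF.
have mN : measurable_fun [set: borelRn R n]
    (fun x : borelRn R n => `|x : 'rV[R]_n| ^+ 2).
  apply: measurable_funX; apply: continuous_measurable_borelRn.
  exact: norm_continuous.
have iN : integrableR nu (fun x : borelRn R n => `|x : 'rV[R]_n| ^+ 2).
  apply: (sphere_bounded_integrable (C := 1) mN) => x x1.
  by rewrite ger0_norm ?sqr_ge0// -x1 norm_row_sqr_le.
rewrite ler_pdivlMr// mulrC -RintegralZl//.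
(* The inequality 9/2 L + 9 <= 16 L - 8 follows from L >= 3/2. *)
apply: (@le_trans _ _ (\int[nu]_x B x)); last by lra.
apply: le_Rintegral => //; first exact: integrableRZ.
move=> x _; have := @max_sqr_le_exp L.
have [x0|/mx_norm_neq0[[i j] /= xE]] := eqVneq (mx_norm (x : 'rV[R]_n)) 0.
  move=> _; rewrite /Num.norm/= x0 expr0n mulr0 /B addr_ge0//; first by lra.
  rewrite mulr_ge0//.
  by rewrite sumr_ge0// => j _; rewrite addr_ge0// expR_ge0.
move=> /(_ ((x : 'rV[R]_n) 0 j)) h.
rewrite {1}/Num.norm/= xE ord1 real_normK ?num_real//.
apply: (le_trans (h _ eL)); first by lra.
rewrite lerD2l ler_wpM2l//.
by rewrite [leRHS](bigD1 j)//= lerDl sumr_ge0.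
Qed.

End sphere.

(** * Powers and p-norms *)

Section powR_abs.
Context {R : realType}.
Implicit Types (a x y : R).

(** The odd extension of the power, which appears as the derivative of powers of the absolute
    value. *)
Definition sgpow a x : R := Num.sg x * `|x| `^ a.

(** The difference quotient at 0 is at most |h|^(a - 1), which tends to 0. This settles the origin,
    where the absolute value has a kink, and later identifies gradients from quadratic error
    bounds. *)
Lemma is_derive_superlinear (f : R -> R) a : 1 < a ->
  (forall t, `|f t| <= `|t| `^ a) -> is_derive (0 : R) 1 f 0.
Proof.
move=> a1 fa.
have f0 : f 0 = 0.
  apply/eqP; rewrite -normr_le0; apply: le_trans (fa 0) _.
  by rewrite normr0 powR0// gt_eqF// (lt_trans _ a1).
have cv : (fun h : R => h^-1 *: ((f \o shift 0) (h *: (1 : R^o)) - f 0 : R^o)) @ 0^' --> (0 : R^o).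
  apply/cvgrPdist_lt => e e0.
  have a0 : 0 < a - 1 by rewrite subr_gt0.
  have := powR_cvg0 a0; move/cvgrPdist_lt => /(_ e e0).
  move=> [d /= d0 hd].
  exists d => //= h /=; rewrite !sub0r !normrN => hlt h0.
  have h0' : 0 < `|h| by rewrite normr_gt0.
  have := hd `|h|; rewrite /= !sub0r !normrN normr_id => /(_ hlt h0').
  apply: le_lt_trans; rewrite f0 subr0 addr0 [h *: (1 : R^o)]mulr1 normrM normfV.
  rewrite ler_pdivrMl// (ger0_norm (powR_ge0 _ _)).
  rewrite (le_trans (fa _))//.
  by rewrite -{2}(powRr1 (ltW h0')) -powRD ?subrKC// gt_eqF// (lt_trans _ a1).
apply: DeriveDef; last by apply/cvg_lim => //; exact: cv.
by apply/cvg_ex; exists 0.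
Qed.

Lemma sgpow0 a : sgpow a 0 = 0.
Proof. by rewrite /sgpow sgr0 mul0r. Qed.

Lemma sgpow_gt0 a x : 0 < x -> sgpow a x = x `^ a.
Proof. by move=> x0; rewrite /sgpow gtr0_sg// mul1r gtr0_norm. Qed.

Lemma sgpow_lt0 a x : x < 0 -> sgpow a x = - (- x) `^ a.
Proof. by move=> x0; rewrite /sgpow ltr0_sg// mulN1r ltr0_norm. Qed.

Lemma normr_sgpow a x : a != 0 -> `|sgpow a x| = `|x| `^ a.
Proof.
move=> a0; have [->|x0] := eqVneq x 0; first by rewrite sgpow0 normr0 powR0.
by rewrite /sgpow normrM normr_sg x0 mul1r (ger0_norm (powR_ge0 _ _)).
Qed.

Lemma is_derive_powN a x : x < 0 ->
  is_derive x 1 (fun t => (- t) `^ a) (- (a * (- x) `^ (a - 1))).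
Proof.
rewrite -oppr_gt0 => x0; have dp := is_derive1_powR a x0.
have h := is_derive1_comp dp (is_deriveNid x (1 : R)).
by apply: is_derive_eq h _; rewrite mulrN1.
Qed.

Lemma is_derive_normpow a x : 1 < a ->
  is_derive x 1 (fun t => `|t| `^ a) (a * sgpow (a - 1) x).
Proof.
move=> a1; have [x0|x0|->] := ltrgt0P x.
- rewrite sgpow_gt0//; apply: (@near_eq_is_derive _ _ _ (fun t => t `^ a)).
    by near=> t; rewrite gtr0_norm//; near: t; exact: lt_nbhsr.
  exact: is_derive1_powR.
- rewrite sgpow_lt0// mulrN; apply: (@near_eq_is_derive _ _ _ (fun t => (- t) `^ a)).
    by near=> t; rewrite ltr0_norm//; near: t; exact: lt_nbhsl.
  exact: is_derive_powN.
- rewrite sgpow0 mulr0; apply: (is_derive_superlinear a1) => t.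
  by rewrite ger0_norm// powR_ge0.
Unshelve. all: by end_near. Qed.

Lemma is_derive_sgpow a x : 1 < a ->
  is_derive x 1 (sgpow a) (a * `|x| `^ (a - 1)).
Proof.
move=> a1; have [x0|x0|->] := ltrgt0P x.
- apply: (@near_eq_is_derive _ _ _ (fun t => t `^ a)).
    by near=> t; rewrite sgpow_gt0//; near: t; exact: lt_nbhsr.
  exact: is_derive1_powR.
- rewrite -[a * _]opprK.
  apply: (@near_eq_is_derive _ _ _ (fun t => - (- t) `^ a)).
    by near=> t; rewrite sgpow_lt0//; near: t; exact: lt_nbhsl.
  by apply: is_deriveN; exact: is_derive_powN.
- rewrite powR0 ?mulr0; last by rewrite gt_eqF// subr_gt0.
  apply: (is_derive_superlinear a1) => t.
  by rewrite normr_sgpow// gt_eqF// (lt_trans _ a1).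
Unshelve. all: by end_near. Qed.

Lemma is_derive_affine (f : R -> R) (f' y h t : R) :
  is_derive (y + t * h) 1 f f' -> is_derive t 1 (fun u => f (y + u * h)) (h * f').
Proof.
move=> df.
have dl : is_derive t 1 ((fun=> y) + ((fun u : R => u) * (fun=> h))) (0 + (t *: 0 + h *: 1)).
  by apply: is_deriveD.
have h1 := is_derive1_comp (df : is_derive (((fun=> y) + ((fun u : R => u) * (fun=> h))) t) 1 f f') dl.
by apply: is_derive_eq h1 _; rewrite scaler0 !add0r [h *: _]mulr1 mulrC.
Qed.

End powR_abs.

Section finite_hoelder.
Context {R : realType} {I : finType}.
Implicit Types a b : I -> R.

(** Young's inequality [conjugate_powR] for each index, after both families are divided by their
    norms; if a norm is 0, so is the left side. *)
Lemma finite_hoelder a b (p q : R) : 0 < p -> 0 < q -> p^-1 + q^-1 = 1 ->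
  (forall i, 0 <= a i) -> (forall i, 0 <= b i) ->
  \sum_i a i * b i <=
    (\sum_i a i `^ p) `^ p^-1 * (\sum_i b i `^ q) `^ q^-1.
Proof.
move=> p0 q0 pq a0 b0.
have A0 c (r : R) : 0 <= \sum_i c i `^ r by apply: sumr_ge0 => i _; exact: powR_ge0.
have z c (r : R) : 0 < r -> (forall i : I, 0 <= c i) -> \sum_i c i `^ r = 0 ->
    forall i, c i = 0.
  move=> r0 c0 /eqP; rewrite psumr_eq0; last by move=> i _; exact: powR_ge0.
  by move=> /allP h i; have := h i (mem_index_enum _) => /eqP/powR_eq0_eq0.
have [A|A] := eqVneq (\sum_i a i `^ p) 0.
  rewrite big1 ?mulr_ge0 ?powR_ge0// => i _.
  by rewrite (z a p p0 a0 A) mul0r.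
have [B|B] := eqVneq (\sum_i b i `^ q) 0.
  rewrite big1 ?mulr_ge0 ?powR_ge0// => i _.
  by rewrite (z b q q0 b0 B) mulr0.
set S := \sum_i a i `^ p in A *; set T := \sum_i b i `^ q in B *.
have S0 : 0 < S by rewrite lt_neqAle eq_sym A A0.
have T0 : 0 < T by rewrite lt_neqAle eq_sym B A0.
have s0 : 0 < S `^ p^-1 by rewrite powR_gt0.
have t0 : 0 < T `^ q^-1 by rewrite powR_gt0.
have st0 := mulr_gt0 s0 t0.
rewrite -[leRHS]mul1r -(ler_pdivrMr _ _ st0) big_distrl/=.
apply: (@le_trans _ _ (\sum_i (a i `^ p / S / p + b i `^ q / T / q))).
  apply: ler_sum => i _; rewrite invfM mulrACA.
  apply: le_trans (conjugate_powR _ _ p0 q0 pq) _.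
  - exact: divr_ge0 (a0 i) (ltW s0).
  - exact: divr_ge0 (b0 i) (ltW t0).
  have div_pow (c e r : R) : 0 <= c -> 0 < e -> 0 < r ->
      (c / e `^ r^-1) `^ r = c `^ r / e.
    move=> c0 e0 r0; rewrite powRM//; last by rewrite invr_ge0 powR_ge0.
    by rewrite -powRN -powRrM mulNr mulVf ?gt_eqF// powR_inv1// ltW.
  rewrite le_eqVlt; apply/orP; left; apply/eqP.
  by congr (_ / _ + _ / _); exact: div_pow.
rewrite big_split/= -!mulr_suml mulfV// mulfV// !mul1r.
by rewrite pq.
Qed.

End finite_hoelder.

Section pnorm_facts.
Context {R : realType} {n : nat}.
Implicit Types (x y z : 'rV[R]_n) (p : R).

Lemma pnorm_ge0 p x : 0 <= pnorm p x.
Proof. exact: powR_ge0. Qed.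

Lemma sum_powR_ge0 p x : 0 <= \sum_(i < n) `|x 0 i| `^ p.
Proof. by apply: sumr_ge0 => i _; exact: powR_ge0. Qed.

Lemma sum_powR_eq0 p x : \sum_(i < n) `|x 0 i| `^ p = 0 -> x = 0.
Proof.
move=> /eqP; rewrite psumr_eq0; last by move=> i _; exact: powR_ge0.
move=> /allP h; apply/rowP => i; rewrite mxE.
by have := h i (mem_index_enum _) => /eqP/powR_eq0_eq0/normr0_eq0.
Qed.

Lemma pnorm_powR p x : 0 < p -> pnorm p x `^ p = \sum_(i < n) `|x 0 i| `^ p.
Proof.
by move=> p0; rewrite -powRrM mulVf ?gt_eqF// powRr1// sum_powR_ge0.
Qed.

Lemma pnorm_gt0 p x : x != 0 -> 0 < pnorm p x.
Proof.
move=> x0; apply: powR_gt0; rewrite lt_neqAle sum_powR_ge0 andbT eq_sym.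
by apply: contra_neq x0; exact: sum_powR_eq0.
Qed.

Lemma pnormZ p c x : 0 < p -> pnorm p (c *: x) = `|c| * pnorm p x.
Proof.
move=> p0; rewrite /pnorm.
rewrite (eq_bigr (fun i => `|c| `^ p * `|x 0 i| `^ p)); last first.
  by move=> i _; rewrite mxE normrM powRM.
rewrite -mulr_sumr powRM ?powR_ge0 ?sum_powR_ge0//.
by rewrite -powRrM mulfV ?gt_eqF// powRr1.
Qed.

Lemma pnorm0 p : 0 < p -> pnorm p (0 : 'rV[R]_n) = 0.
Proof. by move=> p0; rewrite -(scale0r 0) pnormZ// normr0 mul0r. Qed.

Lemma pnorm_sqr p x : pnorm p x ^+ 2 = (\sum_(i < n) `|x 0 i| `^ p) `^ (2 / p).
Proof.
by rewrite -powR_mulrn ?pnorm_ge0// /pnorm -powRrM [p^-1 * _]mulrC.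
Qed.

Lemma pnorm1E x : pnorm 1 x = \sum_(i < n) `|x 0 i|.
Proof.
rewrite /pnorm invr1 powRr1 ?sum_powR_ge0//.
by apply: eq_bigr => i _; rewrite powRr1.
Qed.

(** Termwise |x_i|^p <= |x|_1^(p - 1) |x_i|, and the right sides add up to |x|_1^p. *)
Lemma pnorm_le_pnorm1 p x : 1 <= p -> pnorm p x <= pnorm 1 x.
Proof.
move=> p1; have p0 : 0 < p by exact: lt_le_trans p1.
have [->|x0] := eqVneq x 0; first by rewrite !pnorm0.
have S0 := pnorm_gt0 1 x0.
have xS i : `|x 0 i| <= pnorm 1 x.
  by rewrite pnorm1E (bigD1 i)//= lerDl sumr_ge0.
have : \sum_(i < n) `|x 0 i| `^ p <= pnorm 1 x `^ p.
  have pE (c : R) : 0 <= c -> c `^ p = c `^ (p - 1) * c.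
    move=> c0; have := @powRD _ c (p - 1) 1; rewrite subrK gt_eqF// powRr1//; exact.
  rewrite (pE (pnorm 1 x)) ?pnorm_ge0// [X in _ <= _ * X]pnorm1E mulr_sumr.
  apply: ler_sum => i _; rewrite pE// ler_wpM2r// ge0_ler_powR ?nnegrE//.
  - by rewrite subr_ge0.
  - exact: pnorm_ge0.
move=> /(ge0_ler_powR (r := p^-1)); rewrite invr_ge0 (ltW p0) !nnegrE.
move=> /(_ isT (sum_powR_ge0 _ _) (powR_ge0 _ _)) h.
apply: le_trans h _; rewrite -powRrM mulfV ?gt_eqF// powRr1//.
exact: pnorm_ge0.
Qed.

Lemma measurable_pnorm p d (T : measurableType d) (Y : T -> 'rV[R]_n) :
  measurable_fun [set: T] (Y : T -> borelRn R n) ->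
  measurable_fun [set: T] (fun w => pnorm p (Y w)).
Proof.
move=> /measurable_rowP mY.
apply: (@measurableT_comp _ _ _ _ _ _ (fun t : R => t `^ p^-1)).
  exact: measurable_powR.
apply: measurable_sum => i.
apply: (@measurableT_comp _ _ _ _ _ _ (fun t : R => t `^ p)).
  exact: measurable_powR.
exact: measurableT_comp.
Qed.

End pnorm_facts.

Lemma is_derive_sumR {R : realType} (I : Type) (s : seq I) (f : I -> R -> R)
    (f' : I -> R) (t : R) :
  (forall i, is_derive t 1 (f i) (f' i)) ->
  is_derive t 1 (fun u => \sum_(i <- s) f i u) (\sum_(i <- s) f' i).
Proof.
move=> df; elim: s => [|i s IH].
  by under eq_fun do rewrite big_nil; rewrite big_nil; exact: is_derive_cst.
under eq_fun do rewrite big_cons; rewrite big_cons.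
exact: is_deriveD (df i) IH.
Qed.

Lemma derive_line {R : realType} (V : normedModType R) (f : V -> R) (x v : V) (l : R) :
  is_derive (0 : R) 1 (fun u : R => f (x + u *: v)) l -> 'D_v f x = l.
Proof.
move=> [_ <-]; rewrite /derive; congr (lim (_ @ 0^')).
apply/funext => h /=.
by rewrite addr0 scale0r addr0 [h *: (1 : R^o)]mulr1 (addrC x).
Qed.

Section line_of_powers.
Context {R : realType} {n : nat}.
Variables (s : R) (y h : 'rV[R]_n).

(** The s-th power of the s-norm along a line, followed by its first two derivatives. *)
Definition line_sum (t : R) := \sum_(i < n) `|y 0 i + t * h 0 i| `^ s.
Definition line_sum' (t : R) :=
  \sum_(i < n) h 0 i * (s * sgpow (s - 1) (y 0 i + t * h 0 i)).
Definition line_sum'' (t : R) :=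
  \sum_(i < n) h 0 i * (s * (h 0 i * ((s - 1) * `|y 0 i + t * h 0 i| `^ (s - 2)))).

Lemma is_derive_line_sum (t : R) : 1 < s -> is_derive t 1 line_sum (line_sum' t).
Proof.
move=> s1; apply: is_derive_sumR => i.
exact: (is_derive_affine (is_derive_normpow _ s1)).
Qed.

Lemma is_derive_line_sum' (t : R) : 2 < s -> is_derive t 1 line_sum' (line_sum'' t).
Proof.
move=> s2; apply: is_derive_sumR => i; apply: is_deriveZ; apply: is_deriveZ.
have s1 : 1 < s - 1 by rewrite ltrBrDr.
have := is_derive_affine (h := h 0 i) (is_derive_sgpow (y 0 i + t * h 0 i) s1).
by rewrite (_ : s - 1 - 1 = s - 2)//; ring.
Qed.

Lemma is_derive_line_sum_powR (t a : R) : 1 < s -> 0 < line_sum t ->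
  is_derive t 1 (fun u => line_sum u `^ a)
    (a * line_sum t `^ (a - 1) * line_sum' t).
Proof.
move=> s1 S0; have dp := is_derive1_powR a S0.
exact: (is_derive1_comp dp (is_derive_line_sum t s1)).
Qed.

Lemma line_sumE t : line_sum t = \sum_(i < n) `|(y + t *: h) 0 i| `^ s.
Proof. by apply: eq_bigr => i _; rewrite !mxE. Qed.

End line_of_powers.

(** * The squared r-norm and its conjugate, the squared s-norm *)

Section prox_pair.
Context {R : realType} {n : nat}.
Variables (s A : R).
Hypotheses (s2 : 2 < s) (A0 : 0 < A).
Implicit Types (x y z h : 'rV[R]_n).

Let s1 : 1 < s. Proof. by apply: lt_trans s2; lra. Qed.
Let s0 : 0 < s. Proof. by apply: lt_trans s1. Qed.

Let r := s / (s - 1).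

Let sm1 : 0 < s - 1. Proof. by rewrite subr_gt0. Qed.
Let r0 : 0 < r. Proof. by rewrite divr_gt0. Qed.
Let r1 : 1 < r. Proof. by rewrite /r ltr_pdivlMr// mul1r; lra. Qed.
Let rs : r^-1 + s^-1 = 1.
Proof. by rewrite /r; field; rewrite !gt_eqF. Qed.

Definition dual_prox y := (2 * A)^-1 * pnorm s y ^+ 2.

(** The gradient of [dual_prox]. At y = 0 the factor [sgpow] is 0, whatever value 0 to a negative
    power has. *)
Definition mirror_map y : 'rV[R]_n :=
  \row_i (A^-1 * pnorm s y `^ (2 - s) * sgpow (s - 1) (y 0 i)).

Lemma dotp_le_pnorm z y : dotp z y <= pnorm r z * pnorm s y.
Proof.
apply: le_trans (finite_hoelder r0 s0 rs (fun i => normr_ge0 _) (fun i => normr_ge0 _)).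
by apply: ler_sum => i _; rewrite -normrM ler_norm.
Qed.

(** Hoelder, and then the square of A |z|_r - |y|_s is completed. *)
Lemma prox_fenchel z y : dotp z y <= A / 2 * pnorm r z ^+ 2 + dual_prox y.
Proof.
apply: le_trans (dotp_le_pnorm _ _) _.
rewrite /dual_prox -subr_ge0.
have -> : A / 2 * pnorm r z ^+ 2 + (2 * A)^-1 * pnorm s y ^+ 2
    - pnorm r z * pnorm s y = (2 * A)^-1 * (A * pnorm r z - pnorm s y) ^+ 2.
  by move: (pnorm r z) (pnorm s y) => a b; field; exact: lt0r_neq0.
by rewrite mulr_ge0 ?sqr_ge0// invr_ge0 mulr_ge0// ltW.
Qed.

Lemma sgpow_mul (a x : R) : 0 < a -> sgpow (a - 1) x * x = `|x| `^ a.
Proof.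
move=> a0; have [->|x0] := eqVneq x 0; first by rewrite mulr0 normr0 powR0// gt_eqF.
rewrite /sgpow mulrAC -normrEsg.
have := @powRD _ `|x| 1 (a - 1); rewrite normr_eq0 x0 implybT subrKC powRr1//.
by move=> ->.
Qed.

Lemma mirror_map_coord y i :
  mirror_map y 0 i = A^-1 * pnorm s y `^ (2 - s) * sgpow (s - 1) (y 0 i).
Proof. exact: mxE. Qed.

Lemma mirror_map0 : mirror_map 0 = 0.
Proof. by apply/rowP => i; rewrite mirror_map_coord !mxE sgpow0 mulr0. Qed.

Lemma dotp_mirror_map y h : dotp (mirror_map y) h =
  A^-1 * pnorm s y `^ (2 - s) * \sum_(i < n) sgpow (s - 1) (y 0 i) * h 0 i.
Proof.
by rewrite /dotp mulr_sumr; apply: eq_bigr => i _; rewrite mirror_map_coord -!mulrA.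
Qed.

Lemma dotp_mirror_map_self y : dotp (mirror_map y) y = 2 * dual_prox y.
Proof.
have [->|y0] := eqVneq y 0.
  by rewrite dotp0r /dual_prox pnorm0// expr0n !mulr0.
rewrite dotp_mirror_map (eq_bigr (fun i => `|y 0 i| `^ s)); last first.
  by move=> i _; rewrite sgpow_mul.
rewrite -pnorm_powR// -mulrA -powRD; last by rewrite (gt_eqF (pnorm_gt0 _ y0)) implybT.
rewrite subrK powR_mulrn ?pnorm_ge0// /dual_prox.
by move: (pnorm s y) => a; field; exact: lt0r_neq0.
Qed.

Lemma mirror_mapE y i : y != 0 ->
  `|mirror_map y 0 i| = (A^-1 * pnorm s y `^ (2 - s)) * `|y 0 i| `^ (s - 1).
Proof.
move=> y0; rewrite mirror_map_coord normrM normr_sgpow ?(gt_eqF sm1)//.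
by rewrite ger0_norm// mulr_ge0 ?powR_ge0// invr_ge0 ltW.
Qed.

Let powR_mirror_coef (a Y : R) : 0 <= a -> 0 < Y ->
  (a * Y `^ (2 - s)) `^ r * Y `^ s = (a * Y) `^ r.
Proof.
move=> a0 Y0; have Ys : Y `^ s = (Y `^ (s - 1)) `^ r.
  by rewrite -powRrM /r mulrC divfK// gt_eqF.
rewrite Ys -powRM ?mulr_ge0 ?powR_ge0//; congr (_ `^ r).
rewrite -mulrA; congr (_ * _); have := @powRD _ Y (2 - s) (s - 1).
rewrite (gt_eqF Y0) implybT => <-//.
by rewrite (_ : 2 - s + (s - 1) = 1) ?powRr1 ?ltW//; ring.
Qed.

(** Exponent bookkeeping for conjugate exponents: (s - 1)(r - 1) = 1 recovers |t|, the powers of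
    A^-1 multiply to A^-1 and those of [Y] cancel. *)
Let powR_mirror_inverse (Y t : R) : 0 < Y -> t != 0 ->
  A * ((A^-1 * Y) `^ r `^ (2 / r - 1) *
    (A^-1 * Y `^ (2 - s) * `|t| `^ (s - 1)) `^ (r - 1)) = `|t|.
Proof.
move=> Y0 t0; have Ai : 0 < A^-1 by rewrite invr_gt0.
have pD (x b c : R) : 0 < x -> x `^ (b + c) = x `^ b * x `^ c.
  by move=> x0; rewrite powRD// (gt_eqF x0) implybT.
rewrite -powRrM (_ : r * (2 / r - 1) = 2 - r); last by field; rewrite gt_eqF.
have Y2 := powR_gt0 (2 - s) Y0.
rewrite (powRM _ (ltW Ai) (ltW Y0)).
rewrite (powRM _ (mulr_ge0 (ltW Ai) (ltW Y2)) (powR_ge0 _ _)).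
rewrite (powRM _ (ltW Ai) (ltW Y2)) -!powRrM.
rewrite (_ : (s - 1) * (r - 1) = 1); last by rewrite /r; field; rewrite gt_eqF.
rewrite (powRr1 (normr_ge0 t)).
have An : A^-1 `^ (2 - r) * A^-1 `^ (r - 1) = A^-1.
  by rewrite -pD// (_ : 2 - r + (r - 1) = 1) ?powRr1 ?(ltW Ai)//; ring.
have Yn : Y `^ (2 - r) * Y `^ ((2 - s) * (r - 1)) = 1.
  rewrite -pD// (_ : 2 - r + (2 - s) * (r - 1) = 0) ?powRr0//.
  by rewrite /r; field; rewrite gt_eqF.
move: (A^-1 `^ (2 - r)) (A^-1 `^ (r - 1)) An => a b ab.
move: (Y `^ (2 - r)) (Y `^ ((2 - s) * (r - 1))) Yn => c e ce.
transitivity (A * (a * b) * (c * e) * `|t|); first by ring.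
by rewrite ab ce mulfV ?mul1r// gt_eqF.
Qed.

Lemma sum_powR_mirror_map y : y != 0 ->
  \sum_(i < n) `|mirror_map y 0 i| `^ r = (A^-1 * pnorm s y) `^ r.
Proof.
move=> y0; have Y0 := pnorm_gt0 s y0.
have c0 : 0 <= A^-1 by rewrite invr_ge0 ltW.
rewrite (eq_bigr (fun i => (A^-1 * pnorm s y `^ (2 - s)) `^ r * `|y 0 i| `^ s)).
  by rewrite -mulr_sumr -pnorm_powR//; exact: powR_mirror_coef.
move=> i _; rewrite mirror_mapE//; move: (pnorm s y) Y0 => Y Y0.
rewrite powRM ?mulr_ge0 ?powR_ge0//; congr (_ * _).
by rewrite -powRrM /r mulrC divfK// gt_eqF.
Qed.

Lemma pnorm_mirror_map y : pnorm r (mirror_map y) = A^-1 * pnorm s y.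
Proof.
have [->|y0] := eqVneq y 0; first by rewrite mirror_map0 !pnorm0// mulr0.
rewrite /pnorm sum_powR_mirror_map// -powRrM mulfV ?gt_eqF// powRr1//.
by rewrite mulr_ge0 ?pnorm_ge0// invr_ge0 ltW.
Qed.

Lemma prox_mirror_map y :
  A / 2 * pnorm r (mirror_map y) ^+ 2 + dual_prox y = dotp (mirror_map y) y.
Proof.
rewrite dotp_mirror_map_self pnorm_mirror_map /dual_prox.
by move: (pnorm s y) => a; field; exact: lt0r_neq0.
Qed.

(** The gradients of conjugate functions are inverse to each other. The chain rule for the power 2 /
    r needs a positive base, so y = 0 is treated apart; there the function is quadratic in [u] by
    homogeneity. *)
Lemma grad_prox_mirror_map y :
  grad (fun x => A / 2 * pnorm r x ^+ 2) (mirror_map y) = y.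
Proof.
apply/rowP => i; rewrite mxE; apply: derive_line.
have [->|y0] := eqVneq y 0.
  rewrite mirror_map0 mxE.
  have -> : (fun u : R => A / 2 * pnorm r (0 + u *: delta_mx 0 i : 'rV[R]_n) ^+ 2) =
      (fun u => A / 2 * pnorm r (delta_mx 0 i : 'rV[R]_n) ^+ 2 * u ^+ 2).
    apply/funext => u; rewrite add0r pnormZ// exprMn real_normK ?num_real//.
    by move: (pnorm _ _) => a; ring.
  have : is_derive (0 : R) 1 ((fun u : R => u) * (fun u : R => u)) ((0 : R) *: (1 : R) + (0 : R) *: (1 : R)).
    exact: is_deriveM.
  move=> /(is_deriveZ (A / 2 * pnorm r (delta_mx 0 i : 'rV[R]_n) ^+ 2)) h.
  by apply: is_derive_eq h _; rewrite !scale0r addr0 scaler0.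
pose x := mirror_map y.
have S : \sum_(j < n) `|x 0 j| `^ r = (A^-1 * pnorm s y) `^ r.
  exact: sum_powR_mirror_map.
have Y0 := pnorm_gt0 s y0.
have AY0 : 0 < A^-1 * pnorm s y by rewrite mulr_gt0// invr_gt0.
have E u : pnorm r (x + u *: delta_mx 0 i) ^+ 2 =
    line_sum r x (delta_mx 0 i) u `^ (2 / r) by rewrite line_sumE pnorm_sqr.
rewrite (_ : (fun u => _) =
  (fun u => A / 2 * line_sum r x (delta_mx 0 i) u `^ (2 / r))); last first.
  by apply/funext => u; rewrite -E.
have S0 : line_sum r x (delta_mx 0 i) 0 = (A^-1 * pnorm s y) `^ r.
  by rewrite line_sumE scale0r addr0.
have S0' : 0 < line_sum r x (delta_mx 0 i) 0 by rewrite S0 powR_gt0.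
have := is_deriveZ (A / 2) (is_derive_line_sum_powR (2 / r) r1 S0').
move=> /is_derive_eq; apply.
rewrite S0 /line_sum' (bigD1 i)//= big1 ?addr0; last first.
  by move=> j ji; rewrite mxE (negPf ji) andbF mul0r.
rewrite mul0r addr0 mxE !eqxx mul1r.
(* [powR_mirror_inverse] needs a nonzero coordinate; where y_i = 0 both sides vanish. *)
have [yi0|yi0] := eqVneq (y 0 i) 0.
  have xi0 : x 0 i = 0 by rewrite /x mirror_map_coord yi0 sgpow0 mulr0.
  rewrite xi0 sgpow0 yi0; move: (_ `^ r `^ _) => a.
  by rewrite !mulr0 scaler0.
have xE : sgpow (r - 1) (x 0 i) = Num.sg (y 0 i) *
    (A^-1 * pnorm s y `^ (2 - s) * `|y 0 i| `^ (s - 1)) `^ (r - 1).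
  rewrite /sgpow mirror_mapE//; congr (_ * _).
  rewrite /x mirror_map_coord /sgpow !sgrM sgr_id.
  rewrite (gtr0_sg (_ : 0 < A^-1)) ?invr_gt0//.
  rewrite (gtr0_sg (powR_gt0 _ Y0)) mulr1.
  by rewrite (gtr0_sg (powR_gt0 _ _)) ?normr_gt0// !mul1r mulr1.
have h := powR_mirror_inverse Y0 yi0; rewrite xE.
move: ((A^-1 * pnorm s y) `^ r `^ _) ((_ * `|y 0 i| `^ _) `^ _) h => a b h.
rewrite [RHS](numEsg (y 0 i)) -h.
by rewrite /GRing.scale/=; field; exact: lt0r_neq0.
Qed.

End prox_pair.

Lemma is_derive_le0_le {R : realType} (f f' : R -> R) (x : R) :
  (forall t : R, is_derive t 1 f (f' t)) ->
  (forall t, 0 <= t -> f' t <= 0) -> 0 <= x -> f x <= f 0.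
Proof.
move=> df f'0 x0.
have der t : derivable f t 1 by have [] := df t.
have cf : {within `[0, x], continuous f}.
  by apply: derivable_within_continuous => t _; exact: der.
have d0 t : t \in `]0, x[ -> derive1 f t <= 0.
  rewrite in_itv/= => /andP[t0 _].
  by rewrite derive1E; have [_ ->] := df t; exact: f'0 (ltW t0).
by apply: (ler0_derive1_le_cc _ d0 cf) => //; rewrite in_itv/= ?x0 ?lexx.
Qed.

(** Taylor's bound by monotonicity: [phi' t - 2 * K * t], and then
    [phi t - phi' 0 * t - K * t ^+ 2], do not increase for t >= 0. *)
Lemma second_order_upper_bound {R : realType} (phi phi' phi'' : R -> R) (K : R) :
  (forall t : R, is_derive t 1 phi (phi' t)) ->
  (forall t : R, is_derive t 1 phi' (phi'' t)) ->
  (forall t, phi'' t <= 2 * K) -> phi 1 <= phi 0 + phi' 0 + K.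
Proof.
move=> dphi dphi' phi''_le.
have phi'_le t : 0 <= t -> phi' t - 2 * K * t <= phi' 0.
  move=> t0; pose f t := phi' t - 2 * K * t.
  have df (u : R) : is_derive u 1 f (phi'' u - 2 * K).
    have d := is_deriveB (dphi' u) (is_deriveZ (2 * K) (is_derive_id u (1 : R))).
    by apply: is_derive_eq d _; congr (_ - _); rewrite [LHS]mulr1.
  have := is_derive_le0_le df _ t0; rewrite /f mulr0 subr0; apply.
  by move=> u _; rewrite subr_le0 phi''_le.
pose f t := phi t - phi' 0 * t - K * (t * t).
have df (u : R) : is_derive u 1 f (phi' u - phi' 0 - K * (u + u)).
  have d := is_deriveB (is_deriveB (dphi u) (is_deriveZ (phi' 0) (is_derive_id u (1 : R))))
    (is_deriveZ K (is_deriveM (is_derive_id u (1 : R)) (is_derive_id u (1 : R)))).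
  apply: is_derive_eq d _; congr (_ - _ - _); first by rewrite [LHS]mulr1.
  by congr (K * _); rewrite ![u *: _]mulr1.
have := is_derive_le0_le df _ ler01; rewrite /f !mulr0 !subr0 !mulr1 => h1.
have {h1} : phi 1 - phi' 0 - K <= phi 0.
  by apply: h1 => u u0; have := phi'_le u u0; lra.
lra.
Qed.

(** * Smoothness of the squared s-norm with constant s - 1 *)

Section smoothness.
Context {R : realType} {n : nat}.
Variable s : R.
Hypothesis s2 : 2 < s.
Implicit Types (y h : 'rV[R]_n).

Let s1 : 1 < s. Proof. by apply: lt_trans s2; lra. Qed.
Let s0 : 0 < s. Proof. by apply: lt_trans s1. Qed.
Let sm1 : 0 < s - 1. Proof. by rewrite subr_gt0. Qed.
Let sm2 : 0 < s - 2. Proof. by rewrite subr_gt0. Qed.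

(** Hoelder with the exponents s / (s - 2) and s / 2. *)
Lemma hoelder_sub_two (w b : 'I_n -> R) : (forall i, 0 <= w i) ->
  \sum_(i < n) w i `^ (s - 2) * b i ^+ 2 <=
    (\sum_(i < n) w i `^ s) `^ (1 - 2 / s) *
    (\sum_(i < n) `|b i| `^ s) `^ (2 / s).
Proof.
move=> w0; have p0 : 0 < s / (s - 2) by rewrite divr_gt0.
have q0 : 0 < s / 2 by rewrite divr_gt0.
have pE : (s / (s - 2))^-1 = 1 - 2 / s by field; rewrite !gt_eqF.
have qE : (s / 2)^-1 = 2 / s by field; rewrite !gt_eqF.
have pq : (s / (s - 2))^-1 + (s / 2)^-1 = 1 by rewrite pE qE; ring.
have := finite_hoelder p0 q0 pq (fun i => powR_ge0 (w i) (s - 2))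
  (fun i => sqr_ge0 (b i)).
have -> : \sum_(i < n) (w i `^ (s - 2)) `^ (s / (s - 2)) = \sum_(i < n) w i `^ s.
  by apply: eq_bigr => i _; rewrite -powRrM mulrC divfK// gt_eqF.
have -> : \sum_(i < n) (b i ^+ 2) `^ (s / 2) = \sum_(i < n) `|b i| `^ s.
  apply: eq_bigr => i _.
  rewrite -(@real_normK _ (b i)) ?num_real// -powR_mulrn// -powRrM.
  by congr (_ `^ _); field.
by rewrite pE qE.
Qed.

(* Along the line [y + t h] the second derivative of the squared norm is at most
   [2 (s - 1) |h|_s^2], by Hoelder; its term in [line_sum' ^ 2] is nonpositive. *)
Lemma line_sum_gt0_smooth y h : (forall t, 0 < line_sum s y h t) ->
  pnorm s (y + h) ^+ 2 <= pnorm s y ^+ 2 +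
    2 * (pnorm s y `^ (2 - s) * \sum_(i < n) sgpow (s - 1) (y 0 i) * h 0 i) +
    (s - 1) * pnorm s h ^+ 2.
Proof.
move=> S0; pose ls := line_sum s y h.
pose ls' := line_sum' s y h; pose ls'' := line_sum'' s y h.
pose K := (s - 1) * pnorm s h ^+ 2.
pose phi' t := 2 / s * ls t `^ (2 / s - 1) * ls' t.
have dphi (t : R) : is_derive t 1 (fun u => ls u `^ (2 / s)) (phi' t).
  exact: is_derive_line_sum_powR.
have dphi' (t : R) : is_derive t 1 phi' (2 / s *
    (ls t `^ (2 / s - 1) * ls'' t +
     ls' t * ((2 / s - 1) * ls t `^ (2 / s - 1 - 1) * ls' t))).
  have d1 : is_derive t 1 (fun u => ls u `^ (2 / s - 1))
      ((2 / s - 1) * ls t `^ (2 / s - 1 - 1) * ls' t).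
    exact: is_derive_line_sum_powR.
  have d2 := is_derive_line_sum' y h t s2.
  have d3 := is_deriveZ (2 / s) (is_deriveM d1 d2).
  have -> : phi' = (fun u => 2 / s * (ls u `^ (2 / s - 1) * ls' u)).
    by apply/funext => u; rewrite /phi' mulrA.
  by apply: is_derive_eq d3 _.
have lsp t a : ls t `^ a * ls t `^ (- a) = 1.
  by rewrite powRN mulfV// powR_eq0 negb_and (gt_eqF (S0 t)).
have hoel t : ls'' t <= s * (s - 1) * (ls t `^ (1 - 2 / s) * pnorm s h ^+ 2).
  rewrite /ls'' /line_sum''.
  rewrite (eq_bigr (fun i => s * (s - 1) *
     (`|y 0 i + t * h 0 i| `^ (s - 2) * h 0 i ^+ 2))); last first.
    by move=> i _; move: (_ `^ _) => a; ring.
  rewrite -mulr_sumr ler_wpM2l//; first by rewrite mulr_ge0// ltW.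
  by rewrite pnorm_sqr; apply: hoelder_sub_two => i; exact: normr_ge0.
have phi''_le t : 2 / s * (ls t `^ (2 / s - 1) * ls'' t +
    ls' t * ((2 / s - 1) * ls t `^ (2 / s - 1 - 1) * ls' t)) <= 2 * K.
  have neg : ls' t * ((2 / s - 1) * ls t `^ (2 / s - 1 - 1) * ls' t) <= 0.
    have -> : ls' t * ((2 / s - 1) * ls t `^ (2 / s - 1 - 1) * ls' t) =
        - ((1 - 2 / s) * (ls t `^ (2 / s - 1 - 1) * ls' t ^+ 2)).
      by move: (ls t `^ _) (ls' t) => a b; ring.
    rewrite oppr_le0 mulr_ge0//; last by rewrite mulr_ge0 ?powR_ge0 ?sqr_ge0.
    by rewrite subr_ge0 ler_pdivrMr// mul1r ltW.
  have pos : ls t `^ (2 / s - 1) * ls'' t <= s * K.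
    have e1 : ls t `^ (2 / s - 1) * ls t `^ (1 - 2 / s) = 1.
      by have := lsp t (2 / s - 1); rewrite opprB.
    have := ler_wpM2l (powR_ge0 (ls t) (2 / s - 1)) (hoel t).
    move=> /le_trans; apply; rewrite /K.
    move: (ls t `^ (2 / s - 1)) (ls t `^ (1 - 2 / s)) (pnorm s h ^+ 2) e1 => a b c ab.
    rewrite (_ : a * (s * (s - 1) * (b * c)) = s * ((s - 1) * ((a * b) * c))); last by ring.
    by rewrite ab mul1r.
  move: (_ * ls'' t) (ls' t * _) pos neg => a b pos neg.
  rewrite (_ : 2 / s * (a + b) = 2 * ((a + b) / s)); last by ring.
  by rewrite ler_wpM2l// ler_pdivrMr//; lra.
have := second_order_upper_bound dphi dphi' phi''_le.
have -> : phi' 0 =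
    2 * (pnorm s y `^ (2 - s) * \sum_(i < n) sgpow (s - 1) (y 0 i) * h 0 i).
  have ls0 : ls 0 `^ (2 / s - 1) = pnorm s y `^ (2 - s).
    have -> : ls 0 = pnorm s y `^ s.
      by rewrite /ls line_sumE scale0r addr0 pnorm_powR.
    by rewrite -powRrM (_ : s * (2 / s - 1) = 2 - s)//; field; rewrite gt_eqF.
  have ls'0 : ls' 0 = s * \sum_(i < n) sgpow (s - 1) (y 0 i) * h 0 i.
    rewrite mulr_sumr; apply: eq_bigr => i _; rewrite mul0r addr0 mulrCA.
    by congr (_ * _); exact: mulrC.
  rewrite /phi' ls0 ls'0; move: (_ `^ (2 - s)) (\sum_(i < n) _) => a b.
  by field; rewrite gt_eqF.
by rewrite /ls !line_sumE -!pnorm_sqr scale0r scale1r addr0.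
Qed.

Lemma sgpowM (a x y : R) : sgpow a (x * y) = sgpow a x * sgpow a y.
Proof. by rewrite /sgpow sgrM normrM powRM// mulrACA. Qed.

(* If the line through [y] in the direction [h] meets [0], then [y] is a multiple
   of [h] and the inequality is one-dimensional. *)
Lemma pnorm_smooth y h :
  pnorm s (y + h) ^+ 2 <= pnorm s y ^+ 2 +
    2 * (pnorm s y `^ (2 - s) * \sum_(i < n) sgpow (s - 1) (y 0 i) * h 0 i) +
    (s - 1) * pnorm s h ^+ 2.
Proof.
have [[t t0]|noz] := pselect (exists t, line_sum s y h t = 0); last first.
  apply: line_sum_gt0_smooth => t; rewrite lt_neqAle; apply/andP; split.
    by rewrite eq_sym; apply/negP => /eqP ?; apply: noz; exists t.
  by rewrite line_sumE sum_powR_ge0.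
have yE : y = (- t) *: h.
  have : y + t *: h = 0 by apply: (@sum_powR_eq0 _ _ s); rewrite -line_sumE.
  by move=> /eqP; rewrite addr_eq0 scaleNr => /eqP.
move: {t t0}(- t) yE => c ->.
rewrite -[X in _ + X](scale1r h) -scalerDl !pnormZ//.
rewrite (eq_bigr (fun i => sgpow (s - 1) c * `|h 0 i| `^ s)); last first.
  by move=> i _; rewrite mxE sgpowM -mulrA sgpow_mul.
rewrite -mulr_sumr -pnorm_powR//.
have H0 := pnorm_ge0 s h; move: (pnorm s h) H0 => H H0.
rewrite !exprMn !real_normK ?num_real//.
have -> : (`|c| * H) `^ (2 - s) * (sgpow (s - 1) c * H `^ s) = c * H ^+ 2.
  have [->|c0] := eqVneq c 0; first by rewrite sgpow0 !mul0r mulr0.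
  have [->|Hn0] := eqVneq H 0.
    by rewrite (@powR0 _ s) ?gt_eqF// expr0n !mulr0.
  have Hp : 0 < H by rewrite lt_neqAle eq_sym Hn0.
  have cp : 0 < `|c| by rewrite normr_gt0.
  have pD (x a b : R) : 0 < x -> x `^ a * x `^ b = x `^ (a + b).
    by move=> x0; rewrite powRD// (gt_eqF x0) implybT.
  rewrite powRM// /sgpow.
  have e1 : `|c| `^ (2 - s) * `|c| `^ (s - 1) = `|c|.
    by rewrite pD// (_ : 2 - s + (s - 1) = 1) ?powRr1//; ring.
  have e2 : H `^ (2 - s) * H `^ s = H ^+ 2 by rewrite pD// subrK powR_mulrn.
  move: (H `^ (2 - s)) (H `^ s) (`|c| `^ (2 - s)) (`|c| `^ (s - 1)) e1 e2.
  move=> p q u v uv pq.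
  transitivity ((u * v) * Num.sg c * (p * q)); first by ring.
  by rewrite uv pq mulrC [c in RHS]numEsg; ring.
(* What remains is (c + 1)^2 <= c^2 + 2 c + (s - 1), true because s > 2. *)
have : 0 <= H ^+ 2 by exact: sqr_ge0.
move: (H ^+ 2) => K K0; have := mulr_ge0 (ltW sm2) K0.
by rewrite !expr2; lra.
Qed.

End smoothness.

(** * Mirror descent in dual variables *)

(* [dstar] is the conjugate of [d], [M] its gradient and [N] the squared q-norm;
   [ms_smooth] is dual to the strong convexity of [d]. *)
Record mirror_setup {R : realType} {n : nat} (d dstar N : 'rV[R]_n -> R)
    (M : 'rV[R]_n -> 'rV[R]_n) (rho : R) : Prop := {
  ms_fenchel : forall z y, dotp z y <= d z + dstar y;
  ms_fenchel_eq : forall y, d (M y) + dstar y = dotp (M y) y;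
  ms_smooth : forall y h, dstar (y + h) <= dstar y + dotp (M y) h + N h / 2;
  ms_grad : forall y, grad d (M y) = y;
  ms_M0 : M 0 = 0;
  ms_dstar0 : dstar 0 = 0;
  ms_N_ge0 : forall h, 0 <= N h;
  ms_N_le : forall h, N h <= dotp h h;
  ms_NZ : forall t h, N (t *: h) = t ^+ 2 * N h;
  ms_N_inv : signed_perm_invariant N;
  ms_N_mean : forall nu : probability (borelRn R n) R,
    uniform_on_sphere nu -> \int[nu]_x N x <= rho;
  ms_measurable_d : measurable_fun [set: borelRn R n] (d : borelRn R n -> R);
  ms_measurable_dstar :
    measurable_fun [set: borelRn R n] (dstar : borelRn R n -> R);
  ms_measurable_N : measurable_fun [set: borelRn R n] (N : borelRn R n -> R);
  ms_measurable_M :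
    measurable_fun [set: borelRn R n] (M : borelRn R n -> borelRn R n)
}.

Section parameters.
Context {R : realType}.
Variable n : nat.
Hypothesis n8 : (8 <= n)%N.
Notation L := (ln (n%:R : R)).

Let n0 : 0 < n%:R :> R. Proof. by rewrite ltr0n (leq_trans _ n8). Qed.
Let L32 : 3 / 2 <= L := ln_ge_3_2 n8.
Let L0 : 0 < L. Proof. by have := L32; lra. Qed.

Lemma two_over_q1 : two_over_q 1 = 0 :> R.
Proof. by rewrite /two_over_q /conjugate_exponent hoelder_conjugate1 invey mule0. Qed.

Lemma two_over_q2 : two_over_q 2 = 1 :> R.
Proof.
rewrite /two_over_q /conjugate_exponent hoelder_conjugate2.
by rewrite inver pnatr_eq0/= mulfV.
Qed.

Lemma rho1 : rho n (1 : R) = (16 * L - 8) / n%:R.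
Proof.
rewrite /rho two_over_q1 /conjugate_exponent hoelder_conjugate1 sub0r.
rewrite (_ : Order.min _ _ = (16 * L - 8)%:E); last first.
  by apply/min_idPr; rewrite leey.
by rewrite powR_inv1 ?ltW.
Qed.

Lemma rho2 : rho n (2 : R) = 1.
Proof.
rewrite /rho two_over_q2 /conjugate_exponent hoelder_conjugate2 subrr powRr0.
rewrite mulr1 (_ : 2%:E - 1 = 1%:E)%E; last by rewrite -EFinB; congr EFin; lra.
rewrite (_ : Order.min _ _ = 1%:E)//; apply/min_idPl.
by rewrite lee_fin; have := L32; lra.
Qed.

Lemma Omega2 : Omega n (2 : R) = 1.
Proof. by rewrite /Omega (_ : (2 == 1 :> R) = false)//; apply/eqP; lra. Qed.

Lemma prox2E (x : 'rV[R]_n) : prox 2 x = 2^-1 * dotp x x.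
Proof.
by rewrite /prox (_ : (2 == 1 :> R) = false) ?pnorm2_sqr//; apply/eqP; lra.
Qed.

(* [kappa] is the exponent conjugate to [1 + ln n]. *)
Lemma kappaE : kappa n = (1 + L) / ((1 + L) - 1) :> R.
Proof.
rewrite /kappa (_ : 1 + L - 1 = L); last by ring.
by field; rewrite gt_eqF.
Qed.

(** Since e = n^(1 / ln n), the factor e joins the power of n, whose exponent becomes 2 / (1 + ln
    n). *)
Lemma Omega1E : Omega n (1 : R) = L * n%:R `^ (2 / (1 + L)).
Proof.
rewrite /Omega eqxx /powR !(gt_eqF n0) -expRD mulrC; congr (_ * expR _).
by rewrite /kappa; field; rewrite !gt_eqF//; have := L0; lra.
Qed.

Lemma Omega1_ge1 : 1 <= Omega n (1 : R).
Proof.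
rewrite Omega1E; apply: (@le_trans _ _ (1 * 1)); first by rewrite mulr1.
apply: ler_pM => //; first by have := L32; lra.
rewrite /powR (gt_eqF n0); apply: le_trans (expR_ge1Dx _).
rewrite lerDl mulr_ge0 ?(ltW L0)//.
by rewrite divr_ge0//; have := L0; lra.
Qed.

Lemma prox1E (x : 'rV[R]_n) : prox 1 x = Omega n 1 / 2 * pnorm (kappa n) x ^+ 2.
Proof. by rewrite /prox eqxx. Qed.

End parameters.

Section max_norm.
Context {R : realType} {n : nat}.
Implicit Types x h : 'rV[R]_n.

Lemma norm_row_le x (c : R) : 0 <= c -> (forall i, `|x 0 i| <= c) -> `|x| <= c.
Proof.
move=> c0 xc; have [x0|/mx_norm_neq0[[i j] /= xE]] := eqVneq (mx_norm x) 0.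
  by rewrite /Num.norm/= x0.
by rewrite /Num.norm/= xE ord1.
Qed.

Lemma norm_row_invariant : signed_perm_invariant (fun x => `|x| ^+ 2).
Proof.
split=> [a x|a b x]; congr (_ ^+ 2); apply/eqP; rewrite eq_le; apply/andP; split;
    apply: norm_row_le => // i.
- by rewrite flipE; case: ifP => _; rewrite ?normrN norm_row_coord_le.
- apply: le_trans (norm_row_coord_le _ i).
  by rewrite flipE; case: ifP => _; rewrite ?normrN.
- by rewrite swapE norm_row_coord_le.
- apply: le_trans (norm_row_coord_le _ (tperm a b i)).
  by rewrite swapE tpermK.
Qed.

Lemma dotpp_invariant : signed_perm_invariant (fun x => dotp x x).
Proof.
have h (Q : 'M[R]_n) : Q *m Q^T = 1%:M -> forall x, dotp (x *m Q) (x *m Q) = dotp x x.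
  have dE (x y : 'rV[R]_n) : dotp x y = (x *m y^T) 0 0.
    by rewrite mxE; apply: eq_bigr => i _; rewrite mxE.
  by move=> QQ x; rewrite !dE trmx_mul mulmxA -(mulmxA x) QQ mulmx1.
split=> [a x|a b x]; apply: h; [exact: flip_orthogonal|exact: swap_orthogonal].
Qed.

Lemma pnorm_le_max s h : 0 < s -> pnorm s h <= n%:R `^ s^-1 * `|h|.
Proof.
move=> s0; apply: (@le_trans _ _ ((n%:R * `|h| `^ s) `^ s^-1)); last first.
  by rewrite powRM ?powR_ge0// -powRrM mulfV ?gt_eqF// powRr1.
rewrite /pnorm ge0_ler_powR ?nnegrE ?invr_ge0 ?(ltW s0) ?sum_powR_ge0//.
have -> : n%:R * `|h| `^ s = \sum_(i < n) `|h| `^ s.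
  by rewrite sumr_const card_ord mulr_natl.
apply: ler_sum => i _; rewrite ge0_ler_powR ?nnegrE ?(ltW s0)//.
exact: norm_row_coord_le.
Qed.

Lemma measurable_prox (p : R) :
  measurable_fun [set: borelRn R n] (prox p : borelRn R n -> R).
Proof.
pose c := if p == 1 then Omega n p / 2 else 2^-1 : R.
pose q := if p == 1 then kappa n else 2 : R.
rewrite (_ : prox p = (fun x : 'rV[R]_n => c * pnorm q x ^+ 2)); last first.
  by apply/funext => x; rewrite /prox /c /q; case: ifP.
apply: measurable_funM => //; apply: measurable_funX; apply: measurable_pnorm.
exact: measurable_id.
Qed.

End max_norm.

Section mirror_instances.
Context {R : realType} {n : nat}.
Hypothesis n8 : (8 <= n)%N.
Notation L := (ln (n%:R : R)).

Let n0 : 0 < n%:R :> R. Proof. by rewrite ltr0n (leq_trans _ n8). Qed.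
Let L32 : 3 / 2 <= L := ln_ge_3_2 n8.
Let L0 : 0 < L. Proof. by have := L32; lra. Qed.

Lemma mirror_setup2 : mirror_setup (@prox R n 2) (fun y => 2^-1 * dotp y y)
  (fun h => dotp h h) (fun y => y) (rho n 2).
Proof.
have mdot : measurable_fun [set: borelRn R n]
    (fun x : borelRn R n => dotp (x : 'rV[R]_n) x).
  by apply: measurable_dotp; exact: measurable_id.
split.
- move=> z y; rewrite prox2E; have := dotpp_ge0 (z - y).
  by rewrite dotpp_add !dotpNr dotpNl; lra.
- by move=> y; rewrite prox2E; lra.
- by move=> y h; rewrite dotpp_add; lra.
- move=> y; apply/rowP => i; rewrite mxE; apply: derive_line.
  have -> : (fun u : R => prox 2 (y + u *: delta_mx 0 i)) =
      (fun u => 2^-1 * dotp y y + y 0 i * u + 2^-1 * (u * u)).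
    apply/funext => u; rewrite prox2E dotpp_add !dotpZr dotpZl.
    by rewrite dotp_delta dotp_delta_delta; field.
  have id0 := is_derive_id (0 : R) (1 : R).
  have dd := is_deriveD (is_deriveD (is_derive_cst (2^-1 * dotp y y) (0 : R) (1 : R))
    (is_deriveZ (y 0 i) id0)) (is_deriveZ 2^-1 (is_deriveM id0 id0)).
  apply: is_derive_eq dd _.
  by rewrite !scale0r !addr0 scaler0 addr0 add0r [LHS]mulr1.
- by [].
- by rewrite dotp0l mulr0.
- exact: dotpp_ge0.
- by [].
- by move=> t h; rewrite dotpZl dotpZr mulrA expr2.
- exact: dotpp_invariant.
- move=> nu unu; rewrite rho2// -[leRHS](Rintegral_prob_cst nu).
  have e1 : {ae nu, forall x : borelRn R n, dotp (x : 'rV[R]_n) x = 1}.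
    exact: ae_unit_sphere.
  by rewrite (ae_eq_Rintegral _ _ e1).
- exact: measurable_prox.
- exact: measurable_funM.
- by [].
- exact: measurable_id.
Qed.

Let smoothness_rescale (A a b c e k l m : R) : 0 < A -> k * l <= A * m ->
  a <= b + 2 * (c * e) + k * l ->
  (2 * A)^-1 * a <= (2 * A)^-1 * b + A^-1 * c * e + m / 2.
Proof.
move=> A0 hk sm; have A2 : 0 < 2 * A by rewrite mulr_gt0.
rewrite -(ler_pM2l A2) mulrA mulfV ?mul1r ?gt_eqF//.
rewrite (_ : 2 * A * ((2 * A)^-1 * b + A^-1 * c * e + m / 2) =
  b + 2 * (c * e) + A * m); last by field; rewrite gt_eqF.
by apply: le_trans sm _; rewrite lerD2l.
Qed.

Lemma measurable_sgr : measurable_fun [set: R] (Num.sg : R -> R).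
Proof.
apply: nondecreasing_measurable => // x y xy.
have [x0|x0|x0] := ltrgt0P x; have [y0|y0|y0] := ltrgt0P y;
  rewrite ?(gtr0_sg x0) ?(ltr0_sg x0) ?(gtr0_sg y0) ?(ltr0_sg y0) ?x0 ?y0 ?sgr0;
  lra.
Qed.

(** The max norm is not smooth, so the (1 + ln n)-norm stands in for it. Its square is smooth with
    constant ln n and exceeds the squared max norm at most by the factor n^(2 / (1 + ln n)); [Omega]
    is the product of these two prices. *)
Lemma mirror_setup1 : mirror_setup (@prox R n 1) (dual_prox (1 + L) (Omega n 1))
  (fun h => `|h| ^+ 2) (mirror_map (1 + L) (Omega n 1)) (rho n 1).
Proof.
have s2 : 2 < 1 + L by have := L32; lra.
have s0 : 0 < 1 + L by have := L32; lra.
have A0 : 0 < Omega n (1 : R) by exact: lt_le_trans (Omega1_ge1 n8).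
have proxE : @prox R n 1 = (fun x => Omega n 1 / 2 *
    pnorm ((1 + L) / ((1 + L) - 1)) x ^+ 2).
  by apply/funext => x; rewrite prox1E -kappaE.
split; rewrite ?proxE.
- exact: prox_fenchel.
- exact: prox_mirror_map.
- move=> y h; have sm := pnorm_smooth s2 y h.
  have hm := pnorm_le_max h s0.
  rewrite /dual_prox dotp_mirror_map.
  have hm2 : (1 + L - 1) * pnorm (1 + L) h ^+ 2 <= Omega n 1 * `|h| ^+ 2.
    rewrite Omega1E// (_ : 1 + L - 1 = L); last by ring.
    rewrite -mulrA ler_wpM2l ?(ltW L0)//.
    have : pnorm (1 + L) h ^+ 2 <= (n%:R `^ (1 + L)^-1 * `|h|) ^+ 2.
      by rewrite ler_sqr ?nnegrE ?pnorm_ge0// mulr_ge0 ?powR_ge0.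
    by rewrite exprMn -[(n%:R `^ _) ^+ 2]powR_mulrn ?powR_ge0// -powRrM [_^-1 * 2]mulrC.
  exact: (smoothness_rescale A0 hm2 sm).
- exact: grad_prox_mirror_map.
- exact: mirror_map0.
- by rewrite /dual_prox pnorm0// expr0n mulr0.
- by move=> h; exact: sqr_ge0.
- exact: norm_row_sqr_le.
- by move=> t h; rewrite normrZ exprMn real_normK ?num_real.
- exact: norm_row_invariant.
- by move=> nu unu; rewrite rho1//; exact: sphere_max_norm.
- by rewrite -proxE; exact: measurable_prox.
- apply: measurable_funM => //; apply: measurable_funX.
  by apply: measurable_pnorm; exact: measurable_id.
- apply: measurable_funX; apply: continuous_measurable_borelRn.
  exact: norm_continuous.
- apply: measurable_row => i; under eq_fun do rewrite mirror_map_coord.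
  apply: measurable_funM.
    apply: measurable_funM => //.
    apply: (@measurableT_comp _ _ _ _ _ _ (fun t : R => t `^ (2 - (1 + L)))).
      exact: measurable_powR.
    by apply: measurable_pnorm; exact: measurable_id.
  rewrite /sgpow; apply: measurable_funM.
    apply: (@measurableT_comp _ _ _ _ _ _ (Num.sg : R -> R)); last exact: measurable_coord.
    exact: measurable_sgr.
  apply: (@measurableT_comp _ _ _ _ _ _ (fun t : R => t `^ (1 + L - 1))).
    exact: measurable_powR.
  by apply: measurableT_comp => //; exact: measurable_coord.
Qed.

End mirror_instances.

Section rdd_in_dual.
Context {R : realType} {n : nat} {X : Type}.
Variables (d dstar N : 'rV[R]_n -> R) (M : 'rV[R]_n -> 'rV[R]_n) (r : R).
Hypothesis ms : mirror_setup d dstar N M r.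

(** Fenchel at y + h with h = z - M y, smoothness to bound [dstar (y + h)], and N h <= |h|_2^2. *)
Lemma mirror_distance z y : dotp (z - M y) (z - M y) / 2 <= d z + dstar y - dotp z y.
Proof.
pose h := z - M y.
have f1 := ms_fenchel ms z (y + h).
have f2 := ms_smooth ms y h.
have f3 := ms_N_le ms h.
have f4 : dotp h h = dotp z h - dotp (M y) h by rewrite /h dotpBl.
by rewrite dotpDr in f1; rewrite -/h; lra.
Qed.

(* [mirror_distance] makes the minimizer unique, so that [argmin] returns it. *)
Lemma argmin_mirror (h : 'rV[R]_n -> R) (u y : 'rV[R]_n) (c : R) :
  (forall x, h x = d (x - u) - dotp (x - u) y + c) -> argmin h = u + M y.
Proof.
move=> hE; rewrite /argmin.
have f1 := ms_fenchel_eq ms y.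
have hmin : [set x | forall z, h x <= h z] (u + M y).
  move=> z /=; rewrite !hE (addrC u) addrK.
  by have := ms_fenchel ms (z - u) y; lra.
case: xgetP => [x _ xmin|/(_ (u + M y))//].
have := xmin (u + M y); rewrite !hE (addrC u) addrK => le1.
have := mirror_distance (x - u) y => le2.
have : dotp (x - u - M y) (x - u - M y) = 0.
  by apply/eqP; rewrite eq_le dotpp_ge0 andbT; lra.
by move=> /dotpp_eq0/eqP; rewrite subr_eq0 => /eqP <-; rewrite subrK.
Qed.

Lemma grad_shift (f : 'rV[R]_n -> R) (u x : 'rV[R]_n) :
  grad (fun z => f (z - u)) x = grad f (x - u).
Proof.
apply/rowP => i; rewrite !mxE /derive; congr (lim (_ @ 0^')).
by apply/funext => t /=; rewrite addrA.
Qed.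

Fixpoint dual_iterate (p L2 : R) (oracle : 'rV[R]_n -> X -> 'rV[R]_n -> R)
    (m : nat) (e : nat -> 'rV[R]_n) (xis : nat -> nat -> X) (u : 'rV[R]_n)
    (k : nat) : 'rV[R]_n :=
  if k is k'.+1 then
    let y := dual_iterate p L2 oracle m e xis u k' in
    y - (@stepsize R n p L2 * n%:R) *:
      batch_gradient oracle m (u + M y) (xis k') (e k')
  else 0.

(** By [ms_grad] the gradient of the prox-function at the current point is the current dual point.
    Up to terms free of [x], collected in [c], the minimized function is therefore d (x - u) minus
    the inner product of x - u with the next dual point. *)
Lemma rdd_iterate_dual (p L2 : R) oracle (dprox : 'rV[R]_n -> R) m e xis u k :
  (forall x, dprox x = d (x - u)) ->
  rdd_iterate p L2 oracle dprox m e xis u k =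
  u + M (dual_iterate p L2 oracle m e xis u k).
Proof.
move=> dE; have -> : dprox = (fun x => d (x - u)) by apply/funext.
elim: k => [|k IH] /=; first by rewrite (ms_M0 ms) addr0.
rewrite IH; set y := dual_iterate _ _ _ _ _ _ _ k.
set G := batch_gradient _ _ _ _ _; set a := stepsize _ _ * _.
pose x0 := u + M y.
apply: (argmin_mirror (c := - a * dotp G (x0 - u) - d (x0 - u) + dotp y (x0 - u))).
move=> x; rewrite /bregman grad_shift (addrC u) addrK (ms_grad ms).
rewrite -(addrC u) -/x0 (_ : M y = x0 - u); last by rewrite /x0 (addrC u) addrK.
have subE (a1 b1 c1 : 'rV[R]_n) : a1 - b1 = (a1 - c1) - (b1 - c1).
  by rewrite opprB addrA subrK.
rewrite (subE x x0 u).
clearbody x0; clearbody G; clearbody y; clearbody a.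
rewrite !dotpBr !dotpZr !(dotpC _ G) !(dotpC _ y) !dotpBr.
by ring.
Qed.

End rdd_in_dual.

(** * Regularity of the objective *)

Section convex_gradient.
Context {R : realType} {n : nat}.
Implicit Types (x y v : 'rV[R]_n) (phi : 'rV[R]_n -> R).

Lemma derive_dotp_grad phi x v : differentiable phi x ->
  'D_v phi x = dotp (grad phi x) v.
Proof.
move=> dphi; rewrite deriveE// [v in LHS]row_sum_delta linear_sum.
by apply: eq_bigr => i _; rewrite linearZ mxE deriveE// mulrC.
Qed.

(** By convexity the difference quotient from x towards y is at most phi y - phi x for steps in ]0,
    1], and the bound passes to the limit. *)
Lemma convex_gradient_le phi x y : convex_function [set: 'rV[R]_n] phi ->
  differentiable phi x -> phi x + dotp (grad phi x) (y - x) <= phi y.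
Proof.
move=> cphi dphi; rewrite -derive_dotp_grad//.
have dv : derivable phi x (y - x) by exact: diff_derivable.
rewrite addrC -lerBrDr /derive.
set F := (fun h : R => _).
have cF : F h @[h --> 0^'+] --> lim (F h @[h --> 0^']).
  exact: cvg_dnbhs_at_right.
apply: (cvgr_to_le cF); near=> t.
have t0 : 0 < t by near: t; exact: nbhs_right_gt.
have t1 : t <= 1 by near: t; exact: nbhs_right_le.
have := cphi (Itv01 (ltW t0) t1) y x (mem_set Logic.I) (mem_set Logic.I).
rewrite convRE {1}/conv/= /unstable.onem => h.
rewrite /F/= [_ *: _]mulrC ler_pdivrMr//.
have -> : t *: (y - x) + x = t *: y + (1 - t) *: x.
  by rewrite scalerBr scalerBl scale1r -addrA [- _ + _]addrC.
apply: le_trans (lerB h (lexx _)) _.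
by move: (phi y) (phi x) => a b; lra.
Unshelve. all: by end_near. Qed.

Lemma dotp_le_pnorm2 x y : dotp x y <= pnorm 2 x * pnorm 2 y.
Proof.
have [h|h] := leP (dotp x y) 0.
  by apply: le_trans h _; rewrite mulr_ge0// pnorm_ge0.
have a0 := pnorm_ge0 2 x; have b0 := pnorm_ge0 2 y.
have := dotp_cauchy_schwarz x y; rewrite -(pnorm2_sqr x) -(pnorm2_sqr y) -exprMn.
move: (dotp x y) (pnorm 2 x) (pnorm 2 y) a0 b0 h => c a b a0 b0 h.
by rewrite ler_sqr ?nnegrE ?(ltW h) ?mulr_ge0.
Qed.

(** Along a coordinate axis the error divided by [c] is at most t^2, hence has derivative 0 at t =
    0. *)
Lemma grad_of_quadratic_bound phi x (G : 'rV[R]_n) (c : R) : 0 < c ->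
  (forall h, `|phi (x + h) - phi x - dotp G h| <= c * dotp h h) ->
  grad phi x = G.
Proof.
move=> c0 hphi; apply/rowP => i; rewrite mxE; apply: derive_line.
pose r (u : R) := c^-1 * (phi (x + u *: delta_mx 0 i) - phi x - u * G 0 i).
have dr : is_derive (0 : R) 1 r 0.
  apply: (@is_derive_superlinear _ r 2); first by lra.
  move=> t; rewrite /r normrM gtr0_norm ?invr_gt0// ler_pdivrMl//.
  have := hphi (t *: delta_mx 0 i).
  rewrite !dotpZr dotpZl dotp_delta dotp_delta_delta mulr1 => /le_trans; apply.
  by rewrite powR_mulrn// real_normK ?num_real.
have -> : (fun u : R => phi (x + u *: delta_mx 0 i)) =
    (fun u => phi x + G 0 i * u + c * r u).
  by apply/funext => u; rewrite /r; field; rewrite gt_eqF.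
have dd := is_deriveD (is_deriveD (is_derive_cst (phi x) (0 : R) (1 : R))
  (is_deriveZ (G 0 i) (is_derive_id (0 : R) (1 : R)))) (is_deriveZ c dr).
by apply: is_derive_eq dd _; rewrite add0r scaler0 addr0 [LHS]mulr1.
Qed.

End convex_gradient.

Section objective_regularity.
Context {R : realType} {n : nat} {d : measure_display} {X : measurableType d}.
Variables (P : probability X R) (F : 'rV[R]_n -> X -> R).
Variables (g : 'rV[R]_n -> X -> 'rV[R]_n) (L : X -> R) (L2 sigma : R).
Hypothesis L20 : 0 < L2.
Hypothesis sp : stochastic_problem P F g L L2 sigma.
Notation f := (objective P F).
Implicit Types (x y h : 'rV[R]_n).

Lemma measurable_g_at x : measurable_fun [set: X] (g x : X -> borelRn R n).
Proof.
have mx : measurable_fun [set: X] (fun xi => (x, xi) : borelRn R n * X).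
  exact: measurable_fun_pair.
exact: (measurableT_comp (sp_measurable_g sp) mx).
Qed.

(** One null set serves all [x] and [h]. The upper bound uses the convexity inequality at x + h and
    Cauchy-Schwarz for the difference of the gradients, which gives L |h|^2 without a factor 1/2;
    the constants in 4 L2 and mu <= 2 L2 below reflect this. *)
Lemma ae_gradient_bounds :
  {ae P, forall xi, forall x h,
    0 <= F (x + h) xi - F x xi - dotp (g x xi) h <= L xi * dotp h h}.
Proof.
near=> xi => x h.
have cF : convex_function [set: 'rV[R]_n] (F ^~ xi).
  by near: xi; exact: (sp_convex sp).
have gF : forall z, differentiable (F ^~ xi) z /\ grad (F ^~ xi) z = g z xi.
  by near: xi; exact: (sp_gradient sp).
have lF : forall z y, pnorm 2 (g z xi - g y xi) <= L xi * pnorm 2 (z - y).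
  by near: xi; exact: (sp_lipschitz sp).
have cg z y : F z xi + dotp (g z xi) (y - z) <= F y xi.
  by have [dz <-] := gF z; exact: (convex_gradient_le y cF dz).
have h1 := cg x (x + h); have h2 := cg (x + h) x.
have e1 : x + h - x = h by rewrite addrAC subrr add0r.
have e2 : x - (x + h) = - h by rewrite opprD addrA subrr sub0r.
rewrite e1 in h1; rewrite e2 dotpNr in h2.
have h3 : dotp (g (x + h) xi - g x xi) h <= L xi * dotp h h.
  have p0 := pnorm_ge0 2 h; have pl := lF (x + h) x; rewrite e1 in pl.
  have ds := dotp_le_pnorm2 (g (x + h) xi - g x xi) h.
  rewrite -(pnorm2_sqr h).
  move: (pnorm 2 h) (pnorm 2 (_ - _)) p0 pl ds => a b a0 ba /le_trans; apply.
  by rewrite expr2 mulrA ler_wpM2r.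
rewrite dotpBl in h3; apply/andP; split; lra.
Unshelve. all: by end_near. Qed.

Lemma integrable_L_sqr : integrableR P (fun xi => L xi ^+ 2).
Proof.
apply: integrableR_ge0.
- by apply: measurable_funX; exact: (sp_measurable_L sp).
- by move=> xi; exact: sqr_ge0.
have := sp_L2 sp; rewrite unlock.
by case: (\int[P]_w _)%E => [r| |]//= _; rewrite ltry.
Qed.

Lemma integrable_L : integrableR P L.
Proof.
by apply: integrableR_sqr; [exact: (sp_measurable_L sp)|exact: integrable_L_sqr].
Qed.

(** Integrate L <= L^2 / (2 L2) + L2 / 2 and use that the mean of L^2 is at most L2^2. *)
Lemma mean_L_le : \int[P]_xi L xi <= L2.
Proof.
have L2sq : \int[P]_xi (L xi ^+ 2) <= L2 ^+ 2.
  have := sp_L2 sp; rewrite unlock -RintegralE; last exact: integrable_L_sqr.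
  rewrite /= lee_fin => h.
  rewrite -[leLHS]sqr_sqrtr; last by apply: Rintegral_ge0 => ? _; exact: sqr_ge0.
  by rewrite ler_sqr ?nnegrE ?sqrtr_ge0 ?(ltW L20).
have iq : integrableR P (fun xi => (2 * L2)^-1 * L xi ^+ 2).
  by apply: integrableRZ; exact: integrable_L_sqr.
apply: (@le_trans _ _ (\int[P]_xi ((2 * L2)^-1 * L xi ^+ 2 + L2 / 2))).
  apply: le_Rintegral => //; first exact: integrable_L.
    by apply: integrableRD => //; exact: integrableR_cst.
  move=> xi _; rewrite -subr_ge0.
  rewrite (_ : _ - _ = (2 * L2)^-1 * (L xi - L2) ^+ 2); last first.
    by field; rewrite gt_eqF.
  by rewrite mulr_ge0 ?sqr_ge0// invr_ge0 mulr_ge0// ltW.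
rewrite RintegralD//; last exact: (integrableR_cst P (L2 / 2)).
rewrite Rintegral_prob_cst RintegralZl//; last exact: integrable_L_sqr.
have : (2 * L2)^-1 * \int[P]_xi (L xi ^+ 2) <= (2 * L2)^-1 * L2 ^+ 2.
  by rewrite ler_wpM2l// invr_ge0 mulr_ge0// ltW.
by rewrite (_ : (2 * L2)^-1 * L2 ^+ 2 = L2 / 2); [lra|field; rewrite gt_eqF].
Qed.

Lemma measurable_noise_coord x i :
  measurable_fun [set: X] (fun xi => g x xi 0 i - grad f x 0 i).
Proof.
by apply: measurable_funB => //; exact: (proj1 (measurable_rowP _) (measurable_g_at x)).
Qed.

Let noise_sqrE x : (fun xi => pnorm 2 (g x xi - grad f x) ^+ 2) =
  (fun xi => dotp (g x xi - grad f x) (g x xi - grad f x)).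
Proof. by apply/funext => xi; exact: pnorm2_sqr. Qed.

Lemma integrable_noise_sqr x :
  integrableR P (fun xi => dotp (g x xi - grad f x) (g x xi - grad f x)).
Proof.
apply: integrableR_ge0.
- by apply: measurable_dotp; apply: measurable_rowB => //; exact: measurable_g_at.
- by move=> xi; exact: dotpp_ge0.
have := sp_variance sp x; rewrite noise_sqrE unlock.
by move=> /le_lt_trans; apply; rewrite ltry.
Qed.

Lemma noise_variance x :
  \int[P]_xi dotp (g x xi - grad f x) (g x xi - grad f x) <= sigma ^+ 2.
Proof.
have := sp_variance sp x; rewrite noise_sqrE unlock.
by rewrite -RintegralE//; exact: integrable_noise_sqr.
Qed.

(** A finite second moment around a constant vector is enough; at this stage [grad f x] is not yet
    known to be the mean of [g x]. *)
Lemma integrable_g_coord x i : integrableR P (fun xi => g x xi 0 i).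
Proof.
have h : integrableR P (fun xi => g x xi 0 i - grad f x 0 i).
  apply: integrableR_sqr; first exact: measurable_noise_coord.
  apply: (integrableR_le (integrable_noise_sqr x)).
    by apply: measurable_funX; exact: measurable_noise_coord.
  move=> xi; rewrite ger0_norm ?sqr_ge0//.
  by have := coord_sqr_le (g x xi - grad f x) i; rewrite !mxE.
have := integrableRD h (integrableR_cst P (grad f x 0 i)).
by under eq_fun do rewrite subrK.
Qed.

Lemma integrable_dotp_g x h : integrableR P (fun xi => dotp (g x xi) h).
Proof.
apply: integrableR_sum => i; under eq_fun do rewrite mulrC.
by apply: integrableRZ; exact: integrable_g_coord.
Qed.

Lemma Rintegral_dotp_g x h :
  \int[P]_xi dotp (g x xi) h = dotp (\row_i \int[P]_xi g x xi 0 i) h.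
Proof.
rewrite Rintegral_sum; last first.
  move=> i; under eq_fun do rewrite mulrC.
  by apply: integrableRZ; exact: integrable_g_coord.
apply: eq_bigr => i _; rewrite mxE RintegralZr//.
exact: integrable_g_coord.
Qed.

(** The almost sure bounds are integrated around the candidate, the mean of [g x]. By
    [grad_of_quadratic_bound] this identifies the gradient and takes the place of differentiation
    under the integral. *)
Let mean_bounds x h :
  0 <= f (x + h) - f x - dotp (\row_i \int[P]_xi g x xi 0 i) h <= L2 * dotp h h.
Proof.
have iF z : integrableR P (F z) by exact: (sp_integrable sp).
have i1 := integrableRB (iF (x + h)) (iF x).
have i2 := integrableRB i1 (integrable_dotp_g x h).
have -> : f (x + h) - f x - dotp (\row_i \int[P]_xi g x xi 0 i) h =
    \int[P]_xi (F (x + h) xi - F x xi - dotp (g x xi) h).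
  rewrite RintegralB//; last exact: integrable_dotp_g.
  rewrite RintegralB//; [|exact: iF..].
  by rewrite Rintegral_dotp_g.
apply/andP; split.
  rewrite -[leLHS](Rintegral_prob_cst P).
  apply: ae_le_Rintegral => //; first exact: integrableR_cst.
  by apply: filterS ae_gradient_bounds => xi /(_ x h)/andP[].
apply: (@le_trans _ _ (\int[P]_xi (L xi * dotp h h))).
  apply: ae_le_Rintegral => //.
    by under eq_fun do rewrite mulrC; apply: integrableRZ; exact: integrable_L.
  by apply: filterS ae_gradient_bounds => xi /(_ x h)/andP[].
rewrite RintegralZr//; last exact: integrable_L.
by rewrite ler_wpM2r ?dotpp_ge0// mean_L_le.
Qed.

Lemma grad_objective x : grad f x = \row_i \int[P]_xi g x xi 0 i.
Proof.
apply: (grad_of_quadratic_bound L20) => h.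
by have /andP[h1 h2] := mean_bounds x h; rewrite ger0_norm.
Qed.

Lemma objective_bounds x h :
  0 <= f (x + h) - f x - dotp (grad f x) h <= L2 * dotp h h.
Proof. by rewrite grad_objective. Qed.

(** Compare with the point x - grad f x / (2 L2), the minimizer of the quadratic upper bound along
    the gradient. *)
Lemma grad_objective_sqr_le x (fmin : R) : (forall y, fmin <= f y) ->
  dotp (grad f x) (grad f x) <= 4 * L2 * (f x - fmin).
Proof.
move=> hmin; set G := grad f x.
have /andP[_] := objective_bounds x (- (2 * L2)^-1 *: G).
have := hmin (x + (- (2 * L2)^-1 *: G)).
rewrite -/G !dotpZr dotpZl; move: (dotp G G) => D h1 h2.
have : D / (4 * L2) <= f x - fmin.
  rewrite (_ : D / (4 * L2) = - (- (2 * L2)^-1 * D) -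
     L2 * (- (2 * L2)^-1 * (- (2 * L2)^-1 * D))); first by lra.
  by field; rewrite gt_eqF.
by rewrite ler_pdivrMr ?mulr_gt0// mulrC.
Qed.

Lemma continuous_objective : continuous f.
Proof.
move=> x; apply/(@cvgrPdist_lt _ _ _ (nbhs x) (nbhs_filter x)) => e e0.
(* For |h| < 1 the increment is at most c |h|: the linear term contributes the coordinates of the
   gradient, the quadratic one L2 n |h|^2 <= L2 n |h|, and the 1 makes [c] positive. *)
pose c := \sum_(i < n) `|grad f x 0 i| + L2 * n%:R + 1.
have s0 : 0 <= \sum_(i < n) `|grad f x 0 i| by exact: sumr_ge0.
have Ln : 0 <= L2 * n%:R by rewrite mulr_ge0// ltW.
have c0 : 0 < c by rewrite /c; lra.
have d0 : 0 < Num.min 1 (e / c) by rewrite lt_min ltr01 divr_gt0.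
apply/nbhs_ballP; exists (Num.min 1 (e / c)) => // y.
rewrite -ball_normE /ball_/= => hxy; pose h := y - x.
have yE : y = x + h by rewrite /h subrKC.
have hlt : `|h| < Num.min 1 (e / c).
  by rewrite /h distrC.
move: hlt; rewrite lt_min => /andP[h1 h2].
rewrite distrC yE; have /andP[b1 b2] := objective_bounds x h.
have hh : dotp h h <= n%:R * `|h|.
  apply: (@le_trans _ _ (\sum_(i < n) `|h|)); last first.
    by rewrite sumr_const card_ord mulr_natl.
  apply: ler_sum => i _; rewrite -expr2 -[_ ^+ 2]ger0_norm ?sqr_ge0// normrX.
  apply: le_trans (norm_row_coord_le h i); rewrite expr2 ler_piMr//.
  exact: le_trans (norm_row_coord_le h i) (ltW h1).
have gh : `|dotp (grad f x) h| <= \sum_(i < n) `|grad f x 0 i| * `|h|.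
  apply: le_trans (ler_norm_sum _ _ _) _; apply: ler_sum => i _.
  by rewrite normrM ler_wpM2l// norm_row_coord_le.
rewrite -mulr_suml in gh.
have : `|f (x + h) - f x| <= c * `|h|.
  rewrite (_ : f (x + h) - f x = dotp (grad f x) h +
    (f (x + h) - f x - dotp (grad f x) h)); last by ring.
  apply: le_trans (ler_normD _ _) _; rewrite (ger0_norm b1).
  have : L2 * dotp h h <= L2 * n%:R * `|h| by rewrite -mulrA ler_wpM2l ?(ltW L20).
  have := normr_ge0 h; rewrite /c; lra.
move=> /le_lt_trans; apply.
by rewrite mulrC -ltr_pdivlMr.
Qed.

Lemma measurable_objective :
  measurable_fun [set: borelRn R n] (f : borelRn R n -> R).
Proof. exact: continuous_measurable_borelRn continuous_objective. Qed.

(** Each partial derivative is the limit of difference quotients with step 1 / (k + 1), which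
    [objective_bounds] places within L2 / (k + 1) of it. *)
Lemma measurable_grad_objective :
  measurable_fun [set: borelRn R n] (grad f : borelRn R n -> borelRn R n).
Proof.
apply: measurable_row => i.
pose h (k : nat) (x : borelRn R n) :=
  k.+1%:R * (f ((x : 'rV[R]_n) + k.+1%:R^-1 *: delta_mx 0 i) - f x).
apply: (@measurable_fun_cvg _ _ _ setT h) => [k|x _].
  apply: measurable_funM => //; apply: measurable_funB.
    have ms : measurable_fun [set: borelRn R n]
        (fun x : borelRn R n => (x : 'rV[R]_n) + k.+1%:R^-1 *: delta_mx 0 i : borelRn R n).
      by apply: measurable_rowD => //; exact: measurable_id.
    exact: (measurableT_comp measurable_objective ms).
  exact: measurable_objective.
apply/cvgrPdist_le => e e0; near=> k.
have k0 : 0 < k.+1%:R :> R by rewrite ltr0n.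
have /andP[b1 b2] := objective_bounds x (k.+1%:R^-1 *: delta_mx 0 i).
move: b1 b2; rewrite !dotpZr dotpZl dotp_delta dotp_delta_delta mulr1.
set D := f _ - f x; set G := grad f x 0 i => b1 b2.
rewrite distrC (_ : h k x - G = k.+1%:R * (D - k.+1%:R^-1 * G)); last first.
  by rewrite /h -/D; field; rewrite gt_eqF.
rewrite ger0_norm; last by rewrite mulr_ge0// ltW.
apply: (@le_trans _ _ (L2 * k.+1%:R^-1)).
  rewrite -(ler_pM2l (_ : 0 < k.+1%:R^-1)) ?invr_gt0//.
  rewrite mulrA mulVf ?mul1r ?gt_eqF//; apply: le_trans b2 _.
  by rewrite mulrCA.
rewrite ler_pdivrMr// mulrC -ler_pdivrMr//.
apply: (@le_trans _ _ k%:R); last by rewrite ler_nat.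
by near: k; exact: nbhs_infty_ger.
Unshelve. all: by end_near. Qed.

End objective_regularity.

(** * Moments of the stochastic oracle *)

Section sampling_history.
Context {R : realType} {n : nat} {d : measure_display} {X : measurableType d}.
Context {d' : measure_display} {W : measurableType d'}.
Variables (P : probability X R) (Pr : probability W R).
Variables (e : nat -> nat -> W -> 'rV[R]_n) (xi : nat -> nat -> nat -> W -> X).
Hypothesis sa : sampling P Pr e xi.
Notation index := (nat * nat + nat * nat * nat)%type.

(** Only generators: the past is the sigma-algebra that they generate, and being adapted to [S]
    means measurability on [WS S]. *)
Definition history (S : set index) : set_system W :=
  \bigcup_(a in S) draw_events e xi a.

Notation "'WS' S" := (g_sigma_algebraType (history S)) (at level 10).

Lemma draw_events_measurable a : draw_events e xi a `<=` measurable.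
Proof.
case: a => [[k j]|[[k j] i]] _ [B mB <-].
  exact: (sa_measurable_e sa).
exact: (sa_measurable_xi sa).
Qed.

Lemma history_measurable S : history S `<=` measurable.
Proof. by move=> A [a _]; exact: draw_events_measurable. Qed.

Lemma draw_events_setI a : setI_closed (draw_events e xi a).
Proof.
case: a => [[k j]|[[k j] i]] _ _ [A mA <-] [B mB <-];
  by exists (A `&` B); rewrite ?preimage_setI ?setTI//; exact: measurableI.
Qed.

Lemma draw_events_setT a : draw_events e xi a setT.
Proof.
by case: a => [[k j]|[[k j] i]]; exists setT; rewrite ?preimage_setT ?setTI.
Qed.

Lemma adapted_sub d3 (T : measurableType d3) (Y : W -> T) (S S' : set index) :
  S `<=` S' -> measurable_fun [set: WS S] Y -> measurable_fun [set: WS S'] Y.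
Proof.
move=> SS' mY _ B mB; have := mY measurableT B mB; rewrite !setTI.
move: (_ @^-1` _) => A; apply: sub_smallest2r; first exact: smallest_sigma_algebra.
by move=> C [a Sa dA]; exists a => //; exact: SS'.
Qed.

Lemma adapted_measurable d3 (T : measurableType d3) (Y : W -> T) (S : set index) :
  measurable_fun [set: WS S] Y -> measurable_fun [set: W] Y.
Proof. by apply: measurable_fun_coarsen; exact: history_measurable. Qed.

Lemma adapted_e S k j : S (inl (k, j)) ->
  measurable_fun [set: WS S] (e k j : WS S -> borelRn R n).
Proof.
move=> Skj _ B mB; apply: sub_sigma_algebra; exists (inl (k, j)) => //.
by exists B.
Qed.

Lemma adapted_xi S k j i : S (inr (k, j, i)) ->
  measurable_fun [set: WS S] (xi k j i : WS S -> X).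
Proof.
move=> Skj _ B mB; apply: sub_sigma_algebra; exists (inr (k, j, i)) => //.
by exists B.
Qed.

Definition direction k j : {mfun W >-> borelRn R n} :=
  mfun_Sub (mem_set (sa_measurable_e sa k j)).

Definition direction_law k j : probability (borelRn R n) R :=
  distribution Pr (direction k j).

Lemma uniform_direction_law k j : uniform_on_sphere (direction_law k j).
Proof. exact: (sa_law_e sa k j). Qed.

Let indep S z A B : ~ S z -> <<s history S >> A -> draw_events e xi z B ->
  Pr (A `&` B) = (Pr A * Pr B)%E.
Proof.
apply: mutually_independent_sigma (sa_independent sa) _ _ _.
- exact: draw_events_measurable.
- exact: draw_events_setI.
- exact: draw_events_setT.
Qed.

Lemma independent_direction S k j A (B : set (borelRn R n)) :
  ~ S (inl (k, j)) ->
  <<s history S >> A -> measurable B ->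
  Pr (A `&` e k j @^-1` B) = (Pr A * direction_law k j B)%E.
Proof.
move=> Skj sA mB; rewrite (indep Skj sA)//; exists B => //.
by rewrite setTI.
Qed.

Lemma independent_sample S k j i A (B : set X) : ~ S (inr (k, j, i)) ->
  <<s history S >> A -> measurable B ->
  Pr (A `&` xi k j i @^-1` B) = (Pr A * P B)%E.
Proof.
move=> Skj sA mB; rewrite (indep Skj sA); last by exists B => //; rewrite setTI.
by rewrite -(sa_law_xi sa k j i).
Qed.

Lemma ae_direction k j : {ae Pr, forall w, dotp (e k j w) (e k j w) = 1}.
Proof.
exists (e k j @^-1` ~` unit_sphere); split.
- rewrite -[X in measurable X]setTI; apply: (sa_measurable_e sa) => //.
  by apply: measurableC; exact: measurable_unit_sphere.
- have h : Pr (e k j @^-1` unit_sphere) = 1%E.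
    by have [] := sa_law_e sa k j.
  rewrite -preimage_setC probability_setC ?h ?subee//.
  rewrite -[X in measurable X]setTI; apply: (sa_measurable_e sa) => //.
  exact: measurable_unit_sphere.
- by move=> w /= wN xs; apply: wN; apply/unit_sphereE.
Qed.

Section quadratic_form.
Variables (S : set index) (k j : nat).
Hypothesis Skj : ~ S (inl (k, j)).
Variables (Y Z : W -> 'rV[R]_n) (phi : 'rV[R]_n -> R).
Hypothesis mY : measurable_fun [set: WS S] (Y : WS S -> borelRn R n).
Hypothesis mZ : measurable_fun [set: WS S] (Z : WS S -> borelRn R n).
Hypothesis iY : integrableR Pr (fun w => dotp (Y w) (Y w)).
Hypothesis iZ : integrableR Pr (fun w => dotp (Z w) (Z w)).
Hypothesis mphi : measurable_fun [set: borelRn R n] (phi : borelRn R n -> R).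
Hypothesis phi_le1 : forall x, dotp x x = 1 -> `|phi x| <= 1.
Hypothesis phi_inv : signed_perm_invariant phi.

Let quadratic_le (y z u : 'rV[R]_n) : dotp u u = 1 ->
  `|dotp y u * dotp z u * phi u| <= dotp y y + dotp z z.
Proof.
move=> u1; rewrite normrM -[leRHS]mulr1 ler_pM//; last exact: phi_le1.
have := dotp_cauchy_schwarz y u; have := dotp_cauchy_schwarz z u.
rewrite u1 !mulr1; move: (dotp y u) (dotp z u) => a b ha hb.
by rewrite ler_norml; apply/andP; split; have := sqr_ge0 (a + b);
  have := sqr_ge0 (a - b); have := sqr_ge0 a; have := sqr_ge0 b; nra.
Qed.

(** [Y] and [Z] are frozen, the form is expanded in coordinates, and [sphere_isotropic] leaves only
    the diagonal. Integrability comes from the bound |Y|^2 + |Z|^2, valid whenever the direction has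
    unit length. *)
Lemma direction_quadratic_form :
  integrableR Pr (fun w => dotp (Y w) (e k j w) * dotp (Z w) (e k j w) * phi (e k j w)) /\
  \int[Pr]_w (dotp (Y w) (e k j w) * dotp (Z w) (e k j w) * phi (e k j w)) =
  (\int[direction_law k j]_u phi u) / n%:R * \int[Pr]_w dotp (Y w) (Z w).
Proof.
pose nu := direction_law k j.
have unu : uniform_on_sphere nu := uniform_direction_law k j.
pose h (w : W) (u : borelRn R n) := dotp (Y w) u * dotp (Z w) u * phi u.
have m1 : measurable_fun [set: WS S * borelRn R n] (fun x => Y x.1 : borelRn R n).
  exact: (measurableT_comp mY measurable_fst).
have m2 : measurable_fun [set: WS S * borelRn R n] (fun x => Z x.1 : borelRn R n).
  exact: (measurableT_comp mZ measurable_fst).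
have m3 : measurable_fun [set: WS S * borelRn R n] (fun x => x.2 : borelRn R n).
  exact: measurable_snd.
have mh : measurable_fun [set: WS S * borelRn R n] (fun x => h x.1 x.2).
  apply: measurable_funM.
    by apply: measurable_funM; exact: measurable_dotp.
  exact: (measurableT_comp mphi m3).
have mhw w : measurable_fun [set: borelRn R n] (h w).
  apply: measurable_funM => //; apply: measurable_funM;
    apply: measurable_dotp => //; exact: measurable_id.
have inu w : integrableR nu (h w).
  exact: (sphere_bounded_integrable unu (mhw w) (@quadratic_le (Y w) (Z w))).
have ih : integrableR Pr (fun w => h w (e k j w)).
  apply: (integrableR_ae_le _ (integrableRD iY iZ)).
    have := measurable_freeze (history_measurable (S := S)) (sa_measurable_e sa k j) mh.
    by [].
  by apply: filterS (ae_direction k j) => w; exact: quadratic_le.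
have iab a b : integrableR nu (fun u : borelRn R n => (u : 'rV[R]_n) 0 a * (u : 'rV[R]_n) 0 b * phi u).
  apply: (sphere_bounded_integrable (C := 1) unu).
    apply: measurable_funM => //; apply: measurable_funM; exact: measurable_coord.
  move=> u u1; rewrite !normrM -[leRHS]mulr1 ler_pM//; last exact: phi_le1.
  have c1 c : `|u 0 c| <= 1.
    rewrite -(@ler_pXn2r _ 2)// ?nnegrE// expr1n real_normK ?num_real//.
    by rewrite -u1 coord_sqr_le.
  by rewrite -[leRHS]mulr1 ler_pM.
have inner w : \int[nu]_u h w u = (\int[nu]_u phi u) / n%:R * dotp (Y w) (Z w).
  transitivity (\int[nu]_u \sum_(a < n) \sum_(b < n)
      (Y w 0 a * Z w 0 b) * ((u : 'rV[R]_n) 0 a * (u : 'rV[R]_n) 0 b * phi u)).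
    apply: eq_Rintegral => u _; rewrite /h /dotp !mulr_suml; apply: eq_bigr => a _.
    rewrite mulr_sumr mulr_suml; apply: eq_bigr => b _; ring.
  rewrite Rintegral_sum; last first.
    by move=> a; apply: integrableR_sum => b; exact: integrableRZ.
  rewrite (eq_bigr (fun a => Y w 0 a * Z w 0 a * (n%:R^-1 * \int[nu]_u phi u))).
    by rewrite -mulr_suml mulrC [X in X * _]mulrC.
  move=> a _; rewrite Rintegral_sum; last by move=> b; exact: integrableRZ.
  rewrite (bigD1 a)//= big1 ?addr0; last first.
    move=> b ba; rewrite RintegralZl//; last exact: iab.
    by rewrite (sphere_isotropic unu _ _ mphi phi_le1 phi_inv) eq_sym (negPf ba) !mul0r mulr0.
  rewrite RintegralZl//; last exact: iab.
  by rewrite (sphere_isotropic unu _ _ mphi phi_le1 phi_inv) eqxx mul1r.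
have [i1 E1] := Rintegral_freeze (history_measurable (S := S)) (sa_measurable_e sa k j)
  (fun A B => @independent_direction S k j A B Skj) mh inu ih.
split=> //; rewrite E1 (eq_Rintegral _ (fun w _ => inner w)).
rewrite RintegralZl//.
apply: (integrableR_le (integrableRD iY iZ)).
  by apply: adapted_measurable; exact: measurable_dotp mY mZ.
move=> w; rewrite ler_norml.
have := dotpp_ge0 (Y w + Z w); have := dotpp_ge0 (Y w - Z w).
have := dotpp_ge0 (Y w); have := dotpp_ge0 (Z w).
by rewrite !dotpp_add dotpNr dotpNr dotpNl; lra.
Qed.

End quadratic_form.
End sampling_history.

Lemma dotp_norm_le {R : realType} {n : nat} (y z : 'rV[R]_n) :
  `|dotp y z| <= dotp y y + dotp z z.
Proof.
rewrite ler_norml; have := dotpp_ge0 (y + z); have := dotpp_ge0 (y - z).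
have := dotpp_ge0 y; have := dotpp_ge0 z.
by rewrite !dotpp_add dotpNr dotpNr dotpNl; lra.
Qed.

Lemma sqr_mean_le {R : realType} (m : nat) (a : nat -> R) : (0 < m)%N ->
  (m%:R^-1 * \sum_(i < m) a i) ^+ 2 <= m%:R^-1 * \sum_(i < m) a i ^+ 2.
Proof.
move=> m0; have mR : 0 < m%:R :> R by rewrite ltr0n.
pose u : 'rV[R]_m := \row_i a i; pose v : 'rV[R]_m := \row_i 1.
have := dotp_cauchy_schwarz u v.
have -> : dotp u v = \sum_(i < m) a i by apply: eq_bigr => i _; rewrite !mxE mulr1.
have -> : dotp u u = \sum_(i < m) a i ^+ 2 by apply: eq_bigr => i _; rewrite !mxE expr2.
have -> : dotp v v = m%:R.
  rewrite /dotp (eq_bigr (fun=> 1)); last by move=> i _; rewrite !mxE mulr1.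
  by rewrite sumr_const card_ord.
move: (\sum_(i < m) _) (\sum_(i < m) _) => s t h.
rewrite exprMn exprVn expr2 invfM -mulrA ler_pM2l ?invr_gt0//.
by rewrite ler_pdivrMl// mulrC.
Qed.

Section integrable_rows.
Context {R : realType} {n : nat} {d : measure_display} {T : measurableType d}.
Variable mu : {measure set T -> \bar R}.
Implicit Types Y Z : T -> 'rV[R]_n.

Lemma integrableR_dotp Y Z :
  measurable_fun [set: T] (Y : T -> borelRn R n) ->
  measurable_fun [set: T] (Z : T -> borelRn R n) ->
  integrableR mu (fun w => dotp (Y w) (Y w)) ->
  integrableR mu (fun w => dotp (Z w) (Z w)) ->
  integrableR mu (fun w => dotp (Y w) (Z w)).
Proof.
move=> mY mZ iY iZ; apply: (integrableR_le (integrableRD iY iZ)).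
  exact: measurable_dotp.
by move=> w; exact: dotp_norm_le.
Qed.

End integrable_rows.

Section oracle_moments.
Context {R : realType} {n : nat} {d : measure_display} {X : measurableType d}.
Context {d' : measure_display} {W : measurableType d'}.
Variables (P : probability X R) (Pr : probability W R).
Variables (e : nat -> nat -> W -> 'rV[R]_n) (xi : nat -> nat -> nat -> W -> X).
Hypothesis sa : sampling P Pr e xi.
Variables (F : 'rV[R]_n -> X -> R) (g : 'rV[R]_n -> X -> 'rV[R]_n) (L : X -> R).
Variables (L2 sigma : R).
Hypothesis L20 : 0 < L2.
Hypothesis sp : stochastic_problem P F g L L2 sigma.
Notation f := (objective P F).
Notation index := (nat * nat + nat * nat * nat)%type.
Notation "'WS' S" := (g_sigma_algebraType (history e xi S)) (at level 10).

Variables (S : set index) (k j : nat).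
Hypothesis Se : ~ S (inl (k, j)).
Hypothesis Sxi : forall i, ~ S (inr (k, j, i)).
Variable x : W -> 'rV[R]_n.
Hypothesis mx : measurable_fun [set: WS S] (x : WS S -> borelRn R n).
Hypothesis igrad : integrableR Pr (fun w => dotp (grad f (x w)) (grad f (x w))).

Definition sample_error i w := g (x w) (xi k j i w) - grad f (x w).

(** The past enlarged by chosen samples of the current step, but never by its direction. The choices
    made below are no sample, one other sample, and all samples. *)
Definition with_samples (I : set nat) : set index :=
  [set a | S a \/ exists2 i, I i & a = inr (k, j, i)].

Lemma with_samples_sub I : S `<=` with_samples I.
Proof. by move=> a; left. Qed.

Lemma direction_notin_with_samples I : ~ with_samples I (inl (k, j)).
Proof. by case=> [|[]]. Qed.

Let measurable_g_joint S' : S `<=` S' -> measurable_fun [set: WS S' * X]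
  (fun z => g (x z.1) z.2 : borelRn R n).
Proof.
move=> SS'; have mx' := adapted_sub SS' mx.
have mp : measurable_fun [set: WS S' * X] (fun z => (x z.1, z.2) : borelRn R n * X).
  apply: measurable_fun_pair; last exact: measurable_snd.
  exact: (measurableT_comp mx' measurable_fst).
exact: (measurableT_comp (sp_measurable_g sp) mp).
Qed.

Let measurable_grad_joint S' : S `<=` S' -> measurable_fun [set: WS S' * X]
  (fun z => grad f (x z.1) : borelRn R n).
Proof.
move=> SS'; have mx' := adapted_sub SS' mx.
exact: (measurableT_comp (measurable_grad_objective L20 sp)
  (measurableT_comp mx' measurable_fst)).
Qed.

Lemma adapted_grad : measurable_fun [set: WS S] (fun w => grad f (x w) : borelRn R n).
Proof. exact: (measurableT_comp (measurable_grad_objective L20 sp) mx). Qed.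

Lemma adapted_sample_error I i : I i ->
  measurable_fun [set: WS (with_samples I)] (sample_error i : _ -> borelRn R n).
Proof.
move=> Ii; apply: measurable_rowB; last first.
  exact: (adapted_sub (@with_samples_sub I) adapted_grad).
have mxi : measurable_fun [set: WS (with_samples I)] (xi k j i).
  by apply: adapted_xi; right; exists i.
have mp : measurable_fun [set: WS (with_samples I)]
    (fun w => (x w, xi k j i w) : borelRn R n * X).
  by apply: measurable_fun_pair => //; exact: (adapted_sub (@with_samples_sub I) mx).
exact: (measurableT_comp (sp_measurable_g sp) mp).
Qed.

Let measurable_sample_error i :
  measurable_fun [set: W] (sample_error i : W -> borelRn R n).
Proof. exact: (adapted_measurable sa (@adapted_sample_error setT i Logic.I)). Qed.

Lemma sample_error_variance i :
  integrableR Pr (fun w => dotp (sample_error i w) (sample_error i w)) /\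
  \int[Pr]_w dotp (sample_error i w) (sample_error i w) <= sigma ^+ 2.
Proof.
pose h w z := dotp (g (x w) z - grad f (x w)) (g (x w) z - grad f (x w)).
have mh : measurable_fun [set: WS S * X] (fun z => h z.1 z.2).
  by apply: measurable_dotp; apply: measurable_rowB;
    [exact: measurable_g_joint|exact: measurable_grad_joint|
     exact: measurable_g_joint|exact: measurable_grad_joint].
have [] := ge0_freeze_le (history_measurable sa (S := S))
  (sa_measurable_xi sa k j i)
  (fun A B sA mB => independent_sample sa (@Sxi i) sA mB) mh
  (fun w z => dotpp_ge0 _) (integrableR_cst Pr (sigma ^+ 2)).
  apply: nearW => w.
  have iw : integrableR P (h w) by exact: (integrable_noise_sqr sp).
  by rewrite -RintegralE// lee_fin; exact: (noise_variance sp).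
by rewrite Rintegral_prob_cst.
Qed.

(** Given the past and other samples, [g] has conditional mean [grad f] at the current point, so the
    error is orthogonal to whatever they determine. *)
Lemma sample_error_orthogonal I i (Y : W -> 'rV[R]_n) : ~ I i ->
  measurable_fun [set: WS (with_samples I)] (Y : _ -> borelRn R n) ->
  integrableR Pr (fun w => dotp (Y w) (Y w)) ->
  integrableR Pr (fun w => dotp (sample_error i w) (Y w)) /\
  \int[Pr]_w dotp (sample_error i w) (Y w) = 0.
Proof.
move=> Ii mY iY; pose S' := with_samples I.
have mYW := adapted_measurable sa mY.
have [iE _] := sample_error_variance i.
have S'i : ~ S' (inr (k, j, i)).
  by case=> [/Sxi|[i' Ii' []]]// E; rewrite E in Ii.
pose h w z := dotp (g (x w) z - grad f (x w)) (Y w).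
have mh : measurable_fun [set: WS S' * X] (fun z => h z.1 z.2).
  apply: measurable_dotp; last exact: (measurableT_comp mY measurable_fst).
  by apply: measurable_rowB;
    [apply: measurable_g_joint|apply: measurable_grad_joint]; exact: with_samples_sub.
have ih : integrableR Pr (fun w => h w (xi k j i w)).
  exact: (integrableR_dotp (measurable_sample_error i) mYW iE iY).
have iP w : integrableR P (h w).
  rewrite /h; under eq_fun do rewrite dotpBl.
  apply: integrableRB; first exact: (integrable_dotp_g sp).
  exact: integrableR_cst.
have [_ E] := Rintegral_freeze (history_measurable sa (S := S'))
  (sa_measurable_xi sa k j i)
  (fun A B sA mB => independent_sample sa S'i sA mB) mh iP ih.
split => //; rewrite E.
have inner w : \int[P]_z h w z = 0.
  rewrite /h; under eq_Rintegral do rewrite dotpBl.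
  rewrite RintegralB//; [|exact: (integrable_dotp_g sp)|exact: integrableR_cst].
  rewrite (Rintegral_dotp_g sp) Rintegral_prob_cst.
  by rewrite (grad_objective L20 sp) subrr.
by rewrite (eq_Rintegral _ (fun w _ => inner w)) Rintegral_prob_cst.
Qed.

Section batch.
Variable m : nat.
Hypothesis m0 : (0 < m)%N.

Definition batch_error w := m%:R^-1 *: \sum_(i < m) sample_error i w.

Lemma adapted_batch_error :
  measurable_fun [set: WS (with_samples setT)] (batch_error : _ -> borelRn R n).
Proof.
apply: measurable_rowZ => //; apply: measurable_row_sum => i.
exact: adapted_sample_error.
Qed.

Lemma batch_error_orthogonal (Y : W -> 'rV[R]_n) :
  measurable_fun [set: WS S] (Y : WS S -> borelRn R n) ->
  integrableR Pr (fun w => dotp (Y w) (Y w)) ->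
  integrableR Pr (fun w => dotp (batch_error w) (Y w)) /\
  \int[Pr]_w dotp (batch_error w) (Y w) = 0.
Proof.
move=> mY iY.
have mY0 := adapted_sub (@with_samples_sub set0) mY.
have h i := @sample_error_orthogonal set0 i Y (fun f => f) mY0 iY.
have E w : dotp (batch_error w) (Y w) =
    m%:R^-1 * \sum_(i < m) dotp (sample_error i w) (Y w).
  by rewrite dotpZl dotp_suml.
have isum : integrableR Pr (fun w => \sum_(i < m) dotp (sample_error i w) (Y w)).
  by apply: integrableR_sum => i; exact: (h i).1.
split; first by under eq_fun do rewrite E; exact: integrableRZ.
under eq_Rintegral do rewrite E.
rewrite RintegralZl// Rintegral_sum; last by move=> i; exact: (h i).1.
by rewrite big1 ?mulr0// => i _; exact: (h i).2.
Qed.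

Lemma batch_error_variance :
  integrableR Pr (fun w => dotp (batch_error w) (batch_error w)) /\
  \int[Pr]_w dotp (batch_error w) (batch_error w) <= sigma ^+ 2 / m%:R.
Proof.
have mR : 0 < m%:R :> R by rewrite ltr0n.
have iE i i' : integrableR Pr (fun w => dotp (sample_error i w) (sample_error i' w)).
  by apply: integrableR_dotp => //; exact: (sample_error_variance _).1.
have E w : dotp (batch_error w) (batch_error w) = m%:R ^- 2 *
    \sum_(i < m) \sum_(i' < m) dotp (sample_error i w) (sample_error i' w).
  rewrite dotpZl dotpZr mulrA -invfM -expr2; congr (_ * _).
  rewrite dotp_suml; apply: eq_bigr => i _.
  by rewrite dotpC dotp_suml; apply: eq_bigr => i' _; exact: dotpC.
have isum : integrableR Pr (fun w =>
    \sum_(i < m) \sum_(i' < m) dotp (sample_error i w) (sample_error i' w)).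
  by apply: integrableR_sum => i; apply: integrableR_sum => i'; exact: iE.
split; first by under eq_fun do rewrite E; exact: integrableRZ.
under eq_Rintegral do rewrite E.
rewrite RintegralZl// Rintegral_sum; last first.
  by move=> i; apply: integrableR_sum => i'; exact: iE.
apply: (@le_trans _ _ (m%:R ^- 2 * \sum_(i < m) sigma ^+ 2)); last first.
  rewrite sumr_const card_ord -mulr_natr le_eqVlt; apply/orP; left; apply/eqP.
  by field; rewrite gt_eqF.
rewrite ler_wpM2l ?invr_ge0 ?exprn_ge0 ?(ltW mR)//; apply: ler_sum => i _.
rewrite Rintegral_sum; last by move=> i'; exact: iE.
rewrite (bigD1 i)//= big1 ?addr0; first exact: (sample_error_variance i).2.
move=> i' /eqP i'i.
(* For a cross term sample [i'] joins the past, so that its error is an admissible [Y] for sample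
   [i]. Only the diagonal survives, whence sigma^2 / m. *)
have mi' := @adapted_sample_error [set (i' : nat)] i' erefl.
apply: (proj2 (@sample_error_orthogonal [set (i' : nat)] i _ _ mi' _)).
  by move=> /= /val_inj ii'; apply: i'i.
exact: (sample_error_variance i').1.
Qed.

Definition batch_mean w := grad f (x w) + batch_error w.

Lemma batch_meanE w : batch_mean w = m%:R^-1 *: \sum_(i < m) g (x w) (xi k j i w).
Proof.
rewrite /batch_mean /batch_error /sample_error sumrB sumr_const card_ord.
rewrite scalerBr -(scaler_nat m (grad f (x w))) scalerA mulVf ?scale1r ?subrKC//.
by rewrite pnatr_eq0 -lt0n.
Qed.

Lemma adapted_batch_mean :
  measurable_fun [set: WS (with_samples setT)] (batch_mean : _ -> borelRn R n).
Proof.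
apply: measurable_rowD; last exact: adapted_batch_error.
exact: (adapted_sub (@with_samples_sub setT) adapted_grad).
Qed.

Lemma batch_mean_sqr :
  integrableR Pr (fun w => dotp (batch_mean w) (batch_mean w)) /\
  \int[Pr]_w dotp (batch_mean w) (batch_mean w) <=
  \int[Pr]_w dotp (grad f (x w)) (grad f (x w)) + sigma ^+ 2 / m%:R.
Proof.
have [iE Ele] := batch_error_variance.
have [io Eo] := batch_error_orthogonal adapted_grad igrad.
have i1 := integrableRD (integrableRD igrad (integrableRZ 2 io)) iE.
have E w : dotp (batch_mean w) (batch_mean w) =
    dotp (grad f (x w)) (grad f (x w)) + 2 * dotp (batch_error w) (grad f (x w)) +
    dotp (batch_error w) (batch_error w) by rewrite dotpp_add (dotpC (grad f _)).
split; first by under eq_fun do rewrite E.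
under eq_Rintegral do rewrite E.
have i2 := integrableRD igrad (integrableRZ 2 io).
rewrite (RintegralD measurableT i2 iE) (RintegralD measurableT igrad (integrableRZ 2 io)).
by rewrite RintegralZl// Eo mulr0 addr0 lerD2l.
Qed.

Lemma batch_mean_dotp (Y : W -> 'rV[R]_n) :
  measurable_fun [set: WS S] (Y : WS S -> borelRn R n) ->
  integrableR Pr (fun w => dotp (Y w) (Y w)) ->
  \int[Pr]_w dotp (batch_mean w) (Y w) = \int[Pr]_w dotp (grad f (x w)) (Y w).
Proof.
move=> mY iY; have [io Eo] := batch_error_orthogonal mY iY.
have ig : integrableR Pr (fun w => dotp (grad f (x w)) (Y w)).
  apply: integrableR_dotp => //; first exact: (adapted_measurable sa adapted_grad).
  exact: (adapted_measurable sa mY).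
under eq_Rintegral do rewrite dotpDl.
by rewrite RintegralD// Eo addr0.
Qed.

End batch.

Section noise.
Variables (noise : 'rV[R]_n -> X -> 'rV[R]_n -> R) (D : R).
Hypothesis mnoise : measurable_fun [set: borelRn R n * X * borelRn R n]
  (fun z => noise z.1.1 z.1.2 z.2).
Hypothesis noiseD : forall y u, dotp u u = 1 ->
  (\int[P]_z (noise y z u ^+ 2)%:E <= D%:E)%E.
Variable phi : 'rV[R]_n -> R.
Hypothesis mphi : measurable_fun [set: borelRn R n] (phi : borelRn R n -> R).
Hypothesis phi_ge0 : forall u, 0 <= phi u.
Hypothesis phi_le1 : forall u, dotp u u = 1 -> phi u <= 1.

Let mphi_e : measurable_fun [set: W] (fun w => phi (e k j w)).
Proof. exact: (measurableT_comp mphi (sa_measurable_e sa k j)). Qed.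

Lemma integrable_phi_direction : integrableR Pr (fun w => phi (e k j w)).
Proof.
apply: (integrableR_ae_bounded (C := 1) mphi_e).
by apply: filterS (ae_direction sa k j) => w w1; rewrite ger0_norm// phi_le1.
Qed.

Lemma Rintegral_phi_direction :
  \int[Pr]_w phi (e k j w) = \int[direction_law sa k j]_u phi u.
Proof.
congr fine; rewrite integral_distribution//; first exact/measurable_EFinP.
exact: integrable_phi_direction.
Qed.

(** Here the direction joins the past before the samples are integrated out: the noise may depend on
    it, and its second moment is bounded for each fixed direction. *)
Let with_direction : set index := S `|` [set inl (k, j)].

Lemma sample_noise_sqr i :
  integrableR Pr (fun w => noise (x w) (xi k j i w) (e k j w) ^+ 2 * phi (e k j w)) /\
  \int[Pr]_w (noise (x w) (xi k j i w) (e k j w) ^+ 2 * phi (e k j w)) <=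
  D * \int[direction_law sa k j]_u phi u.
Proof.
have Si : ~ with_direction (inr (k, j, i)) by case=> // /Sxi.
pose h w z := noise (x w) z (e k j w) ^+ 2 * phi (e k j w).
have me : measurable_fun [set: WS with_direction] (e k j : _ -> borelRn R n).
  by apply: adapted_e; right.
have mx' : measurable_fun [set: WS with_direction] (x : _ -> borelRn R n).
  by apply: adapted_sub mx => a; left.
have mh : measurable_fun [set: WS with_direction * X] (fun z => h z.1 z.2).
  have mp : measurable_fun [set: WS with_direction * X]
      (fun z => (x z.1, z.2, e k j z.1) : borelRn R n * X * borelRn R n).
    apply: measurable_fun_pair.
      apply: measurable_fun_pair; last exact: measurable_snd.
      exact: (measurableT_comp mx' measurable_fst).
    exact: (measurableT_comp me measurable_fst).
  apply: measurable_funM.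
    by apply: measurable_funX; exact: (measurableT_comp mnoise mp).
  exact: (measurableT_comp mphi (measurableT_comp me measurable_fst)).
have mnz y u : measurable_fun [set: X] (fun z => noise y z u).
  have mp : measurable_fun [set: X] (fun z => (y, z, u) : borelRn R n * X * borelRn R n).
    by apply: measurable_fun_pair => //; exact: measurable_fun_pair.
  exact: (measurableT_comp mnoise mp).
have h0 w z : 0 <= h w z by rewrite mulr_ge0 ?sqr_ge0.
have [|i1 E1] := ge0_freeze_le (history_measurable sa (S := with_direction))
  (sa_measurable_xi sa k j i)
  (fun A B sA mB => independent_sample sa Si sA mB)
  mh h0 (integrableRZ D integrable_phi_direction).
  apply: filterS (ae_direction sa k j) => w w1.
  rewrite /h; under eq_integral do rewrite EFinM muleC.
  rewrite ge0_integralZl//=.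
  - by rewrite [D * _]mulrC EFinM lee_wpmul2l ?lee_fin//; exact: noiseD.
  - by apply/measurable_EFinP; exact: measurable_funX.
  - by move=> z _; rewrite lee_fin sqr_ge0.
  - by rewrite lee_fin.
split => //; apply: le_trans E1 _.
rewrite RintegralZl//; last exact: integrable_phi_direction.
by rewrite Rintegral_phi_direction.
Qed.

(** The noise need not be centred, so averaging over the batch gains no factor 1 / m; convexity of
    the square preserves the bound. *)
Lemma mean_noise_sqr m : (0 < m)%N ->
  let mean w := m%:R^-1 * \sum_(i < m) noise (x w) (xi k j i w) (e k j w) in
  [/\ measurable_fun [set: W] mean,
      integrableR Pr (fun w => mean w ^+ 2 * phi (e k j w)) &
      \int[Pr]_w (mean w ^+ 2 * phi (e k j w)) <=
      D * \int[direction_law sa k j]_u phi u].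
Proof.
move=> m0 mean; have mR : 0 < m%:R :> R by rewrite ltr0n.
have mmean : measurable_fun [set: W] mean.
  apply: measurable_funM => //; apply: measurable_sum => i.
  have mp : measurable_fun [set: W]
      (fun w => (x w, xi k j i w, e k j w) : borelRn R n * X * borelRn R n).
    apply: measurable_fun_pair; last exact: (sa_measurable_e sa).
    apply: measurable_fun_pair; last exact: (sa_measurable_xi sa).
    exact: (adapted_measurable sa mx).
  exact: (measurableT_comp mnoise mp).
pose B w := m%:R^-1 *
  \sum_(i < m) (noise (x w) (xi k j i w) (e k j w) ^+ 2 * phi (e k j w)).
have iS : integrableR Pr (fun w =>
    \sum_(i < m) (noise (x w) (xi k j i w) (e k j w) ^+ 2 * phi (e k j w))).
  by apply: integrableR_sum => i; exact: (sample_noise_sqr i).1.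
have iB : integrableR Pr B by exact: integrableRZ.
have leB w : mean w ^+ 2 * phi (e k j w) <= B w.
  rewrite /B -mulr_suml mulrA ler_wpM2r//.
  exact: (sqr_mean_le (fun i => noise (x w) (xi k j i w) (e k j w)) m0).
have imean : integrableR Pr (fun w => mean w ^+ 2 * phi (e k j w)).
  apply: (integrableR_le iB).
    by apply: measurable_funM => //; exact: measurable_funX.
  by move=> w; rewrite ger0_norm ?leB// mulr_ge0 ?sqr_ge0.
split => //.
apply: (@le_trans _ _ (\int[Pr]_w B w)); first exact: le_Rintegral.
rewrite RintegralZl// Rintegral_sum; last by move=> i; exact: (sample_noise_sqr i).1.
rewrite ler_pdivrMl//; apply: (@le_trans _ _ (\sum_(i < m) (D * \int[direction_law sa k j]_u phi u))).
  by apply: ler_sum => i _; exact: (sample_noise_sqr i).2.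
by rewrite sumr_const card_ord mulr_natl.
Qed.

End noise.

End oracle_moments.

(** * One run of RDD *)

Section mean_bounds.
Context {R : realType} {d : measure_display} {T : measurableType d}.
Variable mu : {measure set T -> \bar R}.

(** Integrability is part of the bound, because the real-valued integral of a non-integrable
    function may be a default value. The estimates of a step are added up as such pairs. *)
Definition mean_le (h : T -> R) (c : R) := integrableR mu h /\ \int[mu]_x h x <= c.

Lemma mean_leD h1 h2 c1 c2 : mean_le h1 c1 -> mean_le h2 c2 ->
  mean_le (fun x => h1 x + h2 x) (c1 + c2).
Proof.
move=> [i1 le1] [i2 le2]; split; first exact: integrableRD.
by rewrite RintegralD// lerD.
Qed.

Lemma mean_leZ k h c : 0 <= k -> mean_le h c -> mean_le (fun x => k * h x) (k * c).
Proof.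
move=> k0 [ih leh]; split; first exact: integrableRZ.
by rewrite RintegralZl// ler_wpM2l.
Qed.

Lemma mean_le_self h : integrableR mu h -> mean_le h (\int[mu]_x h x).
Proof. by split. Qed.

Lemma mean_le_ge0 (h1 h2 : T -> R) (c : R) : measurable_fun [set: T] h1 ->
  (forall x, 0 <= h1 x <= h2 x) -> mean_le h2 c -> mean_le h1 c.
Proof.
move=> m1 h12 [i2 le2].
have i1 : integrableR mu h1.
  by apply: (integrableR_le i2) => // x; have /andP[h0 h1le] := h12 x; rewrite ger0_norm.
split => //; apply: le_trans le2; apply: le_Rintegral => // x _.
by have /andP[] := h12 x.
Qed.

End mean_bounds.

Section mirror_step_arithmetic.
Context {R : realType}.

Lemma mirror_step_expand (s t a b c dz dy dy' q : R) :
  dy' <= dy + - (s * t) * a + (s * t) ^+ 2 * q / 2 ->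
  dz + dy' - (c + - (s * t) * b) <=
    dz + dy - c - s * (t * (a - b)) + s ^+ 2 * t ^+ 2 * q / 2.
Proof. by rewrite exprMn; lra. Qed.

(* The factors [1] are the weight [phi = 1] of [mean_noise_sqr] and
   [direction_quadratic_form]. *)
Lemma mirror_step_bound (s c1 c2 a b z t q V V' : R) :
  0 <= s -> 0 < c1 -> 0 < c2 -> 0 <= q ->
  V' <= V - s * ((a + z + t) * b) + s ^+ 2 * (a + z + t) ^+ 2 * q / 2 ->
  V' <= V + (s * (- (a * b)) + (s / (2 * c1) * (z ^+ 2 * 1) +
    (s / (2 * c2) * (t ^+ 2 * 1) + (s * (c1 + c2) / 2 * (b * b * 1) +
    (2 * s ^+ 2 * (a * a * q) + (s ^+ 2 * (z ^+ 2 * q) +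
     2 * s ^+ 2 * (t ^+ 2 * q))))))).
Proof.
move=> s0 c10 c20 q0 /le_trans; apply.
have hc c y : 0 < c -> - (y * b) <= (2 * c)^-1 * y ^+ 2 + c / 2 * b ^+ 2.
  move=> c0; rewrite -subr_ge0.
  rewrite (_ : _ - _ = (2 * c)^-1 * (y + c * b) ^+ 2); last by field; rewrite gt_eqF.
  by rewrite mulr_ge0 ?sqr_ge0// invr_ge0 mulr_ge0// ltW.
(* Cauchy-Schwarz with the weights 1/4 + 1/2 + 1/4 = 1 for gradient, [zeta] and [eta]. *)
have hq : (a + z + t) ^+ 2 <= 4 * a ^+ 2 + 2 * z ^+ 2 + 4 * t ^+ 2.
  rewrite -subr_ge0.
  rewrite (_ : _ - _ = 2^-1 * (2 * a - z) ^+ 2 + (a - t) ^+ 2 + 2^-1 * (z - 2 * t) ^+ 2).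
    by have := sqr_ge0 (2 * a - z); have := sqr_ge0 (a - t); have := sqr_ge0 (z - 2 * t); lra.
  by field.
have h1 := ler_wpM2l s0 (hc c1 z c10).
have h2 := ler_wpM2l s0 (hc c2 t c20).
have h3 := ler_wpM2l (mulr_ge0 (sqr_ge0 s) q0) hq.
have -> : s / (2 * c1) * (z ^+ 2 * 1) = s * ((2 * c1)^-1 * z ^+ 2) by ring.
have -> : s / (2 * c2) * (t ^+ 2 * 1) = s * ((2 * c2)^-1 * t ^+ 2) by ring.
move: ((2 * c1)^-1 * z ^+ 2) ((2 * c2)^-1 * t ^+ 2) h1 h2 => p1 p2 h1 h2.
lra.
Qed.

(* [3 / 8 / (N * a)] and [1 / 8 / (N * a)] are the weights of Young's inequality
   for the two noise terms; their sum produces the growth rate [1 / (2 * N)]. *)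
Lemma mirror_step_mean (n N m r L2 a V Vv G dlt Q sg Dz De E : R) :
  0 < n -> 0 < N -> 0 < m -> 0 < r -> 0 < L2 -> a = (48 * n * r * L2)^-1 ->
  dlt <= G -> Vv <= 2 * V -> Q <= 4 * L2 * dlt + sg / m ->
  E <= V + (a * n * (- (G / n)) +
    (a * n / (2 * (3 / 8 / (N * a))) * (Dz * 1) +
    (a * n / (2 * (1 / 8 / (N * a))) * (De * 1) +
    (a * n * (3 / 8 / (N * a) + 1 / 8 / (N * a)) / 2 * (1 / n * Vv) +
    (2 * (a * n) ^+ 2 * (r / n * Q) + ((a * n) ^+ 2 * (Dz * r) +
     2 * (a * n) ^+ 2 * (De * r))))))) ->
  E <= (1 + (2 * N)^-1) * V - 5 / 6 * a * dlt +
    a * (sg / (24 * m * L2) + n * Dz / (48 * L2) + n * De / (24 * L2) +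
         N * Dz / (36 * r * L2) + N * De / (12 * r * L2)).
Proof.
move=> n0 N0 m0 r0 L20 aE hG hV hQ /le_trans; apply.
have a0 : 0 < a by rewrite aE invr_gt0 !mulr_gt0.
have nz := lt0r_neq0.
have hG' := ler_wpM2l (ltW a0) hG.
have hV' : (4 * N)^-1 * Vv <= (4 * N)^-1 * (2 * V).
  by rewrite ler_wpM2l// invr_ge0 mulr_ge0// ltW.
have hQ' : a / (24 * L2) * Q <= a / (24 * L2) * (4 * L2 * dlt + sg / m).
  by rewrite ler_wpM2l// divr_ge0 ?mulr_ge0// ltW.
have -> : a * n * (- (G / n)) = - (a * G) by field; rewrite nz.
have -> : a * n * (3 / 8 / (N * a) + 1 / 8 / (N * a)) / 2 * (1 / n * Vv) =
    (4 * N)^-1 * Vv by field; rewrite !nz.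
(* The step size is made for this term: with the part 4 L2 dlt of [Q] it costs a dlt / 6, which
   leaves 5/6 of the decrease. *)
have -> : 2 * (a * n) ^+ 2 * (r / n * Q) = a / (24 * L2) * Q.
  by rewrite aE; field; rewrite !nz.
have -> : a * n / (2 * (3 / 8 / (N * a))) * (Dz * 1) = a * (N * Dz / (36 * r * L2)).
  by rewrite aE; field; rewrite !nz.
have -> : a * n / (2 * (1 / 8 / (N * a))) * (De * 1) = a * (N * De / (12 * r * L2)).
  by rewrite aE; field; rewrite !nz.
have -> : (a * n) ^+ 2 * (Dz * r) = a * (n * Dz / (48 * L2)).
  by rewrite aE; field; rewrite !nz.
have -> : 2 * (a * n) ^+ 2 * (De * r) = a * (n * De / (24 * L2)).
  by rewrite aE; field; rewrite !nz.
have e1 : a / (24 * L2) * (4 * L2 * dlt + sg / m) = a * dlt / 6 + a * (sg / (24 * m * L2)).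
  by field; rewrite !nz.
have e2 : (4 * N)^-1 * (2 * V) = (2 * N)^-1 * V by field; rewrite nz.
rewrite e1 in hQ'; rewrite e2 in hV'; rewrite !(mulrDr a) [(1 + _) * V]mulrDl mul1r.
move: ((2 * N)^-1 * V) ((4 * N)^-1 * Vv) (a / (24 * L2) * Q) hV' hQ' => v1 v2 v3 hV' hQ'.
move: (a * (sg / (24 * m * L2))) (a * (N * Dz / (36 * r * L2))) (a * (N * De / (12 * r * L2)))
  (a * (n * Dz / (48 * L2))) (a * (n * De / (24 * L2))) hQ' => v4 v5 v6 v7 v8 hQ'.
move: (a * G) hG' => v9 hG'.
have -> : 5 / 6 * a * dlt = a * dlt * 5 / 6 by ring.
by move: (a * dlt) hG' hQ' => v10 hG' hQ'; lra.
Qed.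

(* The potential stays below [2 * B], as [(1 + 1 / (2 * N)) ^ N <= 2]. *)
Lemma potential_sum (N : nat) (V dlt : nat -> R) (a D : R) : (0 < N)%N ->
  (forall j, 0 <= V j) -> (forall j, 0 <= dlt j) -> 0 < a -> 0 <= D ->
  (forall j, V j.+1 <= (1 + (2 * N%:R)^-1) * V j - 5 / 6 * a * dlt j + a * D) ->
  N%:R^-1 * \sum_(j < N) dlt j <= 12 / 5 * (V 0 / (a * N%:R) + D).
Proof.
move=> N0 V0 dlt0 a0 D0 step; pose B := V 0 + N%:R * (a * D).
have NR : 0 < N%:R :> R by rewrite ltr0n.
(* The last term is the budget for growth: [(2 * N)^-1 * V j] is at most B / N as long as V_j <= 2
   B. *)
have inv j : (j <= N)%N -> V j + 5 / 6 * a * \sum_(i < j) dlt i <=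
    V 0 + j%:R * (a * D) + j%:R * (B / N%:R).
  elim: j => [_|j IH jN]; first by rewrite big_ord0 mulr0 !mul0r !addr0.
  have {}IH := IH (ltnW jN); have aD : 0 <= a * D by rewrite mulr_ge0// ltW.
  have S0 : 0 <= 5 / 6 * a * \sum_(i < j) dlt i.
    by rewrite !mulr_ge0 ?(ltW a0)// sumr_ge0.
  have B0 : 0 <= B by rewrite addr_ge0// mulr_ge0// ltW.
  have jNR : j%:R <= N%:R :> R by rewrite ler_nat ltnW.
  have V2 : V j <= 2 * B.
    have l1 : j%:R * (a * D) <= N%:R * (a * D) by rewrite ler_wpM2r.
    have l2 : j%:R * (B / N%:R) <= B.
      by rewrite mulrCA -[leRHS]mulr1 ler_wpM2l// ler_pdivrMr// mul1r.
    have BE : B = V 0 + N%:R * (a * D) by []; clearbody B; lra.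
  have l3 : (2 * N%:R)^-1 * V j <= B / N%:R.
    rewrite mulrC ler_pdivrMr ?mulr_gt0//.
    by rewrite (_ : B / N%:R * _ = 2 * B)//; field; rewrite gt_eqF.
  have := step j; rewrite big_ord_recr/= mulrDr -(natr1 j) !(mulrDl j%:R 1) (mulrDl 1 _ (V j)) !mul1r.
  by lra.
have := inv N (leqnn N); have VN := V0 N.
rewrite (_ : N%:R * (B / N%:R) = B); last by field; rewrite gt_eqF.
rewrite -/B => hB.
rewrite ler_pdivrMl//.
(* After N steps the right side of [inv] is 2 B, and division by 5/6 makes it 12/5 B. *)
have h2 : a * \sum_(j < N) dlt j <= a * (N%:R * (12 / 5 * (V 0 / (a * N%:R) + D))).
  rewrite (_ : a * (N%:R * _) = 12 / 5 * B); last by rewrite /B; field; rewrite !gt_eqF.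
  by move: (\sum_(j < N) dlt j) hB => s; lra.
by rewrite ler_pM2l in h2.
Qed.

End mirror_step_arithmetic.

Section noise_moments.
Context {R : realType} {n : nat} {d : measure_display} {X : measurableType d}.
Variables (P : probability X R) (zeta eta : 'rV[R]_n -> X -> 'rV[R]_n -> R).
Variables Dzeta Deta : R.
Hypothesis on : oracle_noise P zeta eta Dzeta Deta.

Lemma zeta_sqr_le y u : dotp u u = 1 ->
  (\int[P]_z (zeta y z u ^+ 2)%:E <= Dzeta%:E)%E.
Proof. by move=> /unit_sphereE /(on_zeta on y); rewrite unlock. Qed.

Lemma eta_sqr_le y u : dotp u u = 1 ->
  (\int[P]_z (eta y z u ^+ 2)%:E <= (Deta ^+ 2)%:E)%E.
Proof.
move=> /unit_sphereE u1; have mp : measurable_fun [set: X]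
    (fun z => (y, z, u) : borelRn R n * X * borelRn R n).
  by apply: measurable_fun_pair => //; exact: measurable_fun_pair.
have meta : measurable_fun [set: X] (fun z => eta y z u).
  exact: (measurableT_comp (on_measurable_eta on) mp).
have -> : (Deta ^+ 2)%:E = (\int[P]_z (Deta ^+ 2)%:E)%E.
  by rewrite -(RintegralE (integrableR_cst P _)) Rintegral_prob_cst.
apply: ae_ge0_le_integral => //.
- by move=> z _; rewrite lee_fin sqr_ge0.
- by apply/measurable_EFinP; exact: measurable_funX.
- by move=> z _; rewrite lee_fin sqr_ge0.
- apply: filterS (on_eta on y u1) => z hz _; rewrite lee_fin -real_normK ?num_real//.
  by rewrite ler_sqr// nnegrE (le_trans _ hz).
Qed.

Hypothesis n0 : (0 < n)%N.

Lemma exists_unit_vector : exists u : 'rV[R]_n, dotp u u = 1.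
Proof. by exists (delta_mx 0 (Ordinal n0)); exact: dotp_delta_delta. Qed.

Lemma Dzeta_ge0 : 0 <= Dzeta.
Proof.
have [u u1] := exists_unit_vector; have := zeta_sqr_le 0 u1.
by apply: contraTT; rewrite -!ltNge => D0; apply: lt_le_trans (integral_ge0 _ _);
  rewrite ?lte_fin// => z _; rewrite lee_fin sqr_ge0.
Qed.

(** An almost sure bound holds at some point, because the whole space is not negligible. *)
Lemma Deta_ge0 : 0 <= Deta.
Proof.
have [u /unit_sphereE u1] := exists_unit_vector; have ae := on_eta on 0 u1.
have [[z hz]|] := pselect (exists z, `|eta 0 z u| <= Deta).
  exact: le_trans hz.
move=> /forallNP h; have := probability_setT P.
have : P.-negligible setT by apply: negligibleS ae => z _ /=; exact: h.
by move=> /(negligibleP P measurableT) -> [/eqP]; rewrite eq_sym oner_eq0.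
Qed.

End noise_moments.

Section run.
Context {R : realType} {n : nat} {d : measure_display} {X : measurableType d}.
Context {d' : measure_display} {W : measurableType d'}.
Variables (P : probability X R) (Pr : probability W R).
Variables (e : nat -> nat -> W -> 'rV[R]_n) (xi : nat -> nat -> nat -> W -> X).
Hypothesis sa : sampling P Pr e xi.
Variables (F : 'rV[R]_n -> X -> R) (g : 'rV[R]_n -> X -> 'rV[R]_n) (L : X -> R).
Variables (L2 sigma : R).
Hypothesis L20 : 0 < L2.
Hypothesis sp : stochastic_problem P F g L L2 sigma.
Notation f := (objective P F).
Variables (zeta eta : 'rV[R]_n -> X -> 'rV[R]_n -> R) (Dzeta Deta : R).
Hypothesis on : oracle_noise P zeta eta Dzeta Deta.
Variable xstar : 'rV[R]_n.
Hypothesis fmin : forall x, f xstar <= f x.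
Variables (p : R) (dd dstar N : 'rV[R]_n -> R) (M : 'rV[R]_n -> 'rV[R]_n).
Hypothesis ms : mirror_setup dd dstar N M (rho n p).
Hypothesis n0 : (0 < n)%N.
Hypothesis rho0 : 0 < rho n p.
Notation index := (nat * nat + nat * nat * nat)%type.
Notation "'WS' S" := (g_sigma_algebraType (history e xi S)) (at level 10).
Notation oracle := (noisy_oracle g zeta eta).

(** The bound of the squared gradient by the gap, which is 0 at [xstar]. *)
Lemma grad_xstar : grad f xstar = 0.
Proof.
apply: dotpp_eq0; apply/eqP.
rewrite eq_le dotpp_ge0 andbT.
by have := grad_objective_sqr_le L20 sp xstar fmin; rewrite subrr mulr0.
Qed.

Lemma gap_le_dotp x : f x - f xstar <= dotp (grad f x) (x - xstar).
Proof.
have /andP[h _] := objective_bounds L20 sp x (xstar - x).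
by move: h; rewrite subrKC -(opprB x) dotpNr; lra.
Qed.

Lemma gap_le_sqr x : f x - f xstar <= L2 * dotp (x - xstar) (x - xstar).
Proof.
have /andP[_ h] := objective_bounds L20 sp xstar (x - xstar).
by move: h; rewrite grad_xstar dotp0l subr0 subrKC.
Qed.

(** * One mirror step, from the past [S] to the past [S'] *)

Section adapted_step.
Variables (S S' : set index) (k j : nat).
Hypothesis Se : ~ S (inl (k, j)).
Hypothesis Sxi : forall i, ~ S (inr (k, j, i)).
Hypothesis SS' : S `<=` S'.
Hypothesis S'e : S' (inl (k, j)).
Hypothesis S'xi : forall i, S' (inr (k, j, i)).
Variables u y : W -> 'rV[R]_n.
Hypothesis mu : measurable_fun [set: WS S] (u : WS S -> borelRn R n).
Hypothesis my : measurable_fun [set: WS S] (y : WS S -> borelRn R n).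
Variable m : nat.
Hypothesis m0 : (0 < m)%N.

Notation x w := (u w + M (y w)).

Definition potential (y : W -> 'rV[R]_n) w :=
  dd (xstar - u w) + dstar (y w) - dotp (xstar - u w) (y w).

Definition next_dual w := y w - (@stepsize R n p L2 * n%:R) *:
  batch_gradient oracle m (x w) (fun i => xi k j i w) (e k j w).

Hypothesis iV : integrableR Pr (potential y).

Let mx : measurable_fun [set: WS S] ((fun w => x w) : WS S -> borelRn R n).
Proof.
by apply: measurable_rowD mu _; exact: (measurableT_comp (ms_measurable_M ms) my).
Qed.

Let mv : measurable_fun [set: WS S] ((fun w => x w - xstar) : WS S -> borelRn R n).
Proof. exact: measurable_rowB. Qed.

Lemma adapted_batch_gradient : measurable_fun [set: WS S']
  (fun w => batch_gradient oracle m (x w) (fun i => xi k j i w) (e k j w) : borelRn R n).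
Proof.
apply: measurable_rowZ => //; apply: measurable_row_sum => i.
have me' := adapted_e (e := e) (xi := xi) S'e.
apply: measurable_rowZ => //.
have mx' := adapted_sub SS' mx; have mxi := adapted_xi (e := e) (xi := xi) (@S'xi i).
have mp : measurable_fun [set: WS S'] (fun w => (x w, xi k j i w) : borelRn R n * X).
  exact: measurable_fun_pair.
have mp3 : measurable_fun [set: WS S']
    (fun w => (x w, xi k j i w, e k j w) : borelRn R n * X * borelRn R n).
  exact: measurable_fun_pair.
apply: measurable_funD; last exact: (measurableT_comp (on_measurable_eta on) mp3).
apply: measurable_funD; last exact: (measurableT_comp (on_measurable_zeta on) mp3).
by apply: measurable_dotp => //; exact: (measurableT_comp (sp_measurable_g sp) mp).
Qed.

Lemma adapted_next_dual :
  measurable_fun [set: WS S'] (next_dual : WS S' -> borelRn R n).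
Proof.
apply: measurable_rowB; first exact: (adapted_sub SS' my).
by apply: measurable_rowZ => //; exact: adapted_batch_gradient.
Qed.

Lemma measurable_potential (z : W -> 'rV[R]_n) (S1 : set index) : S `<=` S1 ->
  measurable_fun [set: WS S1] (z : WS S1 -> borelRn R n) ->
  measurable_fun [set: W] (potential z).
Proof.
move=> SS1 mz; have mz' := adapted_measurable sa mz.
have mu' := adapted_measurable sa mu.
have mxu : measurable_fun [set: W] (fun w => xstar - u w : borelRn R n).
  exact: measurable_rowB.
apply: measurable_funB; last exact: measurable_dotp.
apply: measurable_funD; first exact: (measurableT_comp (ms_measurable_d ms) mxu).
exact: (measurableT_comp (ms_measurable_dstar ms) mz').
Qed.

Lemma potential_ge0 z w : 0 <= potential z w.
Proof. by rewrite subr_ge0; exact: (ms_fenchel ms). Qed.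

Lemma sqr_distance_le_potential w :
  dotp (x w - xstar) (x w - xstar) <= 2 * potential y w.
Proof.
have := mirror_distance ms (xstar - u w) (y w).
rewrite -/(potential y w) (_ : xstar - u w - M (y w) = - (x w - xstar)); last first.
  by rewrite opprB opprD addrA.
by rewrite dotpNl dotpNr opprK; lra.
Qed.

(** The integrability of all terms of a step starts here: the squared distance controls the gap by
    [gap_le_sqr], and the gap controls the squared gradient. *)
Lemma integrable_sqr_distance :
  mean_le Pr (fun w => dotp (x w - xstar) (x w - xstar))
    (2 * \int[Pr]_w potential y w).
Proof.
apply: (mean_le_ge0 _ _ (mean_leZ (ler0n _ 2) (mean_le_self iV))).
  exact: (adapted_measurable sa (measurable_dotp mv mv)).
by move=> w; rewrite dotpp_ge0 sqr_distance_le_potential.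
Qed.

Lemma integrable_gap : integrableR Pr (fun w => f (x w) - f xstar).
Proof.
have [iv _] := integrable_sqr_distance.
apply: (integrableR_le (integrableRZ L2 iv)).
  apply: measurable_funB => //; apply: (adapted_measurable sa (S := S)).
  exact: (measurableT_comp (measurable_objective L20 sp) mx).
by move=> w; rewrite ger0_norm ?subr_ge0// gap_le_sqr.
Qed.

Lemma mean_grad_sqr :
  mean_le Pr (fun w => dotp (grad f (x w)) (grad f (x w)))
    (4 * L2 * \int[Pr]_w (f (x w) - f xstar)).
Proof.
have c0 : 0 <= 4 * L2 by rewrite mulr_ge0// ltW.
apply: (mean_le_ge0 _ _ (mean_leZ c0 (mean_le_self integrable_gap))).
- have := adapted_grad L20 sp mx => mg.
  exact: (adapted_measurable sa (measurable_dotp mg mg)).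
- by move=> w; rewrite dotpp_ge0 (grad_objective_sqr_le L20 sp _ fmin).
Qed.

Notation mean_grad w := (batch_mean P xi F g k j (fun w => x w) m w).
Notation mean_zeta w := (m%:R^-1 * \sum_(i < m) zeta (x w) (xi k j i w) (e k j w)).
Notation mean_eta w := (m%:R^-1 * \sum_(i < m) eta (x w) (xi k j i w) (e k j w)).

Lemma batch_gradientE w :
  batch_gradient oracle m (x w) (fun i => xi k j i w) (e k j w) =
  (dotp (mean_grad w) (e k j w) + mean_zeta w + mean_eta w) *: e k j w.
Proof.
rewrite batch_meanE// /batch_gradient -scaler_suml scalerA; congr (_ *: _).
by rewrite dotpZl dotp_suml -!mulrDr -!big_split.
Qed.

Let one_invariant : signed_perm_invariant (fun _ : 'rV[R]_n => 1 : R).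
Proof. by split. Qed.

Let N_le1 v : dotp v v = 1 -> N v <= 1.
Proof. by move=> <-; exact: (ms_N_le ms). Qed.

Let mean_one : \int[direction_law sa k j]_v (1 : R) = 1.
Proof. exact: Rintegral_prob_cst. Qed.

Let mean_N_le : \int[direction_law sa k j]_v N v <= rho n p.
Proof. exact: (ms_N_mean ms (uniform_direction_law sa k j)). Qed.

Let mean_N_ge0 : 0 <= \int[direction_law sa k j]_v N v.
Proof. by apply: Rintegral_ge0 => v _; exact: (ms_N_ge0 ms). Qed.

Let mgrad : mean_le Pr (fun w => dotp (mean_grad w) (mean_grad w))
  (4 * L2 * \int[Pr]_w (f (x w) - f xstar) + sigma ^+ 2 / m%:R).
Proof.
have [ig gle] := mean_grad_sqr.
have [i1 h1] := batch_mean_sqr sa L20 sp Sxi mx ig m0.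
by split => //; apply: le_trans h1 _; rewrite lerD2r.
Qed.

Let sub_samples : S `<=` with_samples S k j setT.
Proof. exact: with_samples_sub. Qed.

Let mvs := adapted_sub sub_samples mv.
Let mgs : measurable_fun [set: WS (with_samples S k j setT)]
  (fun w => mean_grad w : borelRn R n).
Proof. exact: (adapted_batch_mean L20 sp mx m). Qed.

Let noise_mean (noise : 'rV[R]_n -> X -> 'rV[R]_n -> R) D phi c :
  measurable_fun [set: borelRn R n * X * borelRn R n]
    (fun z => noise z.1.1 z.1.2 z.2) ->
  (forall y u, dotp u u = 1 -> (\int[P]_z (noise y z u ^+ 2)%:E <= D%:E)%E) ->
  measurable_fun [set: borelRn R n] (phi : borelRn R n -> R) ->
  (forall u, 0 <= phi u) -> (forall u, dotp u u = 1 -> phi u <= 1) -> 0 <= D ->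
  \int[direction_law sa k j]_u phi u <= c ->
  mean_le Pr (fun w => (m%:R^-1 * \sum_(i < m) noise (x w) (xi k j i w) (e k j w)) ^+ 2 *
    phi (e k j w)) (D * c).
Proof.
move=> mnoise hnoise mphi phi0 phi1 D0 hc.
have [_ i1 h1] := mean_noise_sqr sa Sxi mx mnoise hnoise mphi phi0 phi1 m0.
by split=> //; apply: le_trans h1 _; rewrite ler_wpM2l.
Qed.

(** The direction is averaged while all samples are fixed, which turns products with it into inner
    products; averaging the samples then replaces [mean_grad] by the gradient in the linear term.
    [K] will be the length of the run and sets the weights of Young's inequality. *)
Lemma dual_step (K : R) : 0 < K ->
  mean_le Pr (potential next_dual)
    ((1 + (2 * K)^-1) * \int[Pr]_w potential y w -
     5 / 6 * @stepsize R n p L2 * \int[Pr]_w (f (x w) - f xstar) +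
     @stepsize R n p L2 * (sigma ^+ 2 / (24 * m%:R * L2) +
       n%:R * Dzeta / (48 * L2) + n%:R * Deta ^+ 2 / (24 * L2) +
       K * Dzeta / (36 * rho n p * L2) + K * Deta ^+ 2 / (12 * rho n p * L2))).
Proof.
move=> K0.
have nR : 0 < n%:R :> R by rewrite ltr0n.
have mR : 0 < m%:R :> R by rewrite ltr0n.
have [al alE] : exists al, al = @stepsize R n p L2 by exists (@stepsize R n p L2).
rewrite -alE.
have stepE : al = (48 * n%:R * rho n p * L2)^-1 by rewrite alE.
have step0 : 0 < al.
  by rewrite stepE; move: (rho n p) rho0 => r r0; rewrite invr_gt0 !mulr_gt0.
have s0 : 0 <= al * n%:R by rewrite mulr_ge0// ltW.
pose c a := a / 8 / (K * al).
have c0 a : 0 < a -> 0 < c a by move=> a0; rewrite !divr_gt0 ?mulr_gt0.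
have c10 : 0 < c 3 by exact: c0.
have c20 : 0 < c 1 by exact: c0.
have Dz0 := Dzeta_ge0 on n0; have De0 := sqr_ge0 Deta.
have [iv vle] := integrable_sqr_distance; have [ig gle] := mgrad.
have mone : measurable_fun [set: borelRn R n] (fun _ : borelRn R n => 1 : R) by [].
have one_ge0 (v : 'rV[R]_n) : 0 <= 1 :> R by [].
have one_le1 (v : 'rV[R]_n) : dotp v v = 1 -> 1 <= 1 :> R by [].
have norm_one (v : 'rV[R]_n) : dotp v v = 1 -> `|1| <= 1 :> R by rewrite normr1.
have mN := ms_measurable_N ms; have N0 := ms_N_ge0 ms.
have norm_N (v : 'rV[R]_n) : dotp v v = 1 -> `|N v| <= 1.
  by rewrite ger0_norm//; exact: N_le1.
have nSe : ~ with_samples S k j setT (inl (k, j)).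
  exact: (direction_notin_with_samples Se).
(* The three forms belong to the linear term, to the remainder of Young's inequality and to the
   quadratic term; only the last carries the weight [N]. *)
have [iab ab] := direction_quadratic_form sa nSe mgs mvs ig iv mone norm_one one_invariant.
have [ibb bb] := direction_quadratic_form sa nSe mvs mvs iv iv mone norm_one one_invariant.
have [iaa aa] := direction_quadratic_form sa nSe mgs mgs ig ig mN norm_N (ms_N_inv ms).
have gap_le : \int[Pr]_w (f (x w) - f xstar) <=
    \int[Pr]_w dotp (grad f (x w)) (x w - xstar).
  apply: le_Rintegral => //; first exact: integrable_gap.
    have [igf _] := mean_grad_sqr; apply: integrableR_dotp => //.
      exact: (adapted_measurable sa (adapted_grad L20 sp mx)).
    exact: (adapted_measurable sa mv).
  by move=> w _; exact: gap_le_dotp.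
have h1 : mean_le Pr
    (fun w => - (dotp (mean_grad w) (e k j w) * dotp (x w - xstar) (e k j w)))
    (- ((\int[Pr]_w dotp (grad f (x w)) (x w - xstar)) / n%:R)).
  split.
    have := integrableRZ (-1) iab.
    by under eq_fun do rewrite mulr1 mulN1r.
  under eq_Rintegral do rewrite -mulN1r -[_ * dotp _ _]mulr1.
  rewrite RintegralZl// ab mean_one mulN1r lerN2 div1r mulrC.
  have [igf _] := mean_grad_sqr.
  by rewrite (batch_mean_dotp sa L20 sp Sxi mx igf _ mv iv).
have h4 : mean_le Pr
    (fun w => dotp (x w - xstar) (e k j w) * dotp (x w - xstar) (e k j w) * 1)
    (1 / n%:R * \int[Pr]_w dotp (x w - xstar) (x w - xstar)).
  by split=> //; rewrite bb mean_one.
have h5 : mean_le Pr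
    (fun w => dotp (mean_grad w) (e k j w) * dotp (mean_grad w) (e k j w) * N (e k j w))
    (rho n p / n%:R *
      (4 * L2 * \int[Pr]_w (f (x w) - f xstar) + sigma ^+ 2 / m%:R)).
  split=> //; rewrite aa; apply: ler_pM => //.
  - by rewrite divr_ge0.
  - by apply: Rintegral_ge0 => w _; exact: dotpp_ge0.
  - by rewrite ler_wpM2r// invr_ge0.
have mz := on_measurable_zeta on; have me := on_measurable_eta on.
have hz := zeta_sqr_le on; have he := eta_sqr_le on.
have le11 : \int[direction_law sa k j]_u (1 : R) <= 1 by rewrite mean_one.
have z1 := noise_mean mz hz mone one_ge0 one_le1 Dz0 le11.
have t1 := noise_mean me he mone one_ge0 one_le1 De0 le11.
have z2 := noise_mean mz hz mN N0 N_le1 Dz0 mean_N_le.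
have t2 := noise_mean me he mN N0 N_le1 De0 mean_N_le.
have k1 : 0 <= al * n%:R / (2 * c 3) by rewrite divr_ge0// mulr_ge0// ltW.
have k2 : 0 <= al * n%:R / (2 * c 1) by rewrite divr_ge0// mulr_ge0// ltW.
have k3 : 0 <= al * n%:R * (c 3 + c 1) / 2.
  by rewrite divr_ge0// mulr_ge0// addr_ge0// ltW.
have k4 : 0 <= (al * n%:R) ^+ 2 by exact: sqr_ge0.
have k5 : 0 <= 2 * (al * n%:R) ^+ 2 by exact: mulr_ge0.
have total := mean_leD (mean_le_self iV) (mean_leD (mean_leZ s0 h1)
  (mean_leD (mean_leZ k1 z1) (mean_leD (mean_leZ k2 t1) (mean_leD (mean_leZ k3 h4)
  (mean_leD (mean_leZ k5 h5) (mean_leD (mean_leZ k4 z2) (mean_leZ k5 t2))))))).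
have mnext := measurable_potential SS' adapted_next_dual.
have [|i1 le1] := mean_le_ge0 mnext _ total.
  move=> w; rewrite potential_ge0/=.
  apply: mirror_step_bound => //.
  (* The gradient estimate is the scalar [T] times the direction, so [ms_NZ] extracts the square of
     [T] from [N]. *)
  set T := dotp _ _ + _ + _.
  have nextE : next_dual w = y w + - (al * n%:R * T) *: e k j w.
    by rewrite /next_dual -alE batch_gradientE scalerA scaleNr.
  rewrite /potential nextE dotpDr dotpZr.
  have := ms_smooth ms (y w) (- (al * n%:R * T) *: e k j w).
  rewrite (ms_NZ ms) sqrrN dotpZr.
  have -> : dotp (x w - xstar) (e k j w) =
      dotp (M (y w)) (e k j w) - dotp (xstar - u w) (e k j w).
    by rewrite -dotpBl; congr (dotp _ _); rewrite opprB addrCA addrA.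
  exact: mirror_step_expand.
split=> //.
apply: (mirror_step_mean nR K0 mR rho0 L20 stepE gap_le vle (lexx _)).
exact: le1.
Qed.

End adapted_step.

(** The lexicographic order on pairs of run and step; a sample has the time of its step, whatever
    its index in the batch. *)
Definition draws_before (k j : nat) : set index :=
  [set a | let kj := match a with inl b => b | inr b => b.1 end in
           (kj.1 < k)%N || (kj.1 == k) && (kj.2 < j)%N].

Lemma before_step k j : draws_before k j `<=` draws_before k j.+1.
Proof.
by case=> b; rewrite /draws_before/= => /orP[->//|/andP[-> bj]]; rewrite ltnS (ltnW bj) orbT.
Qed.

Lemma before_run k j : draws_before k j `<=` draws_before k.+1 0.
Proof.
by case=> b; rewrite /draws_before/= => /orP[bk|/andP[/eqP -> _]]; rewrite ltnS ?leqnn// ltnW.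
Qed.

Lemma notin_before k j a : draws_before k j a ->
  match a with inl b => b | inr b => b.1 end <> (k, j).
Proof. by case: a => b; rewrite /draws_before/= => + E; rewrite E/= !ltnn andbF. Qed.

(** Jensen by the gradient inequality at the average, from which the deviations sum to 0. *)
Lemma objective_average K (x : nat -> 'rV[R]_n) : (0 < K)%N ->
  f (K%:R^-1 *: \sum_(j < K) x j) <= K%:R^-1 * \sum_(j < K) f (x j).
Proof.
move=> K0; have KR : 0 < K%:R :> R by rewrite ltr0n.
set xb := K%:R^-1 *: _.
have h j : dotp (grad f xb) (x j - xb) <= f (x j) - f xb.
  have /andP[+ _] := objective_bounds L20 sp xb (x j - xb).
  by rewrite subrKC subr_ge0.
have sum0 : \sum_(j < K) (x j - xb) = 0.
  rewrite sumrB sumr_const card_ord -(scaler_nat K xb) /xb scalerA mulfV ?gt_eqF//.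
  by rewrite scale1r subrr.
have : dotp (grad f xb) (\sum_(j < K) (x j - xb)) <= \sum_(j < K) (f (x j) - f xb).
  by rewrite dotpC dotp_suml; apply: ler_sum => j _; rewrite dotpC.
rewrite sum0 dotp0r sumrB sumr_const card_ord -(mulr_natl (f xb)) subr_ge0 => hs.
by rewrite ler_pdivlMl.
Qed.

Section one_run.
Variables (k m K : nat) (u : W -> 'rV[R]_n).
Hypothesis m0 : (0 < m)%N.
Hypothesis K0 : (0 < K)%N.
Hypothesis mu : measurable_fun [set: WS (draws_before k 0)] (u : WS (draws_before k 0) -> borelRn R n).
Hypothesis id : integrableR Pr (fun w => dd (xstar - u w)).

Notation y j w := (dual_iterate M p L2 oracle m
  (fun j' => e k j' w) (fun j' i => xi k j' i w) (u w) j).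
Notation x j w := (u w + M (y j w)).

Let KR : 0 < K%:R :> R. Proof. by rewrite ltr0n. Qed.

Let mu_before j :
  measurable_fun [set: WS (draws_before k j)] (u : WS (draws_before k j) -> borelRn R n).
Proof.
by elim: j => // j; apply: adapted_sub; exact: before_step.
Qed.

Let next_draws j : draws_before k j.+1 (inl (k, j)) /\
  forall i, draws_before k j.+1 (inr (k, j, i)).
Proof. by split => [|i]; rewrite /draws_before/= eqxx ltnSn orbT. Qed.

Lemma adapted_dual_iterate j : measurable_fun [set: WS (draws_before k j)]
  ((fun w => y j w) : WS (draws_before k j) -> borelRn R n).
Proof.
elim: j => [|j IH]; first exact: measurable_cst.
have [ne nxi] := next_draws j.
exact: (adapted_next_dual (@before_step k j) ne nxi (@mu_before j) IH m).
Qed.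

Let V j := \int[Pr]_w potential u (fun w => y j w) w.

Let D := sigma ^+ 2 / (24 * m%:R * L2) +
  n%:R * Dzeta / (48 * L2) + n%:R * Deta ^+ 2 / (24 * L2) +
  K%:R * Dzeta / (36 * rho n p * L2) + K%:R * Deta ^+ 2 / (12 * rho n p * L2).

Let dual_iterate_step j :
  integrableR Pr (potential u (fun w => y j w)) ->
  mean_le Pr (potential u (fun w => y j.+1 w))
    ((1 + (2 * K%:R)^-1) * V j -
     5 / 6 * @stepsize R n p L2 * \int[Pr]_w (f (x j w) - f xstar) +
     @stepsize R n p L2 * D).
Proof.
move=> iV; have [ne nxi] := next_draws j.
have nbe : ~ draws_before k j (inl (k, j)) by move=> /notin_before.
have nbx i : ~ draws_before k j (inr (k, j, i)) by move=> /notin_before.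
exact: (dual_step nbe nbx (@before_step k j) ne nxi
  (@mu_before j) (@adapted_dual_iterate j) m0 iV KR).
Qed.

Let initial_potential :
  potential u (fun w => y 0 w) = (fun w => dd (xstar - u w)).
Proof. by apply/funext => w; rewrite /potential/= (ms_dstar0 ms) dotp0r addr0 subr0. Qed.

Lemma integrable_potential j :
  integrableR Pr (potential u (fun w => y j w)).
Proof.
elim: j => [|j /dual_iterate_step []//].
by rewrite initial_potential.
Qed.

Variable dprox : W -> 'rV[R]_n -> R.
Hypothesis dproxE : forall w x, dprox w x = dd (x - u w).

Notation xbar w := (rdd p L2 oracle (dprox w) K m
  (fun j => e k j w) (fun j i => xi k j i w) (u w)).

Lemma rdd_dual w : xbar w = K%:R^-1 *: \sum_(j < K) x j w.
Proof.
congr (_ *: _); apply: eq_bigr => j _.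
exact: (rdd_iterate_dual ms).
Qed.

Let adapted_x j : measurable_fun [set: WS (draws_before k j)]
  ((fun w => x j w) : WS (draws_before k j) -> borelRn R n).
Proof.
apply: measurable_rowD; first exact: mu_before.
exact: (measurableT_comp (ms_measurable_M ms) (@adapted_dual_iterate j)).
Qed.

Lemma adapted_rdd : measurable_fun [set: WS (draws_before k.+1 0)]
  ((fun w => xbar w) : WS (draws_before k.+1 0) -> borelRn R n).
Proof.
under eq_fun do rewrite rdd_dual.
apply: measurable_rowZ => //; apply: measurable_row_sum => j.
exact: (adapted_sub (@before_run k j) (@adapted_x j)).
Qed.

Lemma rdd_gap : mean_le Pr (fun w => f (xbar w) - f xstar)
  (12 / 5 * (\int[Pr]_w dd (xstar - u w) / (@stepsize R n p L2 * K%:R) +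
     (sigma ^+ 2 / (24 * m%:R * L2) +
       n%:R * Dzeta / (48 * L2) + n%:R * Deta ^+ 2 / (24 * L2) +
       K%:R * Dzeta / (36 * rho n p * L2) + K%:R * Deta ^+ 2 / (12 * rho n p * L2)))).
Proof.
have D0 : 0 <= D.
  have Dz0 := Dzeta_ge0 on n0; rewrite /D; move: (rho n p) rho0 => r r0.
  move: (sigma ^+ 2) (Deta ^+ 2) (sqr_ge0 sigma) (sqr_ge0 Deta) => s2 d2 s20 d20.
  by rewrite !addr_ge0 ?divr_ge0 ?mulr_ge0// ltW.
have al0 : 0 < @stepsize R n p L2.
  rewrite /stepsize; move: (rho n p) rho0 => r r0.
  by rewrite invr_gt0 !mulr_gt0// ltr0n.
have igap j : integrableR Pr (fun w => f (x j w) - f xstar).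
  exact: (integrable_gap (@mu_before j) (@adapted_dual_iterate j)
    (integrable_potential j)).
have avg : mean_le Pr (fun w => K%:R^-1 * \sum_(j < K) (f (x j w) - f xstar))
    (12 / 5 * (\int[Pr]_w dd (xstar - u w) / (@stepsize R n p L2 * K%:R) + D)).
  have isum := integrableR_sum (index_enum 'I_K) (fun j : 'I_K => igap j).
  split; first exact: integrableRZ.
  rewrite RintegralZl// Rintegral_sum; last by move=> j; exact: igap.
  have -> : \int[Pr]_w dd (xstar - u w) = V 0 by rewrite /V initial_potential.
  apply: (@potential_sum _ K V (fun j => \int[Pr]_w (f (x j w) - f xstar)) _ D K0) => //.
  - by move=> j; apply: Rintegral_ge0 => w _; exact: (potential_ge0).
  - by move=> j; apply: Rintegral_ge0 => w _; rewrite subr_ge0.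
  - by move=> j; have [] := dual_iterate_step (integrable_potential j).
have mxbar := adapted_measurable sa adapted_rdd.
apply: (mean_le_ge0 _ _ avg).
  by apply: measurable_funB => //; exact: (measurableT_comp (measurable_objective L20 sp) mxbar).
move=> w; rewrite subr_ge0 fmin/= sumrB sumr_const card_ord mulrBr -(mulr_natl (f xstar)).
rewrite mulKf ?gt_eqF// lerD2r rdd_dual.
exact: (objective_average (fun j => x j w) K0).
Qed.

End one_run.
End run.

(** * Restarts and complexity *)

Section restart_parameters.
Context {R : realType}.

Lemma natceil_ge (x : R) : 0 <= x -> x <= (natceil x)%:R.
Proof.
move=> x0; rewrite /natceil natr_absz ger0_norm ?ceil_ge//.
by rewrite ceil_ge0 (lt_le_trans _ x0)// ltrN10.
Qed.

Lemma natceil_le (x : R) : 0 <= x -> (natceil x)%:R <= x + 1.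
Proof.
move=> x0; rewrite /natceil natr_absz ger0_norm; last first.
  by rewrite ceil_ge0 (lt_le_trans _ x0)// ltrN10.
by have := ceilB1_lt x; rewrite rmorphB/= ltrBlDr => /ltW.
Qed.

(* [3072 = 8 * 384] leaves room: the two leading terms add up to
   [mu * R2 * h / 40], a tenth of what is allowed. *)
Lemma restart_arith (n r L2 Om mu R2 h K m sg Dz De Dl V Q : R) :
  0 < n -> 0 < r -> 0 < L2 -> 0 < Om -> 0 < mu -> 0 < R2 -> 0 < h -> 0 < K ->
  0 < m -> 0 <= Dz -> 0 <= De -> 0 <= Q ->
  3072 * (n * r * L2 * Om) <= K * mu -> 16 * sg <= m * (h * L2 * mu * R2) ->
  n / (12 * L2) * Dz + 4 * n / (3 * L2) * De + K / (3 * L2 * r) * (Dz / 4 + 4 * De) <= Dl ->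
  V <= Om / 2 * Q -> mu * Q <= mu * R2 * h + 4 * Dl ->
  12 / 5 * (V / ((48 * n * r * L2)^-1 * K) +
    (sg / (24 * m * L2) + n * Dz / (48 * L2) + n * De / (24 * L2) +
     K * Dz / (36 * r * L2) + K * De / (12 * r * L2))) <= mu * R2 * h / 4 + 2 * Dl.
Proof.
move=> n0 r0 L20 Om0 mu0 R20 h0 K0 m0 Dz0 De0 Q0 hK hm hD hV hQ.
have nz := lt0r_neq0.
(* The quotient is at most 24 n r L2 Om Q / K, and [hK] bounds this by mu Q / 128, as 3072 = 24 *
   128. *)
have hVK : V / ((48 * n * r * L2)^-1 * K) <= (mu * R2 * h + 4 * Dl) / 128.
  rewrite ler_pdivrMr ?mulr_gt0 ?invr_gt0 ?mulr_gt0//.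
  apply: le_trans hV _; rewrite -subr_ge0.
  have -> : (mu * R2 * h + 4 * Dl) / 128 * ((48 * n * r * L2)^-1 * K) - Om / 2 * Q =
     (n * r * L2 * mu)^-1 / 6144 * (K * mu * (mu * R2 * h + 4 * Dl) -
       3072 * (n * r * L2 * Om) * (mu * Q)).
    by field; rewrite !nz.
  have A0 : 0 <= n * r * L2 by rewrite !mulr_ge0// ltW.
  apply: mulr_ge0.
    by apply: divr_ge0 (ler0n _ _); rewrite invr_ge0 mulr_ge0 ?(ltW mu0).
  rewrite subr_ge0; apply: ler_pM hK hQ; last by rewrite mulr_ge0 ?(ltW mu0).
  by apply: (mulr_ge0 (ler0n _ _)); rewrite mulr_ge0 ?(ltW Om0).
have hs : sg / (24 * m * L2) <= mu * R2 * h / 384.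
  rewrite ler_pdivrMr ?mulr_gt0//.
  by rewrite (_ : mu * R2 * h / 384 * _ = m * (h * L2 * mu * R2) / 16); [lra|field].
have nL0 : 0 <= n / L2 by rewrite divr_ge0// ltW.
have KL0 : 0 <= K / (r * L2) by rewrite divr_ge0 ?mulr_ge0// ltW.
have e1 : n * Dz / (48 * L2) = n / L2 * Dz / 48 by field; rewrite !nz.
have e2 : n * De / (24 * L2) = n / L2 * De / 24 by field; rewrite !nz.
have e3 : K * Dz / (36 * r * L2) = K / (r * L2) * Dz / 36 by field; rewrite !nz.
have e4 : K * De / (12 * r * L2) = K / (r * L2) * De / 12 by field; rewrite !nz.
have e5 : n / (12 * L2) * Dz + 4 * n / (3 * L2) * De +
    K / (3 * L2 * r) * (Dz / 4 + 4 * De) =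
    n / L2 * Dz / 12 + n / L2 * De * 4 / 3 + K / (r * L2) * Dz / 12 +
    K / (r * L2) * De * 4 / 3 by field; rewrite !nz.
rewrite e5 in hD; rewrite e1 e2 e3 e4.
have p1 := mulr_ge0 nL0 Dz0; have p2 := mulr_ge0 nL0 De0.
have p3 := mulr_ge0 KL0 Dz0; have p4 := mulr_ge0 KL0 De0.
have p5 : 0 <= mu * R2 * h by rewrite !mulr_ge0// ltW.
move: (n / L2 * Dz) (n / L2 * De) (K / (r * L2) * Dz) (K / (r * L2) * De) (mu * R2 * h)
  (V / _) (sg / _) p1 p2 p3 p4 p5 hD hVK hs => a1 a2 a3 a4 b v s.
by clear; lra.
Qed.

End restart_parameters.

Section restarts.
Context {R : realType} {n : nat} {d : measure_display} {X : measurableType d}.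
Variables (P : probability X R) (F : 'rV[R]_n -> X -> R).
Variables (g : 'rV[R]_n -> X -> 'rV[R]_n) (L : X -> R) (L2 sigma mu Rp p : R).
Hypothesis L20 : 0 < L2.
Hypothesis sp : stochastic_problem P F g L L2 sigma.
Notation f := (objective P F).
Hypothesis mu0 : 0 < mu.
Hypothesis Rp0 : 0 < Rp.
Hypothesis p0 : 0 < p.
Hypothesis n0 : (0 < n)%N.
Hypothesis rho0 : 0 < rho n p.
Hypothesis Om0 : 0 < Omega n p.
Hypothesis sc : strongly_convex p mu f.
Variable xstar x0 : 'rV[R]_n.
Hypothesis fmin : forall x, f xstar <= f x.
Hypothesis x0R : pnorm p (x0 - xstar) ^+ 2 <= Rp ^+ 2.
Hypothesis prox_le : forall z : 'rV[R]_n, prox p z <= Omega n p / 2 * pnorm p z ^+ 2.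
Variables (dstar N : 'rV[R]_n -> R) (M : 'rV[R]_n -> 'rV[R]_n).
Hypothesis ms : mirror_setup (prox p) dstar N M (rho n p).

Let nR : 0 < n%:R :> R. Proof. by rewrite ltr0n. Qed.

Lemma N0_ratio_gt0 : 0 < 8 * (384 * n%:R * rho n p) * L2 * Omega n p / mu.
Proof.
move: (rho n p) (Omega n p) rho0 Om0 => r Om r0 O0.
apply: divr_gt0 mu0; apply: mulr_gt0 O0; apply: mulr_gt0 L20.
apply: (mulr_gt0 (ltr0Sn _ _)); apply: mulr_gt0 r0; exact: (mulr_gt0 (ltr0Sn _ _)).
Qed.

Lemma N0_ge : 3072 * (n%:R * rho n p * L2 * Omega n p) <= (N0 n p L2 mu)%:R * mu.
Proof.
have := natceil_ge (ltW N0_ratio_gt0); rewrite -/(N0 n p L2 mu) ler_pdivrMr//.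
by apply: le_trans; rewrite le_eqVlt; apply/orP; left; apply/eqP; ring.
Qed.

Lemma N0_gt0 : (0 < N0 n p L2 mu)%N.
Proof.
by rewrite -(ltr0n R); apply: lt_le_trans N0_ratio_gt0 (natceil_ge (ltW N0_ratio_gt0)).
Qed.

Lemma batch_size_gt0 k : (0 < batch_size L2 sigma mu Rp k)%N.
Proof. by rewrite leq_max. Qed.

Lemma batch_ratio_ge0 k : 0 <= 8 * 2 * sigma ^+ 2 * 2 ^+ k / (L2 * mu * Rp ^+ 2).
Proof.
move: (sigma ^+ 2) (sqr_ge0 sigma) => s s0.
by rewrite divr_ge0 ?mulr_ge0 ?exprn_ge0// ltW.
Qed.

Lemma batch_size_ge k : 16 * sigma ^+ 2 <=
  (batch_size L2 sigma mu Rp k)%:R * (2 ^- k * L2 * mu * Rp ^+ 2).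
Proof.
have k0 : 0 < 2 ^+ k :> R by exact: exprn_gt0.
have h : 8 * 2 * sigma ^+ 2 * 2 ^+ k / (L2 * mu * Rp ^+ 2) <=
    (batch_size L2 sigma mu Rp k)%:R.
  by apply: le_trans (natceil_ge (batch_ratio_ge0 k)) _; rewrite ler_nat leq_maxr.
move: h; rewrite ler_pdivrMr ?mulr_gt0 ?exprn_gt0// => h.
move: (batch_size _ _ _ _ _)%:R h => m h; move: (2 ^+ k) k0 h => t t0 h.
have -> : m * (t^-1 * L2 * mu * Rp ^+ 2) = m * (L2 * mu * Rp ^+ 2) / t.
  by field; rewrite gt_eqF.
by rewrite ler_pdivlMr//; apply: le_trans h; lra.
Qed.

Lemma gap_strongly_convex x : mu / 2 * pnorm p (x - xstar) ^+ 2 <= f x - f xstar.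
Proof.
have := sc xstar x; rewrite (grad_xstar L20 sp fmin) dotp0l addr0.
by move: (pnorm p _ ^+ 2) => a; lra.
Qed.

Section noise_level.
Variables Dzeta Deta : R.
Hypothesis Dz0 : 0 <= Dzeta.
Hypothesis De0 : 0 <= Deta.
Notation Delta := (noise_floor n p L2 mu Rp Dzeta Deta).

(** The cross product in the expanded square and the term with the square root of n R^2 Omega are
    bounded below by 0. [restart_arith] takes the noise in this form. *)
Lemma noise_floor_ge : n%:R / (12 * L2) * Dzeta + 4 * n%:R / (3 * L2) * Deta ^+ 2 +
  (N0 n p L2 mu)%:R / (3 * L2 * rho n p) * (Dzeta / 4 + 4 * Deta ^+ 2) <= Delta.
Proof.
rewrite /noise_floor; set s := Num.sqrt Dzeta / 2 + 2 * Deta.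
have s0 : 0 <= s by rewrite addr_ge0 ?divr_ge0 ?mulr_ge0 ?sqrtr_ge0.
have t0 : 0 <= 8 * Num.sqrt (2 * n%:R * Rp ^+ 2 * Omega n p) / (N0 n p L2 mu)%:R * s.
  by rewrite mulr_ge0// divr_ge0// mulr_ge0// sqrtr_ge0.
have ss : Dzeta / 4 + 4 * Deta ^+ 2 <= s ^+ 2.
  have := mulr_ge0 (sqrtr_ge0 Dzeta) De0; have := sqr_sqrtr Dz0.
  by rewrite /s; move: (Num.sqrt Dzeta) => t <-; lra.
have c0 : 0 <= (N0 n p L2 mu)%:R / (3 * L2 * rho n p).
  by move: (rho n p) rho0 => r r0; rewrite divr_ge0 ?mulr_ge0// ltW.
have := ler_wpM2l c0 ss.
move: (_ / (3 * L2 * _) * _) (_ / (3 * L2 * _) * _) => a b ab.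
by move: (8 * _ / _ * _) t0 => c; lra.
Qed.

Lemma noise_floor_ge0 : 0 <= Delta.
Proof.
apply: le_trans noise_floor_ge; move: (rho n p) rho0 => r r0.
move: (Deta ^+ 2) (sqr_ge0 Deta) => D2 D20.
have h1 : 0 <= n%:R / (12 * L2) by rewrite divr_ge0// mulr_ge0// ltW.
have h2 : 0 <= 4 * n%:R / (3 * L2) by rewrite divr_ge0 ?mulr_ge0// ltW.
have h3 : 0 <= (N0 n p L2 mu)%:R / (3 * L2 * r).
  by rewrite divr_ge0// mulr_ge0 ?(ltW r0)// mulr_ge0// ltW.
have h4 : 0 <= Dzeta / 4 + 4 * D2 by have := Dz0; lra.
exact: (addr_ge0 (addr_ge0 (mulr_ge0 h1 Dz0) (mulr_ge0 h2 D20)) (mulr_ge0 h3 h4)).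
Qed.

Lemma radius_gt0 k : 0 < Defs.radius n p L2 mu Rp Dzeta Deta k.
Proof.
rewrite sqrtr_gt0 ltr_pwDl//; first by rewrite mulr_gt0 ?invr_gt0 ?exprn_gt0.
rewrite mulr_ge0 ?divr_ge0 ?mulr_ge0 ?noise_floor_ge0 ?(ltW mu0)//.
by rewrite subr_ge0 invf_le1 ?exprn_gt0// exprn_ege1// ler1n.
Qed.

(* The radius cancels because [prox] is homogeneous of degree 2. *)
Lemma scaled_proxE k (u x : 'rV[R]_n) :
  scaled_prox p L2 mu Rp Dzeta Deta k u x = prox p (x - u).
Proof.
have r0 := radius_gt0 k; rewrite /scaled_prox; move: (Defs.radius _ _ _ _ _ _ _ _) r0 => r r0.
have rN a : r ^+ 2 * (r^-1 * a) ^+ 2 = a ^+ 2.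
  by rewrite -exprMn mulrA mulfV ?mul1r ?gt_eqF.
have ka0 : 0 < kappa n :> R by rewrite ltr_pwDl// invr_ge0 ln_ge0// ler1n.
have key c q : 0 < q -> r ^+ 2 * (c * pnorm q (r^-1 *: (x - u)) ^+ 2) =
    c * pnorm q (x - u) ^+ 2.
  move=> q0; rewrite (pnormZ _ _ q0) gtr0_norm ?invr_gt0//.
  by move: (pnorm q _) => a; rewrite mulrCA rN.
by rewrite /prox; case: (p == 1); apply: key.
Qed.

End noise_level.

Section restart_induction.
Context {d' : measure_display} {W : measurableType d'}.
Variable Pr : probability W R.
Variables (e : nat -> nat -> W -> 'rV[R]_n) (xi : nat -> nat -> nat -> W -> X).
Hypothesis sa : sampling P Pr e xi.
Variables (zeta eta : 'rV[R]_n -> X -> 'rV[R]_n -> R) (Dzeta Deta : R).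
Hypothesis on : oracle_noise P zeta eta Dzeta Deta.
Notation oracle := (noisy_oracle g zeta eta).
Notation Delta := (noise_floor n p L2 mu Rp Dzeta Deta).
Notation index := (nat * nat + nat * nat * nat)%type.
Notation "'WS' S" := (g_sigma_algebraType (history e xi S)) (at level 10).
Notation u k w := (rddsc p L2 sigma mu Rp Dzeta Deta oracle
  (fun a b => e a b w) (fun a b i => xi a b i w) x0 k).

Let Dz0 := Dzeta_ge0 on n0.
Let De0 := Deta_ge0 on n0.

(** Twice the bound on the gap is the bound on the squared distance with [k.+1] in place of [k], so
    by strong convexity the conclusion feeds the next restart. *)
Lemma restart_step k :
  measurable_fun [set: WS (draws_before k 0)] ((fun w => u k w) : WS (draws_before k 0) -> borelRn R n) ->
  mean_le Pr (fun w => mu * pnorm p (u k w - xstar) ^+ 2)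
    (mu * Rp ^+ 2 * 2 ^- k + 4 * Delta) ->
  measurable_fun [set: WS (draws_before k.+1 0)]
    ((fun w => u k.+1 w) : WS (draws_before k.+1 0) -> borelRn R n) /\
  mean_le Pr (fun w => f (u k.+1 w) - f xstar)
    (mu * Rp ^+ 2 / 2 * 2 ^- k.+1 + 2 * Delta).
Proof.
move=> mu_ hQ; have mu' := adapted_measurable sa mu_.
have mpn : measurable_fun [set: W] (fun w => pnorm p (u k w - xstar) ^+ 2).
  by apply: measurable_funX; apply: measurable_pnorm; exact: measurable_rowB.
have iQ : integrableR Pr (fun w => pnorm p (u k w - xstar) ^+ 2).
  have := integrableRZ mu^-1 hQ.1.
  by under eq_fun do rewrite mulKf ?gt_eqF//.
have pnC w : pnorm p (xstar - u k w) = pnorm p (u k w - xstar).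
  by rewrite -opprB -scaleN1r pnormZ// normrN1 mul1r.
have hV : mean_le Pr (fun w => prox p (xstar - u k w))
    (Omega n p / 2 * \int[Pr]_w pnorm p (u k w - xstar) ^+ 2).
  have c0 : 0 <= Omega n p / 2 by rewrite divr_ge0// ltW.
  refine (mean_le_ge0 _ _ (mean_leZ c0 (mean_le_self iQ))).
    apply: (measurableT_comp (measurable_prox p)); exact: measurable_rowB.
  move=> w; rewrite -pnC prox_le andbT.
  have := ms_fenchel ms (xstar - u k w) 0.
  by rewrite (ms_dstar0 ms) dotp0r addr0.
have dE w x : scaled_prox p L2 mu Rp Dzeta Deta k (u k w) x = prox p (x - u k w).
  exact: scaled_proxE.
have gap := rdd_gap sa L20 sp on fmin ms n0 rho0 (batch_size_gt0 k) N0_gt0 mu_ hV.1 dE.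
have adp := adapted_rdd sp on ms (batch_size L2 sigma mu Rp k) (N0 n p L2 mu) mu_ dE.
split; first exact: adp.
case: gap => igap gap; split; first exact: igap.
apply: le_trans gap _.
have k0 : 0 < 2 ^+ k :> R by exact: exprn_gt0.
rewrite (_ : mu * Rp ^+ 2 / 2 * 2 ^- k.+1 = mu * Rp ^+ 2 * 2 ^- k / 4); last first.
  by rewrite (exprS _ k); move: (2 ^+ k) k0 => t t0; field; rewrite gt_eqF.
have NR : 0 < (N0 n p L2 mu)%:R :> R by rewrite ltr0n N0_gt0.
have mR : 0 < (batch_size L2 sigma mu Rp k)%:R :> R by rewrite ltr0n batch_size_gt0.
have Q0 : 0 <= \int[Pr]_w pnorm p (u k w - xstar) ^+ 2.
  by apply: Rintegral_ge0 => w _; exact: sqr_ge0.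
have hQ2 : mu * \int[Pr]_w pnorm p (u k w - xstar) ^+ 2 <=
    mu * Rp ^+ 2 * 2 ^- k + 4 * Delta.
  by case: hQ => _; rewrite RintegralZl.
have R20 : 0 < Rp ^+ 2 by exact: exprn_gt0.
have h0 : 0 < 2 ^- k :> R by rewrite invr_gt0.
exact: (restart_arith nR rho0 L20 Om0 mu0 R20 h0 NR mR Dz0 (sqr_ge0 Deta) Q0
  N0_ge (batch_size_ge k) (noise_floor_ge Dz0 De0) hV.2 hQ2).
Qed.

Lemma gap_rddsc k : (1 <= k)%N ->
  mean_le Pr (fun w => f (u k w) - f xstar) (mu * Rp ^+ 2 / 2 * 2 ^- k + 2 * Delta).
Proof.
have Delta0 := noise_floor_ge0 Dz0 De0.
have mf := measurable_objective L20 sp.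
(* At the start only a distance is known and no gap. The invariant is therefore about the distance,
   and the gap is read off after at least one run. *)
suff inv j : measurable_fun [set: WS (draws_before j 0)]
      ((fun w => u j w) : WS (draws_before j 0) -> borelRn R n) /\
    mean_le Pr (fun w => mu * pnorm p (u j w - xstar) ^+ 2)
      (mu * Rp ^+ 2 * 2 ^- j + 4 * Delta).
  by case: k => // k _; have [mu_ hQ] := inv k; exact: (restart_step mu_ hQ).2.
elim: j => [|j [mu_ hQ]].
  split; first exact: measurable_cst.
  rewrite /mean_le /=; split; first exact: (integrableR_cst Pr (mu * pnorm p (x0 - xstar) ^+ 2)).
  rewrite Rintegral_prob_cst expr0 invr1 mulr1.
  have := ler_wpM2l (ltW mu0) x0R => h; apply: le_trans h _.
  by rewrite lerDl mulr_ge0.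
have [mu1 hgap] := restart_step mu_ hQ; split => //.
have m1 : measurable_fun [set: W] (fun w => mu * pnorm p (u j.+1 w - xstar) ^+ 2).
  apply: measurable_funM => //; apply: measurable_funX; apply: measurable_pnorm.
  by apply: measurable_rowB => //; exact: (adapted_measurable sa mu1).
rewrite (_ : mu * Rp ^+ 2 * 2 ^- j.+1 + 4 * Delta =
  2 * (mu * Rp ^+ 2 / 2 * 2 ^- j.+1 + 2 * Delta)); last first.
  by move: (2 ^- j.+1) Delta => a b; field.
refine (mean_le_ge0 m1 _ (mean_leZ (ler0n _ 2) hgap)) => w.
rewrite mulr_ge0 ?sqr_ge0 ?(ltW mu0)//=.
have := gap_strongly_convex (u j.+1 w).
by move: (pnorm p _ ^+ 2) (f _) => a b; lra.
Qed.

End restart_induction.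
End restarts.

Section parameter_bounds.
Context {R : realType}.
Variables (n : nat) (p : R).
Hypothesis n8 : (8 <= n)%N.
Hypothesis p12 : p = 1 \/ p = 2.

Let n0 : 0 < n%:R :> R. Proof. by rewrite ltr0n (leq_trans _ n8). Qed.
Let L32 : 3 / 2 <= ln (n%:R : R) := ln_ge_3_2 n8.

Lemma p_gt0 : 0 < p.
Proof. by case: p12 => ->. Qed.

Lemma Omega_ge1 : 1 <= Omega n p.
Proof. by case: p12 => ->; [exact: Omega1_ge1|rewrite Omega2]. Qed.

(** The product n rho is 16 ln n - 8 for p = 1 and n for p = 2; its comparison with n^(2/q) is the
    source of the logarithmic factor in the complexity. *)
Lemma rho_bounds : 0 < rho n p /\
  1 <= n%:R * rho n p <= 16 * ln (n%:R : R) * n%:R `^ two_over_q p.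
Proof.
case: p12 => ->.
  rewrite two_over_q1 powRr0 mulr1 rho1// (mulrC (n%:R : R)) divfK ?gt_eqF//; split.
    by rewrite divr_gt0//; have := L32; lra.
  by apply/andP; split; have := L32; lra.
rewrite two_over_q2 powRr1 ?(ltW n0)// rho2// mulr1; split => //.
rewrite ler1n (leq_trans _ n8)//=; apply: ler_peMl; first exact: ltW.
by have := L32; lra.
Qed.

(** For p = 1 the [kappa]-norm is at most the 1-norm, because kappa >= 1. *)
Lemma prox_le (z : 'rV[R]_n) : prox p z <= Omega n p / 2 * pnorm p z ^+ 2.
Proof.
case: p12 => ->; last by rewrite /prox (_ : 2 == 1 = false) ?Omega2 ?div1r//; apply/eqP; lra.
have k1 : 1 <= kappa n :> R by rewrite /kappa lerDl invr_ge0; have := L32; lra.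
rewrite prox1E; move: (pnorm_le_pnorm1 z k1) (pnorm_ge0 (kappa n) z) (Omega1_ge1 (R := R) n8).
move: (pnorm (kappa n) z) (pnorm 1 z) (Omega n 1) => a b O ab a0 O1.
apply: ler_wpM2l; first by lra.
by rewrite ler_sqr ?nnegrE// (le_trans a0).
Qed.

Lemma mirror_setup_prox : exists dstar N M,
  mirror_setup (@prox R n p) dstar N M (rho n p).
Proof.
case: p12 => ->; first by do 3 eexists; exact: mirror_setup1.
by do 3 eexists; exact: mirror_setup2.
Qed.

End parameter_bounds.

Lemma pnorm_delta {R : realType} (n : nat) (p : R) (i : 'I_n) : 0 < p ->
  pnorm p (delta_mx 0 i : 'rV[R]_n) = 1.
Proof.
move=> p0; rewrite /pnorm (bigD1 i)//= big1 ?addr0 ?mxE ?eqxx ?normr1 ?powR1//.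
by move=> j ji; rewrite mxE/= (negPf ji) normr0 powR0// gt_eqF.
Qed.

(** * Counting the oracle calls *)

Section complexity.
Context {R : realType}.

Lemma geometric_sum_le K : \sum_(k < K) 2 ^+ k <= 2 ^+ K :> R.
Proof.
elim: K => [|K IH]; first by rewrite big_ord0 exprn_ge0.
by rewrite big_ord_recr/= exprS mulr_natl mulr2n lerD2r.
Qed.

Lemma exists_log2 (B : R) : 2 <= B ->
  exists K : nat, [/\ (1 <= K)%N, B <= 2 ^+ K, 2 ^+ K <= 2 * B &
    K%:R <= 2 * (ln B / ln 2)].
Proof.
move=> B2; have B0 : 0 < B by lra.
have ex : exists K : nat, B <= 2 ^+ K.
  exists (natceil B); apply: le_trans (natceil_ge (ltW B0)) _.
  by rewrite -natrX ler_nat ltnW// ltn_expl.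
case: (ex_minnP ex) => K BK minK.
have K0 : (0 < K)%N by case: K BK {minK} => //; rewrite expr0; lra.
have K2 : 2 ^+ K <= 2 * B.
  case: K K0 BK minK => // K _ BK minK; rewrite exprS ler_pM2l// ltW// ltNge.
  by apply/negP => /minK; rewrite ltnn.
exists K; split => //.
have l2 : 0 < ln (2 : R) by rewrite ln_gt0// ltr1n.
rewrite mulrA ler_pdivlMr// mulrC.
have : ln (2 ^+ K) <= ln (2 * B) by rewrite ler_ln// posrE ?exprn_gt0// mulr_gt0.
rewrite lnXn// lnM ?posrE// -[_ *+ K]mulr_natr => h.
have : ln 2 <= ln B by rewrite ler_ln// posrE.
by lra.
Qed.

(** Read [T] as n^(2/q), [Lg] as ln n, [nr] as n rho, [pK] as 2^K and [lg] as log2 B. For B = mu R2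
    / eps the quotient R2 mu / B is eps, which turns the growing part of the batches into the
    variance term of the bound. *)
Lemma oracle_calls_arith (T Lg A L2 Om mu R2 sg N0 K pK B lg nr calls : R) :
  0 < T -> 0 < L2 -> 0 < Om -> 0 < mu -> 0 < R2 -> 0 <= sg -> 0 < B -> 0 <= lg ->
  A = nr * L2 * Om / mu -> nr <= 16 * Lg * T -> 0 <= nr ->
  0 <= N0 <= 4096 * A -> calls <= N0 * (K + 16 * sg * pK / (L2 * mu * R2)) ->
  K <= 2 * lg -> pK <= 2 * B ->
  calls <= 4096 * 16 * Lg * (2 * (T * L2 * Om / mu * lg) +
    32 * (T * sg * Om / (mu * (R2 * mu / B)))).
Proof.
move=> T0 L20 Om0 mu0 R20 sg0 B0 lg0 AE hnr nr0 /andP[N00 hN] hc hK hpK.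
apply: le_trans hc _; have A0 : 0 <= A by rewrite AE divr_ge0 ?mulr_ge0// ltW.
have D0 : 0 < L2 * mu * R2 by rewrite !mulr_gt0.
have h1 : K + 16 * sg * pK / (L2 * mu * R2) <= 2 * lg + 32 * (sg * B / (L2 * mu * R2)).
  apply: lerD => //; rewrite mulrA ler_wpM2r ?invr_ge0 ?(ltW D0)//.
  by have := ler_wpM2l sg0 hpK; lra.
have s0 : 0 <= 2 * lg + 32 * (sg * B / (L2 * mu * R2)).
  by rewrite addr_ge0 ?mulr_ge0 ?invr_ge0// ltW.
apply: le_trans (ler_wpM2l N00 h1) _; apply: le_trans (ler_wpM2r s0 hN) _.
have -> : 4096 * A * (2 * lg + 32 * (sg * B / (L2 * mu * R2))) =
    4096 * (nr * (2 * (L2 * Om / mu * lg) + 32 * (sg * Om / (mu * (R2 * mu / B))))).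
  by rewrite AE; field; rewrite !gt_eqF.
have -> : 4096 * 16 * Lg * (2 * (T * L2 * Om / mu * lg) +
      32 * (T * sg * Om / (mu * (R2 * mu / B)))) =
    4096 * ((16 * Lg * T) * (2 * (L2 * Om / mu * lg) + 32 * (sg * Om / (mu * (R2 * mu / B))))).
  by field; rewrite !gt_eqF.
apply: (ler_wpM2l (ler0n _ _)); apply: ler_wpM2r hnr.
by rewrite addr_ge0 ?mulr_ge0 ?invr_ge0 ?mulr_ge0 ?invr_ge0// ltW.
Qed.

End complexity.

Section complexity_parameters.
Context {R : realType} {n : nat}.
Variables (L2 sigma mu Rp p : R).
Hypothesis L20 : 0 < L2.
Hypothesis mu0 : 0 < mu.
Hypothesis Rp0 : 0 < Rp.
Hypothesis n0 : (0 < n)%N.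
Hypothesis rho0 : 0 < rho n p.
Hypothesis Om1 : 1 <= Omega n p.

Let Om0 : 0 < Omega n p. Proof. exact: lt_le_trans Om1. Qed.

(** The hypotheses force A = n rho L2 Omega / mu to be at least 1/2, so rounding up is absorbed:
    3072 A + 1 <= 4096 A. *)
Lemma N0_le : 1 <= n%:R * rho n p -> mu <= 2 * L2 ->
  (N0 n p L2 mu)%:R <= 4096 * (n%:R * rho n p * L2 * Omega n p / mu).
Proof.
move=> nr1 mu2; have N00 := N0_ratio_gt0 L20 mu0 n0 rho0 Om0.
apply: le_trans (natceil_le (ltW N00)) _.
have A2 : 2^-1 <= n%:R * rho n p * L2 * Omega n p / mu.
  rewrite ler_pdivlMr//; apply: (@le_trans _ _ (1 * L2 * 1)); first by rewrite mul1r mulr1; lra.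
  apply: ler_pM => //; first by rewrite mulr_ge0// ltW.
  by apply: ler_wpM2r nr1; exact: ltW.
rewrite (_ : 8 * _ * _ * _ / _ = 3072 * (n%:R * rho n p * L2 * Omega n p / mu)); last by ring.
by move: (_ / mu) A2 => A; lra.
Qed.

(** A batch has size at most 1 + c 2^k; summed over the runs, the first part gives K and the
    geometric part at most c 2^K. *)
Lemma oracle_calls_le K : (1 <= K)%N ->
  (oracle_calls n p L2 sigma mu Rp K)%:R <= (N0 n p L2 mu)%:R *
    (K%:R + 16 * sigma ^+ 2 * 2 ^+ K / (L2 * mu * Rp ^+ 2)).
Proof.
move=> K1; rewrite /oracle_calls natr_sum.
pose c := 16 * sigma ^+ 2 / (L2 * mu * Rp ^+ 2).
have c0 : 0 <= c.
  by move: (sigma ^+ 2) (sqr_ge0 sigma) @c => s s0 c; rewrite divr_ge0 ?mulr_ge0 ?exprn_ge0// ltW.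
have bk k : (batch_size L2 sigma mu Rp k)%:R <= 1 + c * 2 ^+ k.
  have z0 : 0 <= 8 * 2 * sigma ^+ 2 * 2 ^+ k / (L2 * mu * Rp ^+ 2).
    exact: batch_ratio_ge0.
  have := natceil_le z0; rewrite /batch_size natr_max.
  rewrite (_ : 8 * 2 * sigma ^+ 2 * 2 ^+ k / (L2 * mu * Rp ^+ 2) = c * 2 ^+ k) => [h|].
    by rewrite ge_max lerDl mulr_ge0 ?exprn_ge0//= addrC.
  by rewrite /c; ring.
rewrite (eq_bigr (fun k : 'I_K => (N0 n p L2 mu)%:R * (batch_size L2 sigma mu Rp k)%:R)); last first.
  by move=> k _; rewrite natrM.
rewrite -mulr_sumr ler_wpM2l//.
apply: (@le_trans _ _ (\sum_(k < K) (1 + c * 2 ^+ k))); first exact: ler_sum.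
rewrite big_split/= sumr_const card_ord -mulr_sumr lerD2l.
have -> : 16 * sigma ^+ 2 * 2 ^+ K / (L2 * mu * Rp ^+ 2) = c * 2 ^+ K by rewrite /c; ring.
by rewrite ler_wpM2l// geometric_sum_le.
Qed.

(** With Dzeta = t^2 and Deta = t the noise floor becomes a polynomial in t without constant term,
    at most t S for t <= 1. The factors 5/2 and 25/4 are 1/2 + 2 and its square. *)
Lemma exists_small_noise eps : 0 < eps -> exists Dzeta Deta : R,
  [/\ 0 < Dzeta, 0 < Deta &
      2 * noise_floor n p L2 mu Rp Dzeta Deta <= eps / 2].
Proof.
move=> eps0; pose b := 8 * Num.sqrt (2 * n%:R * Rp ^+ 2 * Omega n p) / (N0 n p L2 mu)%:R.
pose a := n%:R / (12 * L2) + 4 * n%:R / (3 * L2).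
pose c := (N0 n p L2 mu)%:R / (3 * L2 * rho n p).
pose S := a + b * (5 / 2) + c * (25 / 4).
have a0 : 0 <= a by rewrite addr_ge0 ?divr_ge0 ?mulr_ge0// ltW.
have b0 : 0 <= b by rewrite divr_ge0// mulr_ge0// sqrtr_ge0.
have c0 : 0 <= c.
  by rewrite /c; move: (rho n p) rho0 => r r0; rewrite divr_ge0 ?mulr_ge0// ltW.
have S0 : 0 <= S by rewrite /S; lra.
have Se : 0 < S + eps / 4 by lra.
(* This choice gives both t <= 1 and t S <= eps / 4, also if S = 0. *)
pose t := eps / 4 / (S + eps / 4).
have t0 : 0 < t by rewrite divr_gt0//; lra.
have t1 : t <= 1 by rewrite ler_pdivrMr// mul1r; lra.
have tS : t * S <= eps / 4.
  by rewrite mulrAC ler_pdivrMr// ler_wpM2l//; lra.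
exists (t ^+ 2), t; split; rewrite ?exprn_gt0//.
have -> : noise_floor n p L2 mu Rp (t ^+ 2) t =
    a * t ^+ 2 + b * (5 / 2) * t + c * (25 / 4) * t ^+ 2.
  rewrite /noise_floor sqrtr_sqr ger0_norm ?(ltW t0)// -/b -/c /a.
  have key (a1 a2 b' c' s : R) : a1 * s ^+ 2 + a2 * s ^+ 2 + b' * (s / 2 + 2 * s) +
      c' * (s / 2 + 2 * s) ^+ 2 = (a1 + a2) * s ^+ 2 + b' * (5 / 2) * s + c' * (25 / 4) * s ^+ 2.
    by field.
  exact: key.
have t2 : t ^+ 2 <= t by rewrite expr2 ler_piMl// ltW.
have h1 := ler_wpM2l a0 t2; have h2 := ler_wpM2l c0 t2.
have : a * t ^+ 2 + b * (5 / 2) * t + c * (25 / 4) * t ^+ 2 <= t * S.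
  by rewrite /S; clear -h1 h2; lra.
by clear -tS; lra.
Qed.

End complexity_parameters.

(** Strong convexity and the quadratic upper bound are compared along a basis vector, which has
    p-norm 1 for every p. The result serves to absorb the rounding in [N0]. *)
Lemma strong_convexity_le_smoothness {R : realType} {n : nat} {d : measure_display}
    {X : measurableType d} (P : probability X R) (F : 'rV[R]_n -> X -> R)
    (g : 'rV[R]_n -> X -> 'rV[R]_n) (L : X -> R) (L2 sigma mu p : R) :
  0 < L2 -> stochastic_problem P F g L L2 sigma -> (0 < n)%N -> 0 < p ->
  strongly_convex p mu (objective P F) -> mu <= 2 * L2.
Proof.
move=> L20 sp n0 p0 sc; pose h : 'rV[R]_n := delta_mx 0 (Ordinal n0).
have /andP[_ up] := objective_bounds L20 sp 0 h.
have := sc 0 (0 + h); rewrite (addrC 0) addrK pnorm_delta// expr1n.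
move: up; rewrite (addrC 0) dotp_delta_delta.
by move: (objective P F _) (objective P F _) (dotp _ _) => a b c; lra.
Qed.

Theorem theorem2p5 :
  exists C c : nat,
  forall (R : realType) (n : nat) (p : R)
    (d : measure_display) (X : measurableType d) (P : probability X R)
    (F : 'rV[R]_n -> X -> R) (g : 'rV[R]_n -> X -> 'rV[R]_n) (L : X -> R)
    (L2 sigma mu Rp : R) (xstar x0 : 'rV[R]_n),
  let f := objective P F in
  (8 <= n)%N -> p = 1 \/ p = 2 -> 0 < L2 -> 0 < mu -> 0 < Rp ->
  stochastic_problem P F g L L2 sigma ->
  strongly_convex p mu f ->
  (forall x, f xstar <= f x) ->
  pnorm p (x0 - xstar) ^+ 2 <= Rp ^+ 2 ->
  let Delta := noise_floor n p L2 mu Rp in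
  let error (Dzeta Deta : R) (zeta eta : 'rV[R]_n -> X -> 'rV[R]_n -> R)
      (d' : measure_display) (W : measurableType d') (Pr : probability W R)
      (e : nat -> nat -> W -> 'rV[R]_n) (xi : nat -> nat -> nat -> W -> X)
      (K : nat) : \bar R :=
    ('E_Pr[fun w => f (rddsc p L2 sigma mu Rp Dzeta Deta
                         (noisy_oracle g zeta eta)
                         (fun k j => e k j w) (fun k j i => xi k j i w) x0 K)]
     - (f xstar)%:E)%E in
  (forall (Dzeta Deta : R) (zeta eta : 'rV[R]_n -> X -> 'rV[R]_n -> R)
      (d' : measure_display) (W : measurableType d') (Pr : probability W R)
      (e : nat -> nat -> W -> 'rV[R]_n) (xi : nat -> nat -> nat -> W -> X)
      (K : nat),
    oracle_noise P zeta eta Dzeta Deta -> sampling P Pr e xi -> (1 <= K)%N ->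
    (error Dzeta Deta zeta eta d' W Pr e xi K
     <= (mu * Rp ^+ 2 / 2 * 2 ^- K + 2 * Delta Dzeta Deta)%:E)%E)
  /\
  (forall eps : R, 0 < eps ->
    (exists Dzeta Deta : R,
      [/\ 0 < Dzeta, 0 < Deta & 2 * Delta Dzeta Deta <= eps / 2]) /\
    exists K : nat,
      [/\ (1 <= K)%N,
          forall (Dzeta Deta : R) (zeta eta : 'rV[R]_n -> X -> 'rV[R]_n -> R)
            (d' : measure_display) (W : measurableType d')
            (Pr : probability W R)
            (e : nat -> nat -> W -> 'rV[R]_n)
            (xi : nat -> nat -> nat -> W -> X),
          2 * Delta Dzeta Deta <= eps / 2 ->
          oracle_noise P zeta eta Dzeta Deta -> sampling P Pr e xi ->
          (error Dzeta Deta zeta eta d' W Pr e xi K <= eps%:E)%E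
        & (oracle_calls n p L2 sigma mu Rp K)%:R
          <= C%:R * ln (n%:R : R) ^+ c
             * complexity_bound n p L2 sigma mu Rp
                 (Num.min eps (mu * Rp ^+ 2 / 2))]).
Proof.
(* [N0 <= 4096 * (n rho L2 Omega / mu)], [n rho <= 16 ln n n^(2/q)] and
   [34 = 2 + 32], where [2] comes from [K <= 2 log2 B] and [32] from
   [2 ^ K <= 2 B] together with the factor 16 of the batch sizes. *)
exists (4096 * 16 * 34)%N, 1%N => R n p d X P F g L L2 sigma mu Rp xstar x0 f
  n8 p12 L20 mu0 Rp0 sp sc fmin x0R Delta error.
have n0 : (0 < n)%N by exact: leq_trans n8.
have p0 := p_gt0 p12.
have [rho0 /andP[nr1 nrT]] := rho_bounds n8 p12.
have Om1 := Omega_ge1 n8 p12; have Om0 : 0 < Omega n p by exact: lt_le_trans Om1.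
have [dstar [N [M ms]]] := mirror_setup_prox n8 p12.
have main (Dzeta Deta : R) zeta eta d' W Pr e xi K :
    oracle_noise P zeta eta Dzeta Deta -> sampling P Pr e xi -> (1 <= K)%N ->
    (error Dzeta Deta zeta eta d' W Pr e xi K
     <= (mu * Rp ^+ 2 / 2 * 2 ^- K + 2 * Delta Dzeta Deta)%:E)%E.
  move=> on sa K1.
  have [igap gap] := gap_rddsc L20 sp mu0 Rp0 p0 n0 rho0 Om0 sc fmin x0R
    (prox_le n8 p12) ms sa on K1.
  (* Adding the constant back shows that f (u_K) is integrable, so its extended expectation is
     finite and the difference is the mean gap. *)
  have iu := integrableRD igap (integrableR_cst Pr (f xstar)).
  move: iu; under eq_fun do rewrite subrK; move=> iu.
  rewrite /error unlock -(RintegralE iu) -EFinB lee_fin.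
  apply: le_trans gap; rewrite RintegralB//; last exact: integrableR_cst.
  by rewrite Rintegral_prob_cst.
split; first exact: main.
move=> eps eps0; split; first exact: exists_small_noise.
(* [K] is chosen for this smaller accuracy, which ensures B >= 2 and thus log2 B >= 1. *)
set eps' := Num.min eps (mu * Rp ^+ 2 / 2).
have R20 : 0 < Rp ^+ 2 by exact: exprn_gt0.
have eps'0 : 0 < eps' by rewrite lt_min eps0/= divr_gt0// mulr_gt0.
have eps'le : eps' <= eps by rewrite ge_min lexx.
pose B := mu * Rp ^+ 2 / eps'.
have B2 : 2 <= B.
  rewrite ler_pdivlMr//; have : eps' <= mu * Rp ^+ 2 / 2 by rewrite ge_min lexx orbT.
  by lra.
have [K [K1 BK KB Klg]] := exists_log2 B2.
exists K; split => //.
  move=> Dzeta Deta zeta eta d' W Pr e xi hD on sa.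
  apply: le_trans (main _ _ _ _ _ _ _ _ _ _ on sa K1) _; rewrite lee_fin.
  (* Since 2^K >= B, the initial distance takes at most half of [eps]; the noise takes the other
     half. *)
  have : mu * Rp ^+ 2 / 2 * 2 ^- K <= eps / 2.
    rewrite ler_pdivrMr ?exprn_gt0//.
    move: BK; rewrite ler_pdivrMr// => BK.
    have := ler_wpM2l (exprn_ge0 K (ler0n R 2)) eps'le.
    by move: (2 ^+ K * eps') (mu * Rp ^+ 2) BK => a b ba; rewrite mulrAC => ab; lra.
  by lra.
have mu2 := strong_convexity_le_smoothness L20 sp n0 p0 sc.
have T0 : 0 < n%:R `^ two_over_q p by apply: powR_gt0; rewrite ltr0n.
have B0 : 0 < B by lra.
have l2 : 0 < ln (2 : R) by rewrite ln_gt0// ltr1n.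
have lg0 : 0 <= ln B / ln 2 by rewrite divr_ge0 ?(ltW l2)// ln_ge0//; lra.
have Ln0 : 0 <= ln (n%:R : R) by rewrite ln_ge0// ler1n.
have N0b : 0 <= ((N0 n p L2 mu)%:R : R) <= 4096 * (n%:R * rho n p * L2 * Omega n p / mu).
  by apply/andP; split; [exact: ler0n|exact: N0_le].
have nr0 : 0 <= n%:R * rho n p by exact: le_trans nr1.
have calls := oracle_calls_arith T0 L20 Om0 mu0 R20 (sqr_ge0 sigma) B0 lg0 erefl nrT nr0
  N0b (oracle_calls_le sigma p L20 mu0 Rp0 K1) Klg KB.
apply: le_trans calls _.
rewrite (_ : Rp ^+ 2 * mu / B = eps'); last first.
  by rewrite /B invf_div mulrCA (mulrC mu) divff ?mulr1// gt_eqF// mulr_gt0.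
rewrite /complexity_bound -/B expr1 !natrM.
move: (_ * (ln B / ln 2)) (_ / (mu * eps')) => M1 M2.
have le1 : M1 <= Num.max M1 M2 by rewrite le_max lexx.
have le2 : M2 <= Num.max M1 M2 by rewrite le_max lexx orbT.
move: (Num.max M1 M2) le1 le2 => m le1 le2.
have -> : 4096 * 16 * 34 * ln n%:R * m = 4096 * 16 * ln n%:R * (34 * m) by ring.
apply: ler_wpM2l; last by lra.
by apply: mulr_ge0 Ln0; apply: mulr_ge0; exact: ler0n.
Qed.
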